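(* Let $X_1,\dots,X_n$ be bounded real random variables on a probability space $(\Omega,\mathbb{P})$. If $H(X_i)>-\infty$ for all $1\le i\le n$, then $$I_{\mathrm{sym}}(X_1,\dots,X_n)=\overline{I}_{\mathrm{sym}}(X_1,\dots,X_n)=S(\mu_{(X_1,\dots,X_n)},\mu_{X_1}\otimes\dots\otimes\mu_{X_n}).$$
   Context: Entropy. For a bounded real random variable $X$, the Boltzmann-Gibbs entropy is $H(X):=-\int_{\mathbb{R}}p\log p\,dx$ if $X$ has a density $p$ with respect to Lebesgue measure, and $H(X):=-\infty$ otherwise; its value lies in $[-\infty,\infty)$. Relative entropy. $\mu_{(X_1,\dots,X_n)}$ is the joint distribution measure of $(X_1,\dots,X_n)$ on $\mathbb{R}^n$ and $\mu_{X_i}$ the distribution of $X_i$ on $\mathbb{R}$. $S(\mu,\nu):=\int\log\frac{d\mu}{d\nu}\,d\mu$ if $\mu$ is absolutely continuous with respect to $\nu$, and $S(\mu,\nu):=+\infty$ otherwise. Micro-states. $\mathbb{R}_\le^N$ is the set of $\mathbf{x}=(x_1,\dots,x_N)\in\mathbb{R}^N$ with $x_1\le\dots\le x_N$. $\mathbb{R}^N$ is an algebra under the pointwise product, and $\kappa_N(\mathbf{x}):=\frac1N\sum_{j=1}^Nx_j$. $\mathbb{E}$ is the expectation on $(\Omega,\mathbb{P})$. For $N,m\in\mathbb{N}$, $\delta>0$, let $\Delta(X_1,\dots,X_n;N,m,\delta)$ be the set of $(\mathbf{x}_1,\dots,\mathbf{x}_n)\in(\mathbb{R}^N)^n$ such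 that $$|\kappa_N(\mathbf{x}_{i_1}\cdots\mathbf{x}_{i_k})-\mathbb{E}(X_{i_1}\cdots X_{i_k})|<\delta$$ for all $1\le i_1,\dots,i_k\le n$ and $1\le k\le m$. For $R>0$ let $\Delta_R(X_1,\dots,X_n;N,m,\delta)$ be the subset of those with $\mathbf{x}_i\in[-R,R]^N$ for all $i$; put $\Delta_\infty:=\Delta$. Permutations. $S_N$ is the group of permutations of $\{1,\dots,N\}$, acting on $\mathbb{R}^N$ by $\sigma(\mathbf{x}):=(x_{\sigma^{-1}(1)},\dots,x_{\sigma^{-1}(N)})$; $\gamma_{S_N}$ is the uniform probability measure on $S_N$, and $\gamma_{S_N}^{\otimes n}$ the product measure on $S_N^n$. For $R\in(0,\infty]$, $\Delta_{\mathrm{sym},R}(X_1,\dots,X_n;N,m,\delta)$ is the set of $(\sigma_1,\dots,\sigma_n)\in S_N^n$ such that $(\sigma_1(\mathbf{x}_1),\dots,\sigma_n(\mathbf{x}_n))\in\Delta_R(X_1,\dots,X_n;N,m,\delta)$ for some $(\mathbf{x}_1,\dots,\mathbf{x}_n)\in(\mathbb{R}_\le^N)^n$. Define (with $\log0=-\infty$) $$I_{\mathrm{sym},R}(X_1,\dots,X_n):=-\lim_{m\to\infty,\delta\searrow0}\limsup_{N\to\infty}\frac1N\log\gamma_{S_N}^{\otimes n}\bigl(\Delta_{\mathrm{sym},R}(X_1,\dots,X_n;N,m,\delta)\bigr),$$ and $\overline{I}_{\mathrm{sym},R}(X_1,\dots,X_n)$ by replacing $\limsup$ by $\liminf$. (The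 inner quantity is nonincreasing in $m$ and nondecreasing in $\delta$, so the limit exists in $[-\infty,0]$; values of $I$ lie in $[0,\infty]$.) Also, for each $i$ let $\xi_i=\{\xi_i(N)\}_{N\in\mathbb{N}}$, $\xi_i(N)\in\mathbb{R}_\le^N$, be a sequence with $\kappa_N(\xi_i(N)^k)\to\mathbb{E}(X_i^k)$ as $N\to\infty$ for all $k\in\mathbb{N}$. $I_{\mathrm{sym}}(X_1,\dots,X_n:\xi_1,\dots,\xi_n)$ and $\overline{I}_{\mathrm{sym}}(X_1,\dots,X_n:\xi_1,\dots,\xi_n)$ are defined by the same formulas with the set of $(\sigma_1,\dots,\sigma_n)\in S_N^n$ such that $(\sigma_1(\xi_1(N)),\dots,\sigma_n(\xi_n(N)))\in\Delta(X_1,\dots,X_n;N,m,\delta)$ in place of $\Delta_{\mathrm{sym},R}$. The paper shows that $I_{\mathrm{sym},\infty}$, $I_{\mathrm{sym},R}$ for any $R>0$ with $R\ge\max_i\|X_i\|_\infty$, and $I_{\mathrm{sym}}(\,\cdot:\xi_1,\dots,\xi_n)$ for any such $\xi_i$ all coincide; the common value is denoted $I_{\mathrm{sym}}(X_1,\dots,X_n)$. Likewise for the barred quantities, with common value $\overline{I}_{\mathrm{sym}}(X_1,\dots,X_n)$. *)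

(* Defs.v *)
From HB Require Import structures.
From mathcomp Require Import all_boot all_order all_algebra all_fingroup.
From mathcomp Require Import all_classical all_reals all_analysis.

Set Implicit Arguments.
Unset Strict Implicit.
Unset Printing Implicit Defensive.

Import Order.TTheory GRing.Theory Num.Theory.
Import numFieldNormedType.Exports.

Local Open Scope classical_set_scope.
Local Open Scope ring_scope.
Local Open Scope charge_scope.

Section Entropy.
Context d (T : measurableType d) (R : realType) (P : probability T R).

Definition is_density (X : {RV P >-> R}) (p : R -> R) : Prop :=
  [/\ measurable_fun [set: R] p, (forall x, 0 <= p x) &
   forall A : set R, measurable A ->
     distribution P X A = (\int[lebesgue_measure]_(x in A) (p x)%:E)%E].

(* Densities are equal almost everywhere, so the choice made by [xget] is
   irrelevant; [ln 0 = 0] gives the convention 0 log 0 = 0. *)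
Definition entropy (X : {RV P >-> R}) : \bar R :=
  if `[< exists p, is_density X p >] then
    let p := xget (cst 0) [set p | is_density X p] in
    (- \int[lebesgue_measure]_(x in [set: R]) (p x * ln (p x))%:E)%E
  else -oo%E.

End Entropy.

(* [lne y = -oo] for [y <= 0]; the Radon-Nikodym derivative of [mu] is positive
   [mu]-almost everywhere. *)
Definition relative_entropy d (T : measurableType d) (R : realType)
    (mu nu : probability T R) : \bar R :=
  if `[< mu `<< nu >] then
    (\int[mu]_x lne (('d (charge_of_finite_measure mu) '/d nu) x))%E
  else +oo%E.

Section ProductProbability.
Context d (T : measurableType d) (R : realType).

Definition tuple_cons n (x : T * n.-tuple T) : n.+1.-tuple T :=
  [tuple of x.1 :: x.2].

Lemma measurable_tuple_cons n : measurable_fun [set: _] (@tuple_cons n).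
Proof. exact: measurable_cons. Qed.

HB.instance Definition _ n := isMeasurableFun.Build _ _ _ _ (@tuple_cons n)
  (@measurable_tuple_cons n).

Fixpoint product_probability n : ('I_n -> probability T R) ->
    probability (n.-tuple T) R :=
  match n with
  | 0 => fun _ => \d_([tuple] : 0.-tuple T)
  | n'.+1 => fun mu => distribution
      (mu ord0 \x product_probability (fun i => mu (lift ord0 i)))%E
      (@tuple_cons n')
  end.

Lemma product_probability_rect n (mu : 'I_n -> probability T R)
    (A : 'I_n -> set T) : (forall i, measurable (A i)) ->
  product_probability mu [set t | forall i, A i (tnth t i)] =
  (\prod_(i < n) mu i (A i))%E.
Proof.
elim: n mu A => [|n IH] mu A mA /=.
  rewrite big_ord0 diracE mem_set//; by case.
rewrite big_ord_recl -IH// /distribution /pushforward.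
rewrite -product_measure1E//.
  congr (_ _); apply/seteqP; split => -[x t] /=.
    move=> h; split => [|i]; first exact: (h ord0).
    by have := h (lift ord0 i); rewrite /tuple_cons tnthS.
  move=> [hx ht] i; case: (unliftP ord0 i) => [j ->|-> //].
  by rewrite /tuple_cons tnthS.
have -> : [set t : n.-tuple T | forall i, A (lift ord0 i) (tnth t i)] =
    \bigcap_(i in [set: 'I_n]) ((@tnth n T)^~ i @^-1` A (lift ord0 i)).
  by apply/seteqP; split => t /= h i => [_|]; exact: h.
apply: fin_bigcap_measurable => // i _.
by rewrite -[_ @^-1` _]setTI; exact: measurable_tnth.
Qed.

End ProductProbability.

Section JointDistribution.
Context d (T : measurableType d) (R : realType) (P : probability T R) (n : nat).

Definition joint_rv (X : 'I_n -> {RV P >-> R}) (w : T) : n.-tuple R :=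
  [tuple X i w | i < n].

Lemma measurable_joint_rv X : measurable_fun [set: T] (joint_rv X).
Proof.
apply/measurable_fun_tnthP => i.
rewrite (_ : _ \o _ = X i); first exact: measurable_funPT.
by apply/funext => w /=; rewrite tnth_mktuple.
Qed.

HB.instance Definition _ X := isMeasurableFun.Build _ _ _ _ (joint_rv X)
  (measurable_joint_rv X).

Definition joint_distribution X : probability (n.-tuple R) R :=
  distribution P (joint_rv X).

Definition product_of_marginals (X : 'I_n -> {RV P >-> R}) :
    probability (n.-tuple R) R :=
  product_probability (fun i => distribution P (X i)).

End JointDistribution.

Section Microstates.
Context d (T : measurableType d) (R : realType) (P : probability T R) (n : nat).
Variable X : 'I_n -> {RV P >-> R}.

Definition nondecreasing_vec N (x : 'I_N -> R) : Prop :=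
  forall j k : 'I_N, (j <= k)%N -> x j <= x k.

Definition kappa N (x : 'I_N -> R) : R := N%:R^-1 * \sum_(j < N) x j.

Definition perm_vec N (s : 'S_N) (x : 'I_N -> R) : 'I_N -> R :=
  fun j => x ((s^-1)%g j).

Definition Delta N (m : nat) (delta : R) : set ('I_n -> 'I_N -> R) :=
  [set x | forall (k : nat) (i : 'I_k -> 'I_n), (1 <= k <= m)%N ->
     (`| (kappa (fun j => (\prod_(l < k) x (i l) j)%R))%:E
         - 'E_P[fun w => (\prod_(l < k) X (i l) w)%R] | < delta%:E)%E].

(* [r = +oo] gives [Delta]. *)
Definition Delta_cut (r : \bar R) N m delta : set ('I_n -> 'I_N -> R) :=
  Delta m delta `&` [set x | forall i j, (`|x i j|%:E <= r)%E].

Definition Delta_sym (r : \bar R) N m delta : set {ffun 'I_n -> 'S_N} :=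
  [set s | exists2 x : 'I_n -> 'I_N -> R,
     (forall i, nondecreasing_vec (x i)) &
     Delta_cut r m delta (fun i => perm_vec (s i) (x i))].

Definition Delta_sym_at (xi : 'I_n -> forall N, 'I_N -> R) N m delta :
    set {ffun 'I_n -> 'S_N} :=
  [set s | Delta m delta (fun i => perm_vec (s i) (xi i N))].

Definition approximates (xi : 'I_n -> forall N, 'I_N -> R) : Prop :=
  forall i, (forall N, nondecreasing_vec (xi i N)) /\
    forall k : nat, (0 < k)%N ->
      (kappa (fun j => xi i N j ^+ k))%:E @[N --> \oo]
        --> 'E_P[fun w => (X i w ^+ k)%R]%E.

(* The [n]-fold product of the uniform probability on ['S_N]. *)
Definition gamma_prod N (A : set {ffun 'I_n -> 'S_N}) : R :=
  \sum_(s | s \in A) \prod_(i < n) #|{: 'S_N}|%:R^-1.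

Definition log_rate (E : forall N, nat -> R -> set {ffun 'I_n -> 'S_N})
    (m : nat) (delta : R) (N : nat) : \bar R :=
  (N%:R^-1%:E * lne (gamma_prod (E N m delta))%:E)%E.

Definition I_limsup E : \bar R :=
  (- lim (limn_esup (log_rate E md.1 md.2)
            @[md --> filter_prod \oo (0 : R)^'+]))%E.

Definition I_liminf E : \bar R :=
  (- lim (limn_einf (log_rate E md.1 md.2)
            @[md --> filter_prod \oo (0 : R)^'+]))%E.

Definition I_sym (r : \bar R) : \bar R := I_limsup (Delta_sym r).
Definition I_sym_bar (r : \bar R) : \bar R := I_liminf (Delta_sym r).
Definition I_sym_at xi : \bar R := I_limsup (Delta_sym_at xi).
Definition I_sym_bar_at xi : \bar R := I_liminf (Delta_sym_at xi).

End Microstates.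

(* Main.v *)
(* A Sanov-type argument. Finitely many cut points turn every vector into a word
   of labels, and the number of tuples of permutations that give the joint word
   of fixed sorted vectors a prescribed type is a quotient of products of
   factorials. By Stirling's formula, the probability of such a type is
   [exp (- N I)] up to a polynomial factor, where [I] is the mutual information
   of the type. By data processing, and by approximation of measurable sets by
   unions of grid cells, the supremum over all cuts of the mutual information of
   the labels of [X] is the relative entropy [S].
   Upper bound: as the marginals have no atoms (the only use of the entropy
   hypothesis), polynomials that bound cell indicators from above show that the
   moment conditions force the type close to the distribution of the labels
   of [X], and sorted vectors have polynomially many label words.
   Lower bound: sampling [X] gives some microstate of nearly the right type;
   putting the given sorted vectors in the same order changes few labels, and
   on a fine grid the labels determine the moments up to a small error. *)

Require Import Defs.
From mathcomp Require Import all_boot all_order all_algebra all_fingroup.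
From mathcomp Require Import all_classical all_reals all_analysis.
From mathcomp Require Import measurable_realfun ess_sup_inf.
From mathcomp Require Import ring lra zify.

Set Implicit Arguments.
Unset Strict Implicit.
Unset Printing Implicit Defensive.

Import Order.TTheory GRing.Theory Num.Theory.
Import numFieldNormedType.Exports.

Local Open Scope classical_set_scope.
Local Open Scope ring_scope.

(** * Counting permutations of given joint type *)

(** The several definitions of [I_sym] are not assumed to coincide: each is squeezed between the
    same two bounds. The upper one uses only that a microstate is a permuted family of sorted
    vectors; the lower one takes sorted vectors with the right half-line frequencies and small
    tails. The obstacle is unboundedness. With cutoff [+oo], or for given [xi], entries may leave
    the range of [X], and only finitely many moments are controlled. So polynomials must dominate
    indicators on the whole line while being close to them only on the range of [X]. This bounds
    cell frequencies from above; the lower bounds follow because frequencies and probabilities both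
    sum to one. For given [xi], high even moments control the tails. That grids exhaust [S] is
    proved through the Donsker-Varadhan functional [E_mu phi - E_nu exp phi + 1]. A bound on it for
    grid functions passes to measurable layers by approximation, forces absolute continuity, and
    bounds [S] when [phi] is close to a truncated log-likelihood. Finite and infinite [S] are
    treated together. *)

Section Words.
Variable A : finType.

Definition cnt N (w : 'I_N -> A) (a : A) : nat := (\sum_(j < N) (w j == a))%N.

Definition has_type (t : A -> nat) N : pred {ffun 'I_N -> A} :=
  [pred w : {ffun _} | [forall a, cnt w a == t a]].

Lemma has_typeP (t : A -> nat) N (w : {ffun 'I_N -> A}) :
  reflect (cnt w =1 t) (has_type t w).
Proof. by apply: (iffP forallP) => h a; apply/eqP; move/(_ a): h. Qed.

Lemma sum_cnt N (w : 'I_N -> A) : (\sum_a cnt w a)%N = N.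
Proof.
rewrite exchange_big /= -[RHS]card_ord -sum1_card; apply: eq_bigr => j _.
rewrite (bigD1 (w j)) //= eqxx big1 // => a; rewrite eq_sym.
by move/negbTE ->.
Qed.

Lemma eq_cnt N (w w' : 'I_N -> A) : w =1 w' -> cnt w =1 cnt w'.
Proof. by move=> e a; apply: eq_bigr => j _; rewrite e. Qed.

Lemma cnt_perm N (w : 'I_N -> A) (s : 'S_N) : cnt (w \o s) =1 cnt w.
Proof.
by move=> a; rewrite /cnt [RHS](reindex_inj (@perm_inj _ s)).
Qed.

Definition word_cons N (x : A * {ffun 'I_N -> A}) : {ffun 'I_N.+1 -> A} :=
  [ffun i => if unlift ord0 i is Some j then x.2 j else x.1].

Definition word_uncons N (w : {ffun 'I_N.+1 -> A}) : A * {ffun 'I_N -> A} :=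
  (w ord0, [ffun j => w (lift ord0 j)]).

Lemma word_consK N : cancel (@word_cons N) (@word_uncons N).
Proof.
move=> [a w]; rewrite /word_uncons /word_cons ffunE unlift_none /=.
by congr pair; apply/ffunP => j; rewrite !ffunE liftK.
Qed.

Lemma word_unconsK N : cancel (@word_uncons N) (@word_cons N).
Proof.
move=> w; apply/ffunP => i; rewrite ffunE /=.
by case: unliftP => [j ->|->]; rewrite ?ffunE.
Qed.

Lemma cnt_cons N a (w : {ffun 'I_N -> A}) b :
  cnt (word_cons (a, w)) b = ((a == b) + cnt w b)%N.
Proof.
rewrite /cnt big_ord_recl ffunE unlift_none /=; congr addn.
by apply: eq_bigr => j _; rewrite ffunE liftK.
Qed.

(** The multinomial formula, in product form to avoid division. Splitting off the first letter [a]
    leaves a word whose type is [t] lowered by one at [a], and the weights [t a] add up to the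
    length. *)
Lemma card_has_type N (t : A -> nat) : (\sum_a t a)%N = N ->
  (#|@has_type t N| * \prod_a (t a)`!)%N = N`!.
Proof.
elim: N t => [|N IH] t tN.
  have t0 a : t a = 0%N.
    by apply/eqP; move/eqP: tN; rewrite sum_nat_eq0 => /forallP/(_ a)/implyP; exact.
  rewrite big1 ?muln1 => [|a _]; last by rewrite t0.
  rewrite (@eq_card _ _ predT) ?card_ffun ?card_ord// => w.
  by apply/has_typeP => a; rewrite t0 /cnt big_ord0.
rewrite -sum1_card (reindex (@word_cons N)) /=; last first.
  by apply: onW_bij; exists (@word_uncons N); [exact: word_consK|exact: word_unconsK].
under eq_bigl do rewrite inE.
rewrite (reindex (fun x : A * {ffun 'I_N -> A} => (x.1, x.2))) /=; last first.
  by exists id => -[].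
rewrite -(pair_big_dep predT (fun a w => has_type t (word_cons (a, w))) (fun _ _ => 1%N)) /=.
rewrite factS big_distrl /=.
have -> : (N.+1 * N`! = \sum_a t a * N`!)%N by rewrite -tN big_distrl.
apply: eq_bigr => a _.
(* A letter of count zero starts no word of this type, which matches its factor [t a]; for the
   others the truncated subtraction in [t'] is exact. *)
have [ta0|ta0] := eqVneq (t a) 0%N.
  rewrite ta0 mul0n big_pred0 ?mul0n// => w.
  apply/negP => /has_typeP/(_ a); rewrite cnt_cons eqxx ta0 //.
pose t' b := (t b - (a == b))%N.
have ht' b : t b = ((a == b) + t' b)%N.
  by rewrite /t' addnC subnK//; case: eqP => // <-; rewrite lt0n.
rewrite (eq_bigl (@has_type t' N)); last first.
  move=> w; apply/has_typeP/has_typeP => h b.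
    by have := h b; rewrite cnt_cons ht' => /addnI.
  by rewrite cnt_cons ht' h.
have -> : (\prod_b (t b)`! = t a * \prod_b (t' b)`!)%N.
  rewrite (bigD1 a)//= [X in (_ * X)%N = _](_ : _ = \prod_(i | i != a) (t' i)`!)%N; last first.
    by apply: eq_bigr => b; rewrite /t' eq_sym => /negbTE ->; rewrite subn0.
  rewrite [in RHS](bigD1 a)//= mulnA; congr (_ * _)%N.
  by rewrite /t' eqxx subn1; case: (t a) ta0.
rewrite mulnCA sum1_card IH//.
apply/eqP; rewrite -(eqn_add2l 1) add1n; apply/eqP; rewrite -[RHS]tN.
have -> : (\sum_b t b = \sum_b (a == b) + \sum_b t' b)%N.
  by rewrite -big_split; apply: eq_bigr => b _; exact: ht'.
have -> : (\sum_b (a == b) = 1)%N.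
  rewrite (bigD1 a)//= eqxx big1 // => b.
  by rewrite eq_sym => /negbTE ->.
by rewrite add1n.
Qed.

(** Existence is read off the count: an empty class would give [N! = 0]. *)
Lemma word_of_type N (t : A -> nat) : (\sum_a t a)%N = N ->
  exists w : {ffun 'I_N -> A}, cnt w =1 t.
Proof.
move=> /card_has_type h.
have : (0 < #|@has_type t N|)%N.
  by rewrite lt0n; apply/eqP => T0; have := fact_gt0 N; rewrite -h T0.
by case/card_gt0P => w /has_typeP ?; exists w.
Qed.

Lemma perm_of_cnt N (b w : 'I_N -> A) : cnt b =1 cnt w ->
  exists s : 'S_N, forall j, b (s j) = w j.
Proof.
move=> bw.
have : perm_eq [tuple w j | j < N] [tuple b j | j < N].
  apply/allP => a _ /=; rewrite eq_sym; apply/eqP.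
  have E (v : 'I_N -> A) : count_mem a (map v (enum 'I_N)) = cnt v a.
    rewrite count_map -sum1_count big_mkcond /= big_enum /cnt /=.
    by apply: eq_bigr => j _; case: eqP.
  by rewrite !E.
move/tuple_permP => [s /val_inj hs]; exists s => j.
by have := congr1 (fun u => tnth u j) hs; rewrite !tnth_mktuple.
Qed.

Definition carries N (b w : 'I_N -> A) : pred 'S_N :=
  [pred s : 'S_N | [forall j, b (s^-1 j)%g == w j]].

(* [N! = sum_w #{s | b \o s^-1 = w}]; the summand is constant on the words
   with the same letter counts as [b]. *)
Lemma card_carries N (b w : {ffun 'I_N -> A}) : cnt b =1 cnt w ->
  #|carries b w| = (\prod_a (cnt b a)`!)%N.
Proof.
move=> bw.
have cst (w' : {ffun 'I_N -> A}) : has_type (cnt b) w' ->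
    #|carries b w'| = #|carries b w|.
  move=> /has_typeP w'b.
  have [s hs] := @perm_of_cnt N w w' (fun a => etrans (esym (bw a)) (esym (w'b a))).
  rewrite -(fintype.card_image (@mulIg _ s)); apply: eq_card => u.
  apply/fintype.imageP/idP => [[v hv ->]|hu]; last first.
    exists (u * s^-1)%g; rewrite ?mulgKV//; apply/forallP => j.
    rewrite invMg invgK permM -hs.
    by move/forallP: hu => /(_ (s j)).
  apply/forallP => j; rewrite invMg permM; move/forallP: hv.
  by move=> /(_ (s^-1 j)%g) => /eqP ->; rewrite -hs permKV.
have tot : (\sum_(w' | has_type (cnt b) w') #|carries b w'|)%N = N`!.
  rewrite -card_Sn -sum1_card.
  rewrite (partition_big (fun s : 'S_N => [ffun j => b (s^-1 j)%g]) (@has_type (cnt b) N)) /=.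
    apply: eq_bigr => w' _; rewrite -sum1_card; apply: eq_bigl => s.
    rewrite !inE; apply/forallP/eqP => [h|<- j]; last by rewrite ffunE.
    by apply/ffunP => j; rewrite ffunE; exact/eqP.
  move=> s _; apply/has_typeP => a; rewrite -[in RHS](cnt_perm _ (s^-1)%g).
  by apply: eq_cnt => j; rewrite ffunE.
rewrite (eq_bigr _ cst) sum_nat_const in tot.
have := @card_has_type N (cnt b) (sum_cnt b).
rewrite -tot => /eqP; rewrite eqn_pmul2l; first by move/eqP.
by apply/card_gt0P; exists b; apply/has_typeP.
Qed.

End Words.

(** * Tuples of permutations that produce a prescribed joint type *)

Section JointWords.
Variables (n N : nat) (B : finType).
Implicit Types (b : 'I_n -> 'I_N -> B) (s : {ffun 'I_n -> 'S_N}).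

Definition joint_word b (j : 'I_N) : {ffun 'I_n -> B} := [ffun i => b i j].

Definition permute_words s b : 'I_n -> 'I_N -> B := fun i j => b i ((s i)^-1 j)%g.

(** Values lie in any additive monoid, so natural counts and real frequencies share it. *)
Definition marginal (V : nmodType) (t : {ffun 'I_n -> B} -> V) i (c : B) : V :=
  \sum_(a : {ffun 'I_n -> B} | a i == c) t a.

Lemma marginal_cnt b i c :
  marginal (cnt (joint_word b) : _ -> nat) i c = cnt (b i) c.
Proof.
rewrite /marginal /cnt exchange_big /=; apply: eq_bigr => j _.
rewrite (eq_bigr (fun a : {ffun 'I_n -> B} => (joint_word b j == a) : nat)) //.
have [e|e] := eqVneq (b i j) c.
  rewrite (bigD1 (joint_word b j)) ?ffunE ?e ?eqxx//= big1 ?addn0//.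
  by move=> a /andP[_]; rewrite eq_sym => /negbTE ->.
rewrite big1 // => a /eqP ai; case: eqP => // /(congr1 (fun f : {ffun _ -> _} => f i)).
by rewrite ffunE ai => /eqP; rewrite (negbTE e).
Qed.

(** Sort the tuples by the joint word [w] that they produce. The fibre over [w] is a product over
    [i] of the sets of permutations carrying [b i] to row [i] of [w]; its size does not depend on
    [w], and [card_has_type] counts the words. The witness [s0] ensures that the marginals of [t]
    are the letter counts of the [b i]. *)
Lemma card_joint_type b (t : {ffun 'I_n -> B} -> nat) s0 :
  cnt (joint_word (permute_words s0 b)) =1 t ->
  (#|[pred s | [forall a, cnt (joint_word (permute_words s b)) a == t a]]| *
   \prod_a (t a)`! = N`! * \prod_i \prod_c (cnt (b i) c)`!)%N.
Proof.
move=> ht.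
pose W (w : {ffun 'I_N -> {ffun 'I_n -> B}}) i : {ffun 'I_N -> B} := [ffun j => w j i].
have bf i : cnt [ffun j => b i j] =1 cnt (b i) by apply: eq_cnt => j; rewrite ffunE.
have -> : #|[pred s | [forall a, cnt (joint_word (permute_words s b)) a == t a]]| =
   (\sum_(w | has_type t w) \prod_i #|carries [ffun j => b i j] (W w i)|)%N.
  rewrite -sum1_card.
  rewrite (partition_big (fun s => [ffun j => joint_word (permute_words s b) j])
    (@has_type _ t N)) /=; last first.
    move=> s /forallP h; apply/has_typeP => a; rewrite -(eqP (h a)).
    by apply: eq_cnt => j; rewrite ffunE.
  apply: eq_bigr => w /has_typeP tw.
  have -> : (\prod_i #|carries [ffun j => b i j] (W w i)|)%N =
      #|family (fun i => carries [ffun j => b i j] (W w i))|.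
    by rewrite card_family foldrE big_map big_enum.
  rewrite -sum1_card; apply: eq_bigl => s; rewrite !inE.
  apply/andP/familyP => [[_ /eqP e] i|h].
    rewrite inE; apply/forallP => j; rewrite !ffunE -e !ffunE //.
  have e : [ffun j => joint_word (permute_words s b) j] = w.
    apply/ffunP => j; apply/ffunP => i; rewrite !ffunE.
    by have := h i; rewrite inE => /forallP/(_ j); rewrite !ffunE => /eqP.
  split; last exact/eqP.
  apply/forallP => a; rewrite -tw -e; apply/eqP/eq_cnt => j; by rewrite ffunE.
rewrite (eq_bigr (fun _ => \prod_i \prod_c (cnt (b i) c)`!)%N).
  rewrite sum_nat_const mulnAC card_has_type// -(sum_cnt (joint_word (permute_words s0 b))).
  by apply: eq_bigr.
move=> w /has_typeP tw; apply: eq_bigr => i _.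
rewrite card_carries; first by apply: eq_bigr => c _; rewrite bf.
(* Row [i] of [w] has the letter counts of [b i]: both are the marginal of [t], for [b i] by way of
   [s0]. *)
move=> c; rewrite bf -(cnt_perm (b i) (s0 i)^-1%g).
rewrite (eq_cnt (w' := permute_words s0 b i))//.
rewrite -marginal_cnt /marginal; under eq_bigr do rewrite ht -tw.
rewrite -/(marginal (cnt w : _ -> nat) i c).
transitivity (marginal (cnt (joint_word (fun i j => w j i)) : _ -> nat) i c).
  by apply: eq_bigr => a _; apply: eq_cnt => j; apply/ffunP => k; rewrite ffunE.
by rewrite marginal_cnt; apply: eq_cnt => j; rewrite ffunE.
Qed.

End JointWords.

(** * Exponential rate of a type *)

Section LnEstimates.
Variable R : realType.
Implicit Types x y e : R.

Definition xlnx x : R := x * ln x.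

Lemma ln_le_subr1 x : 0 < x -> ln x <= x - 1.
Proof.
move=> x0; rewrite -[in ln x](subrK 1 x) addrC; apply: le_ln1Dx.
by rewrite ltrBrDr addNr.
Qed.

Lemma ln_ge_subV x : 0 < x -> 1 - x^-1 <= ln x.
Proof.
move=> x0; have := @ln_le_subr1 x^-1; rewrite invr_gt0 => /(_ x0).
by rewrite lnV ?posrE// => h; lra.
Qed.

Lemma ln_sqrt_le x : 1 <= x -> ln x <= 2 * Num.sqrt x.
Proof.
move=> x1; have s0 : 0 < Num.sqrt x by rewrite sqrtr_gt0; lra.
rewrite -[in ln x](@sqr_sqrtr _ x); last lra.
by rewrite lnXn// mulr_natl lerMn2r/= ltW// ln_sublinear.
Qed.

Definition ln_fact_err m : R := ln m`!%:R - (xlnx m%:R - m%:R).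

(** Passing from [c] to [c + 1] raises the error by [1 - c (ln (c + 1) - ln c)], which lies between
    [0] and [ln (c + 1) - ln c]; the upper bounds telescope. *)
Lemma ln_fact_bound m : 0 <= ln_fact_err m <= ln m.+1%:R + 1.
Proof.
rewrite /ln_fact_err /xlnx; case: m => [|m].
  by rewrite fact0 mul0r !ln1; lra.
suff : 0 <= ln_fact_err m.+1 <= ln m.+1%:R + 1.
  rewrite /ln_fact_err /xlnx => /andP[-> h] /=; apply: (le_trans h).
  by rewrite lerD2r ler_ln ?posrE ?ltr0n// ler_nat.
rewrite /ln_fact_err /xlnx; elim: m => [|m /andP[IH1 IH2]].
  rewrite (_ : 1`! = 1)%N// !ln1.
  by lra.
have m0 : (0 : R) < m.+1%:R by rewrite ltr0n.
have m1 : (0 : R) < m.+2%:R by rewrite ltr0n.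
rewrite factS natrM lnM ?posrE ?ltr0n ?fact_gt0//.
set u := ln (_`!%:R) in IH1 IH2 *.
have rat : ln (m.+2%:R / m.+1%:R : R) = ln m.+2%:R - ln m.+1%:R.
  by rewrite ln_div ?posrE.
have r0 : (0 : R) < m.+2%:R / m.+1%:R by rewrite divr_gt0.
have r1 : m.+2%:R / m.+1%:R - 1 = m.+1%:R^-1 :> R.
  by rewrite -[m.+2]addn1 natrD; field; rewrite ?lt0r_neq0 // -natr1 natr1 pnatr_eq0.
have r2 : 1 - (m.+2%:R / m.+1%:R)^-1 = m.+2%:R^-1 :> R.
  rewrite invf_div -[X in X - _](@divff _ m.+2%:R) ?lt0r_neq0// -mulrBl.
  by rewrite -natr1 addrAC subrr add0r mul1r natr1.
have := ln_le_subr1 r0; have := ln_ge_subV r0; rewrite rat r1 r2.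
set a := ln m.+2%:R; set b := ln m.+1%:R in IH1 IH2 *.
set c : R := m.+1%:R in m0 IH1 IH2 *.
have c1 : m.+2%:R = c + 1 by rewrite natr1.
rewrite c1 in m1 *; move=> h1 h2.
have h1' : 1 <= (c + 1) * (a - b) by rewrite -ler_pdivrMl ?mulr1.
have h2' : c * (a - b) <= 1 by rewrite -ler_pdivlMl ?mulr1//.
by apply/andP; split; nra.
Qed.

Lemma near_ln_rate (C e : R) : 0 < e ->
  \forall N \near \oo, C * (ln N.+1%:R + 1) <= e * N%:R.
Proof.
(* With [s = sqrt (N + 1)] the left side is at most [3 |C| s] and the right side is [e (s^2 - 1)],
   so [s >= 2] and [e s >= 6 |C|] suffice. *)
move=> e0; pose s0 := 6 * `|C| / e + 2.
exists (Num.truncn (s0 ^+ 2)).+1 => // N /= hN.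
set s := Num.sqrt (N.+1%:R : R).
have sN : N%:R = s ^+ 2 - 1 by rewrite sqr_sqrtr// -natr1; ring.
have hs0 : 0 <= s0 by rewrite /s0 addr_ge0// divr_ge0 ?mulr_ge0// ltW.
have s_s0 : s0 <= s.
  rewrite -[s0]ger0_norm// -sqrtr_sqr ler_sqrt// ltW//.
  rewrite (lt_trans (truncnS_gt _))// ltr_nat ltnS//.
have C0 := normr_ge0 C.
have lns : ln (N.+1%:R : R) <= 2 * s by apply: ln_sqrt_le; rewrite ler1n.
have ln0 : 0 <= ln (N.+1%:R : R) by apply: ln_ge0; rewrite ler1n.
have s2 : 2 <= s by apply: le_trans s_s0; rewrite /s0 lerDr divr_ge0 ?mulr_ge0// ltW.
have h6 : 6 * `|C| <= e * s.
  by rewrite mulrC [e * s]mulrC -ler_pdivrMr//; apply: le_trans s_s0; rewrite /s0 mulrC lerDl.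
apply: (@le_trans _ _ (`|C| * (3 * s))).
  apply: (@le_trans _ _ (`|C| * (ln N.+1%:R + 1))).
    by rewrite ler_wpM2r ?ler_norm//; lra.
  by rewrite ler_wpM2l//; lra.
rewrite sN; nra.
Qed.

Lemma xlnx0 : xlnx 0 = 0. Proof. by rewrite /xlnx mul0r. Qed.

Lemma xlnxM x y : 0 < x -> 0 <= y -> xlnx (x * y) = x * xlnx y + x * y * ln x.
Proof.
move=> x0; rewrite le_eqVlt => /predU1P[<-|y0].
  by rewrite mulr0 xlnx0 !mulr0 mul0r addr0.
by rewrite /xlnx lnM ?posrE//; ring.
Qed.

(** The delicate point is [0], approached from the right, where [|y ln y| <= 2 sqrt y]; on
    nonpositive numbers the default [ln = 0] makes [xlnx] vanish. Continuity on the whole line lets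
    types be perturbed regardless of sign. *)
Lemma continuous_xlnx : continuous xlnx.
Proof.
move=> x; case: (ltgtP x 0) => [x0|x0|->].
- rewrite /continuous_at {2}/xlnx ln0 ?ltW// mulr0.
  apply: cvg_near_cst; near=> y; apply/eqP.
  by rewrite /xlnx ln0 ?mulr0//; apply: ltW; near: y; apply: (cvgr_lt x (@cvg_id _ _)).
- by apply: cvgM; [exact: cvg_id|exact: continuous_ln].
- rewrite /continuous_at xlnx0; apply/cvgrPdist_le => /= e e0.
  near=> y; rewrite sub0r normrN /=.
  have [y0|y0] := leP y 0; first by rewrite /xlnx ln0// mulr0 normr0 ltW.
  have y1 : y < 1 by near: y; apply: (cvgr_lt 0 (@cvg_id _ _)).
  have ye : y <= (e / 3) ^+ 2.
    by apply: ltW; near: y; apply: (cvgr_lt 0 (@cvg_id _ _)); rewrite exprn_gt0// divr_gt0.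
  have lny : ln y <= 0 by apply: ln_le0; lra.
  rewrite /xlnx normrM (ger0_norm (ltW y0)) (ler0_norm lny) -lnV ?posrE//.
  have s0 : 0 < Num.sqrt y by rewrite sqrtr_gt0.
  have := @ln_sqrt_le y^-1; rewrite invf_ge1// => /(_ (ltW y1)) h.
  apply: (@le_trans _ _ (y * (2 * Num.sqrt y^-1))); first by rewrite ler_wpM2l// ltW.
  rewrite sqrtrV ?ltW// -{1}(sqr_sqrtr (ltW y0)) expr2.
  have -> : Num.sqrt y * Num.sqrt y * (2 * (Num.sqrt y)^-1) = 2 * Num.sqrt y.
    by field; rewrite lt0r_neq0.
  have : Num.sqrt y <= e / 3.
    rewrite -[leRHS]ger0_norm; last by rewrite divr_ge0// ltW.
    by rewrite -sqrtr_sqr ler_sqrt// sqr_ge0.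
  by move=> ?; lra.
Unshelve. all: by end_near. Qed.

End LnEstimates.

(** * The probability of a joint type as an exponential in its mutual information *)

Section TypeRate.
Variable R : realType.

Lemma ln_prod_gt0 (I : Type) (r : seq I) (F : I -> R) : (forall i, 0 < F i) ->
  ln (\prod_(i <- r) F i) = \sum_(i <- r) ln (F i).
Proof.
move=> F0; elim: r => [|i r IH]; first by rewrite !big_nil ln1.
by rewrite !big_cons lnM ?posrE// ?IH// prodr_gt0.
Qed.

Definition freq (A : finType) N (w : 'I_N -> A) (a : A) : R := (cnt w a)%:R / N%:R.

Variables (n : nat) (B : finType).
Implicit Types (tau : {ffun 'I_n -> B} -> R).

(** The relative entropy of [tau] to the product of its marginals, see [mutual_infoE]; this form
    comes directly from the logarithms of the factorials and is visibly continuous in [tau]. *)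
Definition mutual_info tau : R :=
  \sum_a xlnx (tau a) - \sum_i \sum_c xlnx (marginal tau i c).

Lemma sum_freq (A : finType) N (w : 'I_N -> A) : (0 < N)%N -> \sum_a freq w a = 1.
Proof.
by move=> N0; rewrite -mulr_suml -natr_sum sum_cnt divff// pnatr_eq0 -lt0n.
Qed.

Lemma freq_ge0 (A : finType) N (w : 'I_N -> A) a : 0 <= freq w a.
Proof. by rewrite /freq divr_ge0. Qed.

Lemma marginal_freq N (b : 'I_n -> 'I_N -> B) i c :
  marginal (freq (joint_word b)) i c = freq (b i) c.
Proof. by rewrite /freq -marginal_cnt natr_sum mulr_suml. Qed.

Lemma sum_xlnx_cnt (A : finType) N (w : 'I_N -> A) : (0 < N)%N ->
  \sum_a xlnx ((cnt w a)%:R : R) =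
  N%:R * \sum_a xlnx (freq w a) + N%:R * ln N%:R.
Proof.
move=> N0; have N0' : 0 < N%:R :> R by rewrite ltr0n.
have cE a : (cnt w a)%:R = N%:R * freq w a.
  by rewrite /freq mulrCA divff ?mulr1// lt0r_neq0.
under eq_bigr do rewrite cE xlnxM// ?freq_ge0//.
rewrite big_split /= -mulr_sumr; congr (_ + _).
by rewrite -mulr_suml -mulr_sumr sum_freq// mulr1.
Qed.

Lemma sum_ln_fact (A : finType) N (w : 'I_N -> A) : (0 < N)%N ->
  \sum_a ln ((cnt w a)`!%:R : R) =
  N%:R * \sum_a xlnx (freq w a) + xlnx N%:R - N%:R + \sum_a ln_fact_err R (cnt w a).
Proof.
move=> N0.
have E a : ln ((cnt w a)`!%:R : R) =
    xlnx (cnt w a)%:R - (cnt w a)%:R + ln_fact_err R (cnt w a).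
  by rewrite /ln_fact_err; ring.
under eq_bigr do rewrite E.
by rewrite big_split/= sumrB sum_xlnx_cnt// -natr_sum sum_cnt.
Qed.

Lemma cnt_le (A : finType) N (w : 'I_N -> A) a : (cnt w a <= N)%N.
Proof. by rewrite -[leqRHS](sum_cnt w) (bigD1 a)//= leq_addr. Qed.

Lemma sum_ln_fact_err_bound (A : finType) N (w : 'I_N -> A) :
  0 <= \sum_a ln_fact_err R (cnt w a) <= #|A|%:R * (ln N.+1%:R + 1).
Proof.
apply/andP; split.
  by apply: sumr_ge0 => a _; have /andP[] := ln_fact_bound R (cnt w a).
rewrite mulr_natl -sumr_const; apply: ler_sum => a _.
have /andP[_ h] := ln_fact_bound R (cnt w a); apply: (le_trans h).
by rewrite lerD2r ler_ln ?posrE// ler_nat ltnS cnt_le.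
Qed.

Definition same_joint_type N (b : 'I_n -> 'I_N -> B) (s0 : {ffun 'I_n -> 'S_N}) :
    pred {ffun 'I_n -> 'S_N} :=
  [pred s | [forall a, cnt (joint_word (permute_words s b)) a ==
                       cnt (joint_word (permute_words s0 b)) a]].

(** The logarithm of [card_joint_type] with Stirling's formula inserted. The constant counts the
    factorials involved, each of which contributes one error term. *)
Lemma ln_card_joint_type N (b : 'I_n -> 'I_N -> B) (s0 : {ffun 'I_n -> 'S_N}) :
  (0 < N)%N ->
  `|ln (#|same_joint_type b s0|%:R / N`!%:R ^+ n) +
     N%:R * mutual_info (freq (joint_word (permute_words s0 b)))| <=
  (1 + n + #|{: {ffun 'I_n -> B}}| + n * #|B|)%:R * (ln N.+1%:R + 1).
Proof.
move=> N0; set w := joint_word _; set Q := #|_|.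
have QE : (Q * \prod_a (cnt w a)`! = N`! * \prod_i \prod_c (cnt (b i) c)`!)%N.
  exact: card_joint_type.
have Q0 : 0 < Q%:R :> R.
  by rewrite ltr0n; apply/card_gt0P; exists s0; apply/forallP.
have lnQ : ln (Q%:R : R) + \sum_a ln ((cnt w a)`!%:R : R) =
    ln N`!%:R + \sum_i \sum_c ln ((cnt (b i) c)`!%:R : R).
  rewrite -ln_prod_gt0 => [|a]; last by rewrite ltr0n fact_gt0.
  rewrite -lnM ?posrE//; last first.
    by apply: prodr_gt0 => a _; rewrite ltr0n fact_gt0.
  rewrite -natr_prod -natrM QE natrM lnM ?posrE ?ltr0n ?fact_gt0//; last first.
    by apply: prodn_gt0 => i; apply: prodn_gt0 => c; exact: fact_gt0.
  congr (_ + _); rewrite natr_prod ln_prod_gt0; last first.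
    by move=> i; rewrite ltr0n; apply: prodn_gt0 => c; exact: fact_gt0.
  apply: eq_bigr => i _; rewrite natr_prod ln_prod_gt0//.
have mE i : \sum_c xlnx (marginal (freq w) i c) = \sum_c xlnx (freq (b i) c).
  apply: eq_bigr => c _; rewrite marginal_freq; congr xlnx.
  by rewrite /freq (cnt_perm (b i) (s0 i)^-1%g).
rewrite /mutual_info; under [in X in _ - X]eq_bigr do rewrite mE.
rewrite sum_ln_fact// in lnQ.
rewrite [in RHS](eq_bigr _ (fun i _ => sum_ln_fact (b i) N0)) in lnQ.
rewrite lnM ?posrE ?invr_gt0 ?exprn_gt0 ?ltr0n ?fact_gt0//; last first.
  by rewrite -(ltr0n R).
rewrite lnV ?posrE ?exprn_gt0 ?ltr0n ?fact_gt0// lnXn ?ltr0n ?fact_gt0//.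
rewrite -[_ *+ n]mulr_natl.
have lnN : ln (N`!%:R : R) = xlnx N%:R - N%:R + ln_fact_err R N.
  by rewrite /ln_fact_err; ring.
have E (F G : 'I_n -> R) (x y z : R) :
    \sum_i (z * F i + x - y + G i) =
    z * \sum_i F i + n%:R * x - n%:R * y + \sum_i G i.
  by rewrite !big_split /= sumrN !sumr_const card_ord !mulr_natl mulr_sumr.
rewrite E in lnQ.
have /andP[e1 e2] := ln_fact_bound R N.
have /andP[e3 e4] := sum_ln_fact_err_bound w.
have : 0 <= \sum_i \sum_c ln_fact_err R (cnt (b i) c) <=
    n%:R * (#|B|%:R * (ln N.+1%:R + 1)).
  apply/andP; split.
    by apply: sumr_ge0 => i _; have /andP[] := sum_ln_fact_err_bound (b i).
  rewrite -[n in n%:R * _]card_ord mulr_natl -sumr_const; apply: ler_sum => i _.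
  by have /andP[] := sum_ln_fact_err_bound (b i).
move=> /andP[e5 e6]; rewrite !natrD natrM.
move: lnQ lnN e1 e2 e3 e4 e5 e6.
set x1 := \sum_a ln_fact_err _ _; set x2 := \sum_i \sum_c ln_fact_err _ _.
set y1 := \sum_a xlnx _; set y2 := \sum_i \sum_c xlnx _.
set L := ln N.+1%:R + 1; set lQ := ln Q%:R; set lF := ln N`!%:R.
set er := ln_fact_err R N => lnQ lnN e1 e2 e3 e4 e5 e6.
(* The terms [N ln N - N] enter [n + 1] times with each sign and cancel; only Stirling errors
   remain. *)
have -> : lQ + - (n%:R * lF) + N%:R * (y1 - y2) = (1 - n%:R) * er + x2 - x1.
  have -> : lQ = lF + (N%:R * y2 + n%:R * xlnx N%:R - n%:R * N%:R + x2)
       - (N%:R * y1 + xlnx N%:R - N%:R + x1) by lra.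
  by rewrite lnN; ring.
have n0 : (0 : R) <= n%:R by [].
rewrite ler_norml; apply/andP; split.
  have : n%:R * er <= n%:R * L by rewrite ler_wpM2l.
  have : 0 <= n%:R * (#|B|%:R * L) by rewrite !mulr_ge0// (le_trans e1).
  by move=> ? ?; nra.
have : 0 <= n%:R * er by rewrite mulr_ge0.
have : 0 <= n%:R * L by rewrite mulr_ge0// (le_trans e1).
have : 0 <= #|{ffun 'I_n -> B}|%:R * L by rewrite mulr_ge0// (le_trans e1).
by move=> ? ? ?; nra.
Qed.

Lemma mutual_info_continuous (p : {ffun 'I_n -> B} -> R) (e : R) : 0 < e ->
  exists2 eta, 0 < eta & forall tau, (forall a, `|tau a - p a| <= eta) ->
    `|mutual_info tau - mutual_info p| <= e.
Proof.
move=> e0.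
(* [K] exceeds the number of [xlnx] terms, so each may move by [e / K]. Below, [M] exceeds the
   number of entries summed in a marginal, which therefore moves by at most [M * eta]. *)
pose K : R := #|{: {ffun 'I_n -> B}}|%:R + n%:R * #|B|%:R + 1.
have K0 : 0 < K by rewrite ltr_wpDl// addr_ge0// mulr_ge0.
have eK : 0 < e / K by rewrite divr_gt0.
pose M : R := #|{: {ffun 'I_n -> B}}|%:R + 1.
have M0 : 0 < M by rewrite ltr_wpDl.
have cont (x : R) : \forall eta \near 0^'+, forall y, `|y - x| <= M * eta ->
    `|xlnx y - xlnx x| <= e / K.
  have /cvgrPdist_le/(_ _ eK)/nbhs_normP[r /= r0 hr] := @continuous_xlnx R x.
  near=> eta => y hy; rewrite distrC; apply: hr => /=.
  rewrite distrC (le_lt_trans hy)// mulrC -ltr_pdivlMr//.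
  by near: eta; apply: nbhs_right_lt; rewrite divr_gt0.
have ev : \forall eta \near 0^'+, 0 < eta /\
   ((forall a y, `|y - p a| <= M * eta -> `|xlnx y - xlnx (p a)| <= e / K) /\
   (forall (ic : 'I_n * B) y, `|y - marginal p ic.1 ic.2| <= M * eta ->
      `|xlnx y - xlnx (marginal p ic.1 ic.2)| <= e / K)).
  apply: filterS2 (nbhs_right_gt 0) _ => [eta h1 h2|]; first by split; [exact: h1|exact: h2].
  apply: filterS2 => [eta h1 h2||]; first by split; [exact: h1|exact: h2].
    exact: (@filter_forall _ _ (fun a eta => forall y, `|y - p a| <= M * eta ->
      `|xlnx y - xlnx (p a)| <= e / K) _ _ (fun a => cont (p a))).
  exact: (@filter_forall _ _ (fun (ic : 'I_n * B) eta => forall y,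
    `|y - marginal p ic.1 ic.2| <= M * eta ->
    `|xlnx y - xlnx (marginal p ic.1 ic.2)| <= e / K) _ _
    (fun ic => cont (marginal p ic.1 ic.2))).
have [eta [eta0 [h1 h2]]] := @filter_ex _ _ _ _ ev.
exists eta => // tau ht.
have M1 : 1 <= M by rewrite /M lerDr.
have mt i c : `|marginal tau i c - marginal p i c| <= M * eta.
  rewrite /marginal -sumrB (le_trans (ler_norm_sum _ _ _))//.
  apply: (@le_trans _ _ (\sum_(a : {ffun 'I_n -> B}) eta)).
    rewrite big_mkcond; apply: ler_sum => a _; case: ifP => // _; exact: ltW.
  by rewrite sumr_const -mulr_natl ler_wpM2r ?ltW// /M ltrDl.
rewrite /mutual_info opprD addrACA -sumrB -opprD -sumrB.
apply: (le_trans (ler_normB _ _)).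
apply: (@le_trans _ _ (#|{: {ffun 'I_n -> B}}|%:R * (e / K) + n%:R * #|B|%:R * (e / K))).
  apply: lerD.
    apply: (le_trans (ler_norm_sum _ _ _)).
    rewrite mulr_natl -sumr_const; apply: ler_sum => a _; apply: h1.
    by rewrite (le_trans (ht a))// ler_pMl.
  rewrite -mulrA -[n in n%:R * _]card_ord mulr_natl -sumr_const.
  apply: (le_trans (ler_norm_sum _ _ _)); apply: ler_sum => i _.
  rewrite -sumrB; apply: (le_trans (ler_norm_sum _ _ _)).
  rewrite mulr_natl -sumr_const; apply: ler_sum => c _.
  exact: (h2 (i, c)).
rewrite -mulrDl mulrCA ler_piMr ?(ltW e0)// ler_pdivrMr// mul1r.
by rewrite /K lerDl.
Unshelve. all: by end_near. Qed.

End TypeRate.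

(** * From moments to cell frequencies *)

Section HalflinePolynomial.
Variable R : realType.
Implicit Types (a b c e x y : R).

Lemma bernoulli_ineq x m : -1 <= x -> 1 + m%:R * x <= (1 + x) ^+ m.
Proof.
move=> x1; elim: m => [|m IH]; first by rewrite mul0r addr0.
rewrite exprS -natr1.
apply: (@le_trans _ _ ((1 + x) * (1 + m%:R * x))).
  have : 0 <= m%:R * x ^+ 2 by rewrite mulr_ge0// sqr_ge0.
  by move=> ?; nra.
by rewrite ler_wpM2l//; lra.
Qed.

Lemma expr_small x e : 0 <= x < 1 -> 0 < e -> exists n, x ^+ n.+1 <= e.
Proof.
move=> /andP[x0 x1] e0.
have /cvgrPdist_le/(_ _ e0)[n _ /(_ n.+1)] : (fun n => x ^+ n) @ \oo --> 0.
  by apply: cvg_expr; rewrite ger0_norm.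
rewrite /= => /(_ (leqnSn n)); rewrite sub0r normrN ger0_norm ?exprn_ge0//.
by exists n.
Qed.

(* Stone's polynomials [1 - (1 - y^n)^m]: [m] is chosen with
   [m a^n << 1 << m b^n]. *)
Lemma stone_step a b e : 0 < a -> a < b -> b <= 1 -> 0 < e -> exists n m,
  (forall y, 0 <= y <= a -> 1 - (1 - y ^+ n) ^+ m <= e) /\
  (forall y, b <= y <= 1 -> 1 - e <= 1 - (1 - y ^+ n) ^+ m).
Proof.
move=> a0 ab b1 e0; have b0 := lt_trans a0 ab.
have [n1 h1] : exists n, (a / b) ^+ n.+1 <= e * e / 2.
  apply: expr_small; last by rewrite divr_gt0// mulr_gt0.
  by rewrite divr_ge0 ?ltW//= ltr_pdivrMr// mul1r.
have [n2 h2] : exists n, a ^+ n.+1 <= e / 2.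
  by apply: expr_small; rewrite ?divr_gt0// ltW//= (lt_le_trans ab).
have ab1 : a / b <= 1 by rewrite ler_pdivrMr// mul1r ltW.
have ab0 : 0 <= a / b by rewrite divr_ge0// ltW.
have a1 : a <= 1 by rewrite (le_trans (ltW ab)).
pose n := maxn n1.+1 n2.+1.
have hn1 : (a / b) ^+ n <= e * e / 2.
  by apply: le_trans h1; rewrite ler_wiXn2l// leq_maxl.
have hn2 : a ^+ n <= e / 2.
  by apply: le_trans h2; rewrite ler_wiXn2l ?(ltW a0)// leq_maxr.
have bn0 : 0 < b ^+ n by rewrite exprn_gt0.
(* The integer [m] just above [M] has [m y^n >= 1 / e] for [y >= b], while for [y <= a] Bernoulli's
   inequality bounds the value by [m y^n <= (M + 1) a^n = (a / b)^n / e + a^n <= e]. *)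
pose M := (e * b ^+ n)^-1.
have M0 : 0 < M by rewrite invr_gt0 mulr_gt0.
pose m := (Num.truncn M).+1.
have m1 : M < m%:R by exact: truncnS_gt.
have m2 : m%:R <= M + 1.
  by rewrite /m -natr1 lerD2r truncn_le// ltW.
exists n, m; split => y /andP[y1 y2].
  have y3 : y ^+ n <= a ^+ n by rewrite lerXn2r ?nnegrE// ltW.
  have yn1 : y ^+ n <= 1 by rewrite exprn_ile1// (le_trans y2).
  have := @bernoulli_ineq (- y ^+ n) m; rewrite lerN2 => /(_ yn1) h.
  have : m%:R * y ^+ n <= e.
    apply: (@le_trans _ _ ((M + 1) * a ^+ n)); first by rewrite ler_pM ?exprn_ge0.
    have -> : (M + 1) * a ^+ n = (a / b) ^+ n / e + a ^+ n.
      by rewrite expr_div_n /M; field; rewrite !gt_eqF.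
    have : (a / b) ^+ n / e <= e / 2 by rewrite ler_pdivrMr// mulrAC.
    by lra.
  by rewrite mulrN in h; lra.
have y0 : 0 <= y by rewrite (le_trans (ltW b0)).
have yb : b ^+ n <= y ^+ n by rewrite lerXn2r ?nnegrE// ltW.
have yn1 : y ^+ n <= 1 by rewrite exprn_ile1.
have yn0 : 0 <= y ^+ n by rewrite exprn_ge0.
(* [(1 - v) (1 + v) <= 1] for [v = y^n] turns Bernoulli's lower bound on [(1 + v)^m] into an upper
   bound on [(1 - v)^m]. *)
have h1' : (1 - y ^+ n) ^+ m * (1 + y ^+ n) ^+ m <= 1.
  rewrite -exprMn exprn_ile1//; nra.
have h2' := @bernoulli_ineq (y ^+ n) m.
have h3 : e^-1 <= m%:R * y ^+ n.
  apply: (@le_trans _ _ (M * b ^+ n)); last by rewrite ler_pM// ltW.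
  by rewrite /M invfM -mulrA mulVf ?mulr1// gt_eqF.
have h4 : e^-1 <= (1 + y ^+ n) ^+ m by apply: le_trans (h2' _); lra.
have h5 : 0 <= (1 - y ^+ n) ^+ m by rewrite exprn_ge0//; lra.
have : (1 - y ^+ n) ^+ m * e^-1 <= 1.
  by apply: le_trans h1'; rewrite ler_wpM2l.
by rewrite ler_pdivrMr// mul1r; lra.
Qed.

(** Lower bounds are required on the whole line and upper bounds on [[-r, r]] only: entries of a
    microstate may be arbitrarily large, whereas [X] has bounded range. *)
Definition halfline_poly (r c eta e : R) (f : {poly R}) :=
  [/\ forall x, 0 <= f.[x], forall x, c <= x -> 1 <= f.[x],
      forall x, `|x| <= r -> f.[x] <= 1 + e &
      forall x, `|x| <= r -> x <= c - eta -> f.[x] <= e].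

(* [(u + d)^2 + (x / (r + 1))^(2k)] with [u] close to the step function at [c]
   on a large interval: the second term is at least [1] outside that interval
   and small on [-r, r]. *)
Lemma halfline_poly_ex (r c eta e : R) : 0 < r -> 0 < eta -> 0 < e ->
  exists f, halfline_poly r c eta e f.
Proof.
(* [d] bounds at once the error of Stone's polynomial, the shift and the outer term; left of
   [c - eta] the value is then at most [(2 d)^2 + d <= 5 d]. *)
move=> r0 eta0 e0; pose d := Num.min 1 (e / 5).
have d0 : 0 < d by rewrite lt_min ltr01 divr_gt0.
have d1 : d <= 1 by rewrite ge_min lexx.
have de : 5 * d <= e by rewrite mulrC -ler_pdivlMr// ge_min lexx orbT.
(* Large enough that [c - eta] and [c] lie inside [[-L, L]], which [s] maps onto [[0, 1]], and that
   [x / (r + 1) >= 1] beyond [L]. *)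
pose L := 2 * (r + `|c| + eta + 1).
have c0 := normr_ge0 c.
have L0 : 0 < L by rewrite /L; lra.
have cL : - `|c| <= c <= `|c| by rewrite -ler_norml.
pose s x := (x + L) / (2 * L).
have L20 : 0 < 2 * L by lra.
have s_le x y : (s x <= s y) = (x <= y).
  by rewrite /s ler_pM2r ?invr_gt0// lerD2r.
have s_ge0 x : - L <= x -> 0 <= s x.
  by move=> h; rewrite /s divr_ge0//; lra.
have s_le1 x : x <= L -> s x <= 1.
  by move=> h; rewrite /s ler_pdivrMr//; lra.
have [n [m [u0 u1]]] : exists n m,
  (forall y, 0 <= y <= s (c - eta) -> 1 - (1 - y ^+ n) ^+ m <= d) /\
  (forall y, s c <= y <= 1 -> 1 - d <= 1 - (1 - y ^+ n) ^+ m).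
  apply: stone_step => //.
  - by rewrite /s divr_gt0//; move: cL; rewrite /L => ?; lra.
  - by rewrite ltNge s_le -ltNge ltrBlDr ltrDl.
  - by apply: s_le1; move: cL; rewrite /L => ?; lra.
have uU x : `|x| <= L -> 0 <= 1 - (1 - s x ^+ n) ^+ m <= 1.
  rewrite ler_norml => /andP[x1 x2].
  have h : 0 <= 1 - s x ^+ n <= 1.
    by rewrite subr_ge0 exprn_ile1 ?s_ge0 ?s_le1//= lerBlDr lerDl exprn_ge0// s_ge0.
  case/andP: h => h1 h2.
  by rewrite subr_ge0 exprn_ile1//= lerBlDr lerDl exprn_ge0.
have [k hk] : exists k, ((r / (r + 1)) ^+ 2) ^+ k.+1 <= d.
  apply: expr_small => //; rewrite sqr_ge0/= expr_lt1// ?ltr_pdivrMr; first lra.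
  - lra.
  - by rewrite divr_ge0//; lra.
pose S : {poly R} := ('X + L%:P) * ((2 * L)^-1)%:P.
pose f : {poly R} := (1 - (1 - S ^+ n) ^+ m + d%:P) ^+ 2 +
  (('X * ((r + 1)^-1)%:P) ^+ 2) ^+ k.+1.
have fE x : f.[x] = (1 - (1 - s x ^+ n) ^+ m + d) ^+ 2 + ((x / (r + 1)) ^+ 2) ^+ k.+1.
  by rewrite /f /S /s !(hornerE, horner_exp).
have t0 x : 0 <= ((x / (r + 1)) ^+ 2) ^+ k.+1 by rewrite exprn_ge0// sqr_ge0.
have t1 x : `|x| <= r -> ((x / (r + 1)) ^+ 2) ^+ k.+1 <= d.
  move=> hx; apply: le_trans hk; rewrite lerXn2r ?nnegrE ?sqr_ge0//.
  rewrite -real_normK ?num_real// [in leRHS]expr2 expr2.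
  have : `|x / (r + 1)| <= r / (r + 1).
    by rewrite normrM normfV [in X in _ / X]ger0_norm ?ler_pM2r ?invr_gt0//; lra.
  by move=> h; rewrite ler_pM.
have rL x : `|x| <= r -> `|x| <= L by move=> h; rewrite (le_trans h)// /L; lra.
exists f; split => x.
- by rewrite fE addr_ge0// sqr_ge0.
- move=> cx; rewrite fE; have [xL|Lx] := leP x L.
    have := u1 (s x); rewrite s_le cx s_le1// => /(_ isT) h.
    by have := t0 x; nra.
  have : 1 <= ((x / (r + 1)) ^+ 2) ^+ k.+1.
    rewrite exprn_ege1// exprn_ege1// ler_pdivlMr; last lra.
    by rewrite /L in Lx; lra.
  by have := sqr_ge0 (1 - (1 - s x ^+ n) ^+ m + d); lra.
- move=> xr; rewrite fE; have := uU _ (rL _ xr); have := t1 _ xr.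
  by move=> h1 /andP[h2 h3]; nra.
- move=> xr xc; rewrite fE; have := uU _ (rL _ xr); have := t1 _ xr.
  have := u0 (s x); rewrite s_le xc s_ge0/=; last first.
    by move: (rL _ xr); rewrite ler_norml => /andP[].
  by move=> /(_ isT) h0 h1 /andP[h2 h3]; nra.
Qed.

Definition step_poly (r c eta e : R) (sg : bool) (f : {poly R}) :=
  [/\ forall x, 0 <= f.[x], forall x, (c < x) = sg -> 1 <= f.[x],
      forall x, `|x| <= r -> f.[x] <= 1 + e &
      forall x, `|x| <= r -> (c < x) = ~~ sg -> eta < `|x - c| -> f.[x] <= e].

Lemma step_poly_ex (r c eta e : R) sg : 0 < r -> 0 < eta -> 0 < e ->
  exists f, step_poly r c eta e sg f.
Proof.
move=> r0 eta0 e0; case: sg.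
  have [f [f0 f1 f2 f3]] := halfline_poly_ex c r0 eta0 e0.
  exists f; split => // x; first by move=> cx; rewrite f1// ltW.
  move=> xr /negbT; rewrite -leNgt => xc; rewrite ler0_norm ?subr_le0// => h.
  by apply: f3 => //; lra.
have [f [f0 f1 f2 f3]] := halfline_poly_ex (- c) r0 eta0 e0.
have fE x : (f \Po - 'X).[x] = f.[- x] by rewrite horner_comp !hornerE.
exists (f \Po - 'X); split => x; rewrite fE.
- exact: f0.
- by move=> /negbT; rewrite -leNgt => xc; rewrite f1// lerN2.
- by move=> xr; rewrite f2// normrN.
- move=> xr cx; rewrite gtr0_norm ?subr_gt0// => h.
  by rewrite f3 ?normrN//; lra.
Qed.

End HalflinePolynomial.

(** * Real-valued expectation of variables bounded on a set of full measure *)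

Section BoundedExpectation.
Context d (T : measurableType d) (R : realType) (P : probability T R).
Variable D : set T.
Hypotheses (mD : measurable D) (PD : P D = 1%E).
Implicit Types (Y Z : T -> R) (A : set T) (b : T -> bool).

(** The variables are only essentially bounded. Fixing a set [D] of probability one on which the
    bounds hold pointwise gives plain estimates, and [expectation_Ev] returns to the expectation. *)
Definition bounded_on Y :=
  measurable_fun [set: T] Y /\ exists C : R, forall w, D w -> `|Y w| <= C.

Definition Ev Y : R := \int[P]_(w in D) Y w.

Definition pr A : R := fine (P A).

Lemma prE A : measurable A -> P A = (pr A)%:E.
Proof. by move=> mA; rewrite fineK// fin_num_measure. Qed.

Lemma pr_ge0 A : 0 <= pr A.
Proof. by rewrite fine_ge0. Qed.

Lemma pr_le A A' : measurable A -> measurable A' -> A `<=` A' -> pr A <= pr A'.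
Proof.
by move=> mA mA' h; rewrite -lee_fin -!prE// le_measure ?inE.
Qed.

Lemma prT : pr [set: T] = 1.
Proof. by rewrite /pr probability_setT. Qed.

Lemma pr_negl A : measurable A -> P (A `\` D) = 0%E.
Proof.
move=> mA; apply/eqP; rewrite -measure_le0.
have <- : P (~` D) = 0%E by rewrite probability_setC// PD subee.
by apply: le_measure; rewrite ?inE; [exact: measurableD|exact: measurableC|move=> ? []].
Qed.

Lemma bounded_on_integrable Y : bounded_on Y -> P.-integrable D (EFin \o Y).
Proof.
move=> [mY [C hC]]; apply: measurable_bounded_integrable => //.
- by rewrite [X in (X < _)%E](_ : _ = 1%E) ?ltry//; exact: PD.
- exact: measurable_funTS.
- exists C; split; first exact: num_real.
  by move=> M CM w Dw /=; rewrite (le_trans (hC _ Dw))// ltW.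
Qed.

Lemma bounded_on_cst (r : R) : bounded_on (fun=> r).
Proof. by split; [exact: measurable_cst|exists `|r|]. Qed.

Lemma bounded_onD Y Z : bounded_on Y -> bounded_on Z ->
  bounded_on (fun w => Y w + Z w).
Proof.
move=> [mY [C hC]] [mZ [C' hC']]; split; first exact: measurable_funD.
by exists (C + C') => w Dw; rewrite (le_trans (ler_normD _ _))// lerD ?hC ?hC'.
Qed.

Lemma bounded_onM Y Z : bounded_on Y -> bounded_on Z ->
  bounded_on (fun w => Y w * Z w).
Proof.
move=> [mY [C hC]] [mZ [C' hC']]; split; first exact: measurable_funM.
by exists (C * C') => w Dw; rewrite normrM ler_pM ?hC ?hC'.
Qed.

Lemma bounded_onZ (r : R) Y : bounded_on Y -> bounded_on (fun w => r * Y w).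
Proof. by move=> bY; apply: bounded_onM => //; exact: bounded_on_cst. Qed.

Lemma bounded_on_sum (I : Type) (s : seq I) (F : I -> T -> R) :
  (forall i, bounded_on (F i)) -> bounded_on (fun w => \sum_(i <- s) F i w).
Proof.
move=> bF; elim: s => [|i s IH].
  by under eq_fun do rewrite big_nil; exact: bounded_on_cst.
by under eq_fun do rewrite big_cons; exact: bounded_onD.
Qed.

Lemma bounded_on_prod (I : Type) (s : seq I) (F : I -> T -> R) :
  (forall i, bounded_on (F i)) -> bounded_on (fun w => \prod_(i <- s) F i w).
Proof.
move=> bF; elim: s => [|i s IH].
  by under eq_fun do rewrite big_nil; exact: bounded_on_cst.
by under eq_fun do rewrite big_cons; exact: bounded_onM.
Qed.

Lemma bounded_onX Y k : bounded_on Y -> bounded_on (fun w => Y w ^+ k).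
Proof.
move=> bY; elim: k => [|k IH].
  by under eq_fun do rewrite expr0; exact: bounded_on_cst.
by under eq_fun do rewrite exprS; exact: bounded_onM.
Qed.

Lemma bounded_on_horner Y (f : {poly R}) : bounded_on Y ->
  bounded_on (fun w => f.[Y w]).
Proof.
move=> bY; under eq_fun do rewrite horner_coef.
by apply: bounded_on_sum => i; apply/bounded_onZ/bounded_onX.
Qed.

Lemma bounded_on_bool b : measurable [set w | b w] ->
  bounded_on (fun w => (b w)%:R).
Proof.
move=> mb; split; last by exists 1 => w _; case: (b w); rewrite ?normr1 ?normr0.
rewrite (_ : (fun w => _) = \1_[set w | b w]); first exact: measurable_indic.
by apply/funext => w; rewrite indicE mem_setE.
Qed.

Lemma Ev_bool b : measurable [set w | b w] ->
  Ev (fun w => (b w)%:R) = pr [set w | b w].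
Proof.
move=> mb; rewrite /Ev /Rintegral /pr; congr fine.
rewrite (eq_integral (EFin \o \1_[set w | b w])); last first.
  by move=> w _ /=; rewrite indicE mem_setE.
rewrite integral_indic//.
rewrite [RHS](measureDI P mb mD) [X in _ = (X + _)%E](_ : _ = 0%E) ?add0e//.
exact: pr_negl.
Qed.

Lemma Ev_cst (r : R) : Ev (fun=> r) = r.
Proof. by rewrite /Ev Rintegral_cst// [X in fine X](_ : _ = 1%E) ?mulr1//; exact: PD. Qed.

Lemma EvD Y Z : bounded_on Y -> bounded_on Z ->
  Ev (fun w => Y w + Z w) = Ev Y + Ev Z.
Proof. by move=> bY bZ; apply: RintegralD => //; exact: bounded_on_integrable. Qed.

Lemma EvZ (r : R) Y : bounded_on Y -> Ev (fun w => r * Y w) = r * Ev Y.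
Proof. by move=> bY; apply: RintegralZl => //; exact: bounded_on_integrable. Qed.

Lemma Ev_sum (I : Type) (s : seq I) (F : I -> T -> R) :
  (forall i, bounded_on (F i)) ->
  Ev (fun w => \sum_(i <- s) F i w) = \sum_(i <- s) Ev (F i).
Proof.
move=> bF; elim: s => [|i s IH].
  by under [in LHS]eq_fun do rewrite big_nil; rewrite big_nil Ev_cst.
under [in LHS]eq_fun do rewrite big_cons; rewrite big_cons EvD// ?IH//.
exact: bounded_on_sum.
Qed.

Lemma le_Ev Y Z : bounded_on Y -> bounded_on Z ->
  (forall w, D w -> Y w <= Z w) -> Ev Y <= Ev Z.
Proof. by move=> bY bZ; apply: le_Rintegral => //; exact: bounded_on_integrable. Qed.

Lemma Ev_norm_le Y r : bounded_on Y -> (forall w, D w -> `|Y w| <= r) ->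
  `|Ev Y| <= r.
Proof.
move=> bY h; rewrite ler_norml; apply/andP; split.
  rewrite -(Ev_cst (- r)); apply: le_Ev => // [|w Dw]; first exact: bounded_on_cst.
  by have := h w Dw; rewrite ler_norml => /andP[].
rewrite -(Ev_cst r); apply: le_Ev => // [|w Dw]; first exact: bounded_on_cst.
by have := h w Dw; rewrite ler_norml => /andP[].
Qed.

Lemma expectation_Ev Y : bounded_on Y -> 'E_P[Y]%E = (Ev Y)%:E.
Proof.
move=> bY; rewrite unlock /Ev /Rintegral fineK; last first.
  by apply: integrable_fin_num => //; exact: bounded_on_integrable.
have mY : measurable_fun [set: T] (fun w => (Y w)%:E) by apply/measurable_EFinP; case: bY.
have iY : P.-integrable [set: T] (EFin \o Y).
  apply/integrableP; split => //.
  have -> : (\int[P]_x `|(EFin \o Y) x| = \int[P]_(x in D) `|(EFin \o Y) x|)%E.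
    rewrite (@ge0_negligible_integral _ _ _ P setT (~` D))//.
    - by rewrite setTD setCK.
    - exact: measurableC.
    - exact: measurableT_comp.
    - by rewrite -[~` D]setTD; exact: pr_negl.
  by have /integrableP[] := bounded_on_integrable bY.
rewrite (@negligible_integral _ _ _ P setT (~` D))// ?setTD ?setCK//.
  exact: measurableC.
by rewrite -[~` D]setTD; exact: pr_negl.
Qed.

Lemma pr_sum_fin (A : finType) (g : T -> A) (S : pred A) :
  (forall a, measurable [set w | g w == a]) ->
  pr [set w | S (g w)] = \sum_(a | S a) pr [set w | g w == a].
Proof.
move=> mg; have mS (S' : pred A) : measurable [set w | S' (g w)].
  rewrite (_ : [set _ | _] = \bigcup_(a in [set a | S' a]) [set w | g w == a]).
    by apply: fin_bigcup_measurable => // a _; exact: finite_finset.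
  apply/seteqP; split => [w /= h|w /= [a h] /eqP ->//].
  by exists (g w) => /=.
rewrite -Ev_bool// (eq_bigr (fun a => Ev (fun w => (g w == a)%:R))); last first.
  by move=> a _; rewrite Ev_bool.
rewrite -[in RHS]big_filter -Ev_sum; last by move=> a; exact: bounded_on_bool.
congr Ev; apply/funext => w; rewrite big_filter.
have [h|h] := boolP (S (g w)).
  rewrite (bigD1 (g w))//= eqxx big1 ?addr0// => a /andP[_].
  by rewrite eq_sym => /negbTE ->.
rewrite big1 // => a Sa; case: eqP => // e; by rewrite e Sa in h.
Qed.

End BoundedExpectation.

Section Kappa.
Variables (R : realType) (N : nat).
Implicit Types (x y : 'I_N -> R).

Lemma eq_kappa x y : x =1 y -> kappa x = kappa y.
Proof. by move=> h; rewrite /kappa (eq_bigr _ (fun j _ => h j)). Qed.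

Lemma kappaD x y : kappa (fun j => x j + y j) = kappa x + kappa y.
Proof. by rewrite /kappa big_split mulrDr. Qed.

Lemma kappaZ (r : R) x : kappa (fun j => r * x j) = r * kappa x.
Proof. by rewrite /kappa -mulr_sumr mulrCA. Qed.

Lemma kappa_sum (I : Type) (s : seq I) (F : I -> 'I_N -> R) :
  kappa (fun j => \sum_(i <- s) F i j) = \sum_(i <- s) kappa (F i).
Proof. by rewrite /kappa exchange_big mulr_sumr. Qed.

Lemma kappa_cst (r : R) : (0 < N)%N -> kappa (fun _ : 'I_N => r) = r.
Proof.
move=> N0; rewrite /kappa sumr_const card_ord -[r *+ N]mulr_natl mulKf//.
by rewrite pnatr_eq0 -lt0n.
Qed.

Lemma le_kappa x y : (forall j, x j <= y j) -> kappa x <= kappa y.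
Proof. by move=> h; rewrite ler_wpM2l// ler_sum. Qed.

Lemma kappa_norm_le x : `|kappa x| <= kappa (fun j => `|x j|).
Proof. by rewrite /kappa normrM ger0_norm// ler_wpM2l// ler_norm_sum. Qed.

Lemma kappa_freq (A : finType) (w : 'I_N -> A) a :
  kappa (fun j => (w j == a)%:R) = freq R w a.
Proof. by rewrite /kappa /freq /cnt natr_sum mulrC. Qed.

End Kappa.

Lemma prod_word (R : comPzRingType) (J : finType) k (u : 'I_k -> J) (z : J -> R) :
  \prod_(l < k) z (u l) = \prod_j z j ^+ cnt u j.
Proof.
rewrite (partition_big u predT) //=; apply: eq_bigr => j _.
rewrite (eq_bigr (fun=> z j)); last by move=> l /eqP ->.
by rewrite prodr_const /cnt -sum1_card big_mkcond.
Qed.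

(** * Moment conditions bound the cell frequencies from above *)

Section Moments.
Context d (T : measurableType d) (R : realType) (P : probability T R) (n : nat).
Variables (X : 'I_n -> {RV P >-> R}) (r0 : R).

Definition good_set : set T := [set w | forall i, `|X i w| <= r0].

Lemma measurable_good_set : measurable good_set.
Proof.
rewrite (_ : good_set = \bigcap_(i in [set: 'I_n]) [set w | `|X i w| <= r0]).
  apply: fin_bigcap_measurable => // i _.
  rewrite (_ : [set _ | _] = (fun w => `|X i w|) @^-1` `]-oo, r0]).
    by rewrite -[_ @^-1` _]setTI; exact: measurableT_comp.
  by apply/seteqP; split => w /=; rewrite in_itv.
by apply/seteqP; split => w /= h i => [_|]; exact: h.
Qed.

Hypotheses (r0_gt0 : 0 < r0) (PD : P good_set = 1%E).
Hypothesis atomless : forall i c, P [set w | X i w = c] = 0%E.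
Local Notation D := good_set.
Let mD := measurable_good_set.

Lemma bounded_on_X i : bounded_on D (X i).
Proof. by split => //; exists r0 => w; exact. Qed.

Lemma measurable_band i c (eta : R) : measurable [set w | `|X i w - c| <= eta].
Proof.
rewrite (_ : [set _ | _] = (fun w => `|X i w - c|) @^-1` `]-oo, eta]); last first.
  by apply/seteqP; split => w /=; rewrite in_itv.
rewrite -[_ @^-1` _]setTI; apply: measurableT_comp => //.
exact: measurable_funB.
Qed.

(** The bands decrease to a level set of [X i], which is null because there are no atoms. This makes
    the error of the polynomials near a cut harmless. *)
Lemma small_band i c (e : R) : 0 < e ->
  \forall eta \near 0^'+, pr P [set w | `|X i w - c| <= eta] <= e.
Proof.
move=> e0; pose F k := [set w | `|X i w - c| <= k.+1%:R^-1].
have mF k : measurable (F k) by exact: measurable_band.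
have capF : \bigcap_k F k = [set w | X i w = c].
  apply/seteqP; split => w /= h => [|k _]; last first.
    by rewrite /F /= h subrr normr0.
  apply/eqP; rewrite -subr_eq0 -normr_le0; apply/ler_addgt0Pr => u u0.
  rewrite add0r; have [k hk] := near_infty_natSinv_lt (PosNum u0).
  by move/(_ k (leqnn k)) => /ltW; exact/le_trans/(h k).
have : P (F k) @[k --> \oo] --> P (\bigcap_k F k).
  apply: nonincreasing_cvg_mu => //.
  - by rewrite (le_lt_trans (probability_le1 P _))// ltry.
  - exact: bigcap_measurable.
  - move=> k l kl; apply/subsetPset => w /= /le_trans; apply.
    by rewrite lef_pV2 ?posrE ?ltr0n// ler_nat ltnS.
rewrite capF atomless => /fine_cvgP[_ /cvgrPdist_le/(_ _ e0)[k _ hk]].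
have := hk k (leqnn k); rewrite /= sub0r normrN => hk'.
exists k.+1%:R^-1 => /=; first by rewrite invr_gt0.
move=> eta /= heta eta0; rewrite sub0r normrN in heta.
apply: le_trans (le_trans (ler_norm _) hk'); apply: pr_le => //.
  exact: measurable_band.
by move=> w /= h; rewrite /F /= (le_trans h)// (le_trans (ler_norm _))// ltW.
Qed.

Variable J : finType.
Implicit Types (ix : J -> 'I_n) (f : J -> {poly R}) (c : J -> R) (sg : J -> bool).

Lemma prod_horner_expand f (m := (\max_j size (f j))%N) (y : J -> R) :
  \prod_j (f j).[y j] =
  \sum_(e : {ffun J -> 'I_m}) (\prod_j (f j)`_(e j)) * \prod_j y j ^+ e j.
Proof.
rewrite (eq_bigr (fun j => \sum_(k < m) (f j)`_k * y j ^+ k)); last first.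
  by move=> j _; rewrite (@horner_coef_wide _ m)// leq_bigmax.
by rewrite bigA_distr_bigA /=; apply: eq_bigr => e _; rewrite big_split.
Qed.

(** The product is a finite combination of monomials of degree at most [#|J| * M], each a word in
    the variables and thus subject to a moment condition; [S] exceeds the sum of the absolute
    coefficients. *)
Lemma poly_moment ix f (e : R) : 0 < e -> exists m0, exists2 delta0, 0 < delta0 &
  forall N m (delta : R) (x : 'I_n -> 'I_N -> R), (0 < N)%N -> (m0 <= m)%N ->
    delta <= delta0 -> Delta X m delta x ->
    `|kappa (fun j => \prod_l (f l).[x (ix l) j]) -
      Ev P D (fun w => \prod_l (f l).[X (ix l) w])| <= e.
Proof.
move=> e0; pose M := (\max_j size (f j))%N.
pose co (a : {ffun J -> 'I_M}) := \prod_j (f j)`_(a j).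
pose S : R := \sum_a `|co a| + 1.
have S0 : 0 < S by rewrite ltr_wpDl// sumr_ge0.
exists (#|J| * M)%N, (e / S) => [|N m delta x N0 hm hd hx]; first exact: divr_gt0.
have bmono (a : {ffun J -> 'I_M}) :
    bounded_on D (fun w => \prod_j X (ix j) w ^+ a j).
  by apply: bounded_on_prod => j; exact/bounded_onX/bounded_on_X.
rewrite (eq_kappa (fun j => prod_horner_expand f (fun l => x (ix l) j))).
rewrite kappa_sum.
have -> : Ev P D (fun w => \prod_l (f l).[X (ix l) w]) =
    \sum_(a : {ffun J -> 'I_M}) co a * Ev P D (fun w => \prod_j X (ix j) w ^+ a j).
  under eq_fun do rewrite prod_horner_expand.
  rewrite Ev_sum//; last by move=> a; exact/bounded_onZ.
  by apply: eq_bigr => a _; rewrite EvZ.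
rewrite -sumrB; apply: (le_trans (ler_norm_sum _ _ _)).
apply: (@le_trans _ _ (\sum_a `|co a| * (e / S))); last first.
  rewrite -mulr_suml mulrA ler_pdivrMr// [leRHS]mulrC ler_wpM2r ?(ltW e0)//.
  by rewrite /S lerDl.
apply: ler_sum => a _.
rewrite kappaZ -mulrBr normrM ler_wpM2l//.
pose k := (\sum_j a j)%N.
(* A monomial given by its exponents becomes a word [u] with these letter counts, the form in which
   [Delta] states moments. *)
have [u hu] := @word_of_type J k (fun j => a j) erefl.
have kM : (k <= #|J| * M)%N.
  by rewrite -sum_nat_const; apply: leq_sum => j _; exact: ltnW.
have monoE (z : 'I_n -> R) : \prod_j z (ix j) ^+ a j = \prod_(l < k) z (ix (u l)).
  by rewrite (prod_word u (fun j => z (ix j))); apply: eq_bigr => j _; rewrite hu.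
rewrite (eq_kappa (fun j => monoE (fun i => x i j))).
rewrite (_ : (fun w => \prod_j X (ix j) w ^+ a j) =
    (fun w => \prod_(l < k) X (ix (u l)) w)); last first.
  by apply/funext => w; rewrite (monoE (fun i => X i w)).
(* [Delta] says nothing about the empty word, but both of its averages are [1]. *)
have [k0|k0] := posnP k.
  rewrite (eq_kappa (y := fun=> 1)); last first.
    by move=> j; rewrite big1 // => -[l lk]; exfalso; move: lk; rewrite k0.
  rewrite (_ : (fun w => _) = (fun=> 1)); last first.
    by apply/funext => w; rewrite big1 // => -[l lk]; exfalso; move: lk; rewrite k0.
  by rewrite kappa_cst// Ev_cst// subrr normr0 ltW// divr_gt0.
have := hx k (ix \o u); rewrite k0 (leq_trans kM hm) => /(_ isT) /=.
rewrite (expectation_Ev mD PD); last by apply: bounded_on_prod => l; exact: bounded_on_X.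
by rewrite -EFinB lte_fin => h; rewrite (le_trans (ltW h)).
Qed.

Definition in_cell ix c sg (y : 'I_n -> R) : bool :=
  [forall l, (c l < y (ix l)) == sg l].

Lemma measurable_in_cell ix c sg : measurable [set w | in_cell ix c sg (X^~ w)].
Proof.
rewrite (_ : [set _ | _] = \bigcap_(l in [set: J]) [set w | (c l < X (ix l) w) = sg l]).
  apply: fin_bigcap_measurable => // l _.
  have mc : measurable [set w | c l < X (ix l) w].
    rewrite (_ : [set _ | _] = X (ix l) @^-1` `]c l, +oo[); last first.
      by apply/seteqP; split => w /=; rewrite in_itv /= andbT.
    by rewrite -[_ @^-1` _]setTI; exact: measurable_funPT.
  case: (sg l) => //.
  rewrite (_ : [set _ | _] = ~` [set w | c l < X (ix l) w]); first exact: measurableC.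
  by apply/seteqP; split => w /=; [move=> ->|move/negP/negbTE].
apply/seteqP; split => w /= h.
  by move=> l _; move/forallP: h => /(_ l)/eqP.
by apply/forallP => l; apply/eqP; exact: h.
Qed.

(* [1_cell <= prod f] everywhere, while outside a small neighbourhood of the
   cell boundary [prod f] is close to [1_cell] on the range of [X]. *)
Lemma cell_poly ix c sg (e : R) : 0 < e -> exists f,
  (forall y, (in_cell ix c sg y)%:R <= \prod_l (f l).[y (ix l)]) /\
  Ev P D (fun w => \prod_l (f l).[X (ix l) w]) <=
    pr P [set w | in_cell ix c sg (X^~ w)] + e.
Proof.
move=> e0; pose K : R := 2 ^+ #|J|.
have K1 : 1 <= K by rewrite exprn_ege1// ler1n.
have [u u0 [u1 hu]] : exists2 u : R, 0 < u & u <= 1 /\ (1 + u) ^+ #|J| - 1 + u * K <= e / 2.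
  have cvg0 : (fun u : R => (1 + u) ^+ #|J| - 1 + u * K) @ 0^'+ --> (0 : R).
    rewrite -[X in _ --> X](_ : (1 + 0) ^+ #|J| - 1 + 0 * K = 0); last first.
      by rewrite addr0 expr1n subrr mul0r addr0.
    apply: cvg_at_right_filter; apply: cvgD; last by apply: cvgM; [exact: cvg_id|exact: cvg_cst].
    apply: cvgB; last exact: cvg_cst.
    have : continuous (fun u : R => (1 + u) ^+ #|J|).
      have -> : (fun u : R => (1 + u) ^+ #|J|) = horner ((1 + 'X) ^+ #|J|).
        by apply/funext => z; rewrite horner_exp !hornerE.
      exact: continuous_horner.
    exact.
  have e20 : 0 < e / 2 by rewrite divr_gt0.
  have := @filter_ex _ _ _ _ (filterI (nbhs_right_gt (0 : R)) (filterI
    (nbhs_right_le (ltr01 : (0 : R) < 1)) (cvgr_le 0 cvg0 _ e20))).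
  by move=> [u [h1 [h2 h3]]]; exists u.
have [eta [eta0 heta]] : exists eta : R, 0 < eta /\
    forall l, pr P [set w | `|X (ix l) w - c l| <= eta] <= e / (2 * K * (#|J|%:R + 1)).
  have e' : 0 < e / (2 * K * (#|J|%:R + 1)).
    by rewrite divr_gt0// mulr_gt0 ?ltr_wpDl// mulr_gt0// (lt_le_trans ltr01).
  apply: (@filter_ex _ _ _ _ (filterI (nbhs_right_gt (0 : R)) (@filter_forall _ _
    (fun l eta => pr P [set w | `|X (ix l) w - c l| <= eta] <= e / (2 * K * (#|J|%:R + 1)))
    _ _ (fun l => small_band (ix l) (c l) e')))).
have /boolp.choice[f hf] : forall l, exists g, step_poly r0 (c l) eta u (sg l) g.
  by move=> l; exact: step_poly_ex.
exists f; split => [y|].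
  have [/forallP h|_] := boolP (in_cell ix c sg y); last first.
    by apply: prodr_ge0 => l _; have [+ _ _ _] := hf l; exact.
  apply: (@le_trans _ _ (\prod_(l : J) (1 : R))); first by rewrite big1_eq.
  apply: ler_prod => l _; rewrite ler01 /=.
  by have [_ + _ _] := hf l; apply; exact/eqP/h.
pose bad l w := `|X (ix l) w - c l| <= eta.
have mbad l : measurable [set w | bad l w] by exact: measurable_band.
have mcell := measurable_in_cell ix c sg.
have b1 : bounded_on D (fun w => (1 + u) ^+ #|J| * (in_cell ix c sg (X^~ w))%:R).
  exact/bounded_onZ/bounded_on_bool.
have b2 : bounded_on D (fun w => K * \sum_l (bad l w)%:R).
  by apply: bounded_onZ; apply: bounded_on_sum => l; exact: bounded_on_bool.
apply: (@le_trans _ _ (Ev P D (fun w => (1 + u) ^+ #|J| * (in_cell ix c sg (X^~ w))%:R +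
    (K * \sum_l (bad l w)%:R + u * K)))).
  apply: le_Ev => //.
  - by apply: bounded_on_prod => l; exact/bounded_on_horner/bounded_on_X.
  - by apply: bounded_onD => //; apply: bounded_onD => //; exact: bounded_on_cst.
  (* Three cases. On the cell the product is at most [(1 + u)^#|J|]. Off the cell some coordinate
     [l] is on the wrong side: either [w] lies in the band of [l], where [K = 2^#|J|] suffices, or
     the factor of [l] is at most [u] and the others at most [2]. *)
  move=> w Dw.
  have fle l : (f l).[X (ix l) w] <= 1 + u by have [_ _ + _] := hf l; apply; exact: Dw.
  have fge l : 0 <= (f l).[X (ix l) w] by have [+ _ _ _] := hf l; exact.
  have prodle : \prod_l (f l).[X (ix l) w] <= (1 + u) ^+ #|J|.
    by rewrite -prodr_const; apply: ler_prod => l _; rewrite fge fle.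
  have uK : (1 + u) ^+ #|J| <= K.
    by rewrite lerXn2r ?nnegrE ?addr_ge0 ?(ltW u0)//; lra.
  have sum0 : 0 <= \sum_l (bad l w)%:R :> R by apply: sumr_ge0.
  have uK0 : 0 <= u * K by rewrite mulr_ge0 ?(ltW u0)// (le_trans ler01).
  have K0 : 0 <= K by rewrite (le_trans ler01).
  have [h|] := boolP (in_cell ix c sg (X^~ w)).
    by rewrite mulr1 (le_trans prodle)// lerDl addr_ge0// mulr_ge0.
  rewrite /in_cell negb_forall => /existsP[l hl]; rewrite mulr0 add0r.
  have [bl|bl] := boolP (bad l w).
    rewrite (le_trans prodle)// (le_trans uK)//.
    apply: (@le_trans _ _ (K * \sum_l (bad l w)%:R)); last by rewrite lerDl.
    by rewrite ler_peMr// (bigD1 l)//= bl lerDl sumr_ge0.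
  rewrite (@le_trans _ _ (u * K))//; last by rewrite lerDr mulr_ge0.
  rewrite (bigD1 l)//= ler_pM ?prodr_ge0//.
    have [_ _ _ +] := hf l; apply; first exact: Dw.
      by move: hl; case: (_ < _); case: (sg l).
    by rewrite ltNge.
  apply: (@le_trans _ _ (\prod_(i | i != l) 2)).
    by apply: ler_prod => i _; rewrite fge (le_trans (fle i))//; lra.
  rewrite prodr_const ler_weXn2l ?ler1n//.
  by apply: subset_leq_card; apply/fintype.subsetP => ?.
have b3 : bounded_on D (fun w => K * \sum_l (bad l w)%:R + u * K).
  by apply: bounded_onD => //; exact: bounded_on_cst.
rewrite EvD// EvD//; last exact: bounded_on_cst.
rewrite EvZ//; last exact: bounded_on_bool.
rewrite EvZ//; last by apply: bounded_on_sum => l; exact: bounded_on_bool.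
rewrite Ev_cst// Ev_bool// Ev_sum//; last by move=> l; exact: bounded_on_bool.
have h1 : K * \sum_l Ev P D (fun w => (bad l w)%:R) <= e / 2.
  apply: (@le_trans _ _ (K * \sum_(l : J) (e / (2 * K * (#|J|%:R + 1))))).
    rewrite ler_wpM2l ?(le_trans ler01)//; apply: ler_sum => l _.
    by rewrite Ev_bool//; exact: heta.
  have -> (z : R) : \sum_(l : J) z = #|J|%:R * z by rewrite sumr_const mulr_natl.
  have -> : K * (#|J|%:R * (e / (2 * K * (#|J|%:R + 1)))) =
      e / 2 * (#|J|%:R / (#|J|%:R + 1)).
    by field; rewrite !gt_eqF ?ltr_wpDl// (lt_le_trans ltr01).
  by rewrite ler_piMr ?divr_ge0 ?(ltW e0)// ler_pdivrMr ?ltr_wpDl// mul1r lerDl.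
have : ((1 + u) ^+ #|J| - 1) * pr P [set w | in_cell ix c sg (X^~ w)] <=
    (1 + u) ^+ #|J| - 1.
  rewrite ler_piMr//; first by rewrite subr_ge0 exprn_ege1// lerDl ltW.
  by rewrite -(prT P); apply: pr_le.
by move=> h2; lra.
Qed.

Lemma cell_freq_le ix c sg (e : R) : 0 < e ->
  exists m0, exists2 delta0, 0 < delta0 &
  forall N m (delta : R) (x : 'I_n -> 'I_N -> R), (0 < N)%N -> (m0 <= m)%N ->
    delta <= delta0 -> Delta X m delta x ->
    kappa (fun j => (in_cell ix c sg (x^~ j))%:R) <=
      pr P [set w | in_cell ix c sg (X^~ w)] + e.
Proof.
move=> e0; have e20 : 0 < e / 2 by rewrite divr_gt0.
have [f [f1 f2]] := cell_poly ix c sg e20.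
have [m0 [delta0 d0 h]] := poly_moment ix f e20.
exists m0, delta0 => // N m delta x N0 hm hd hx.
have := h N m delta x N0 hm hd hx; rewrite ler_norml => /andP[_ h1].
apply: (@le_trans _ _ (kappa (fun j => \prod_l (f l).[x (ix l) j]))).
  by apply: le_kappa => j; exact: f1.
lra.
Qed.

End Moments.

(** * Relative entropy as a supremum over grids *)

Section RelativeEntropy.
Context d (T : measurableType d) (R : realType).
Implicit Types (mu nu P : probability T R).

Lemma le_integral_measurable P (D : set T) (f v : T -> \bar R) :
  measurable D -> measurable_fun D f -> measurable_fun D v ->
  (forall x, D x -> (v x <= f x)%E) ->
  (\int[P]_(x in D) v x <= \int[P]_(x in D) f x)%E.
Proof.
move=> mD mf mv h; rewrite integralE [leRHS]integralE leeB//.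
  apply: ge0_le_integral => //; [exact: measurable_funepos|exact: measurable_funepos|].
  move=> x Dx; rewrite !funeposE ge_max le_max (h x Dx)/=.
  by rewrite le_max lexx orbT.
apply: ge0_le_integral => //; [exact: measurable_funeneg|exact: measurable_funeneg|].
move=> x Dx; rewrite !funenegE ge_max le_max leeN2 (h x Dx)/=.
by rewrite le_max lexx orbT.
Qed.

(** A real-valued version of [dmu / dnu], packaged with the change of variables and with the entropy
    integrated over the points where it is positive, so that only logarithms of positive reals
    occur. *)
Definition is_likelihood_ratio mu nu (g : T -> R) :=
  [/\ measurable_fun [set: T] g, (forall x, 0 <= g x),
      (forall E (f : T -> \bar R), (forall x, (0 <= f x)%E) -> measurable E ->
        measurable_fun E f ->
        (\int[nu]_(x in E) (f x * (g x)%:E) = \int[mu]_(x in E) f x)%E),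
      mu [set x | 0 < g x] = 1%E &
      relative_entropy mu nu = (\int[mu]_(x in [set x | (0 < g x)%R]) (ln (g x))%:E)%E].

Lemma measurable_gt0 (g : T -> R) : measurable_fun [set: T] g ->
  measurable [set x | 0 < g x].
Proof.
move=> mg; rewrite (_ : [set _ | _] = g @^-1` `]0, +oo[); last first.
  by apply/seteqP; split => w /=; rewrite in_itv /= andbT.
by rewrite -[_ @^-1` _]setTI; exact: mg.
Qed.

Lemma likelihood_ratio_ex mu nu : (mu `<< nu) ->
  exists g, is_likelihood_ratio mu nu g.
Proof.
move=> dom; pose f := Radon_Nikodym_SigmaFinite.f mu nu.
have f0 x : (0 <= f x)%E by exact: Radon_Nikodym_SigmaFinite.f_ge0.
have ffin x : f x \is a fin_num by exact: Radon_Nikodym_SigmaFinite.f_fin_num.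
have mf : measurable_fun [set: T] f.
  exact: measurable_int (Radon_Nikodym_SigmaFinite.f_integrable dom).
pose g x := fine (f x).
have gE x : (g x)%:E = f x by rewrite /g fineK.
have mg : measurable_fun [set: T] g by exact: measurableT_comp.
have g0 x : 0 <= g x by rewrite fine_ge0.
pose G := [set x | 0 < g x].
have mG : measurable G by exact: measurable_gt0.
have muG : mu (~` G) = 0%E.
  rewrite (Radon_Nikodym_SigmaFinite.f_integral dom); last exact: measurableC.
  apply: integral0_eq => x /= /negP; rewrite -leNgt => gx.
  by rewrite -/(f x) -gE; congr EFin; apply/eqP; rewrite eq_le gx g0.
exists g; split => //.
- move=> E h h0 mE mh; under eq_integral do rewrite gE.
  exact: Radon_Nikodym_SigmaFinite.change_of_variables.
- have := probability_setC mu mG; rewrite muG => /esym/eqP.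
  rewrite sube_eq ?add0e => [/eqP <-//|//|].
  by rewrite fin_num_adde_defr.
rewrite /relative_entropy; case: asboolP => // _.
have mrn : measurable_fun [set: T] (Radon_Nikodym (charge_of_finite_measure mu) nu).
  by apply: measurable_int; exact: Radon_Nikodym_integrable.
have rnfin x : (Radon_Nikodym (charge_of_finite_measure mu) nu) x \is a fin_num.
  exact: Radon_Nikodym_fin_num.
have mlne (h : T -> R) : measurable_fun [set: T] h ->
    measurable_fun [set: T] (fun x => lne (h x)%:E).
  move=> mh; rewrite /lne; apply: measurable_fun_if => //.
  - exact: measurable_fun_ler.
  - apply/measurable_EFinP; apply: measurableT_comp => //.
    exact: measurable_funTS.
(* The derivative in [relative_entropy] is that of a charge, [f] that of a measure; they agree
   [nu]-almost everywhere, hence by domination [mu]-almost everywhere. *)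
have ae1 : ae_eq mu [set: T] (fun x => lne ((Radon_Nikodym (charge_of_finite_measure mu) nu) x))
    (fun x => lne (f x)).
  apply: (@null_dominates_ae_eq _ _ _ _ mu nu) => //.
  have := ae_eq_Radon_Nikodym_SigmaFinite dom measurableT.
  by apply: filterS => x h _; rewrite -h.
rewrite (ae_eq_integral _ _ _ _ _ ae1)//; last 2 first.
- under eq_fun do rewrite -(fineK (rnfin _)).
  by apply: mlne; exact: measurableT_comp.
- by under eq_fun do rewrite -gE; exact: mlne.
have ae2 : ae_eq mu [set: T] (fun x => lne (f x)) (fun x => (ln (g x))%:E).
  exists (~` G); split => //; first exact: measurableC.
  move=> x /= h; apply: contra_not h => gx _.
  by rewrite -gE lne_EFin.
rewrite (ae_eq_integral _ _ _ _ _ ae2)//; last 2 first.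
- by under eq_fun do rewrite -gE; exact: mlne.
- by apply/measurable_EFinP; exact: measurableT_comp.
have ae3 : ae_eq mu [set: T] (fun x => (ln (g x))%:E)
    ((fun x => (ln (g x))%:E) \_ G).
  exists (~` G); split => //; first exact: measurableC.
  by move=> x /= h; apply: contra_not h => gx _; rewrite patchE mem_set.
rewrite (ae_eq_integral _ _ _ _ _ ae3)// -?integral_mkcond//.
- by apply/measurable_EFinP; exact: measurableT_comp.
- apply/(measurable_restrictT _ mG).1; apply/measurable_funTS/measurable_EFinP.
  exact: measurableT_comp.
Qed.

Section Partition.
Variables (A : finType) (L : T -> A).
Hypothesis mL : forall a, measurable [set x | L x == a].

Lemma measurable_fin_comp (F : A -> R) : measurable_fun [set: T] (fun x => F (L x)).
Proof.
rewrite (_ : (fun x => _) = (fun x => \sum_a F a * (L x == a)%:R)); last first.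
  apply/funext => x; rewrite (bigD1 (L x))//= eqxx mulr1 big1 ?addr0// => a.
  by rewrite eq_sym => /negbTE ->; rewrite mulr0.
apply: measurable_sum => a; apply: measurable_funM => //.
rewrite (_ : (fun w => _) = \1_[set x | L x == a]); first exact: measurable_indic.
by apply/funext => w; rewrite indicE mem_setE.
Qed.

Lemma bounded_on_fin (D : set T) (F : A -> R) : bounded_on D (fun x => F (L x)).
Proof.
split; first exact: measurable_fin_comp.
by exists (\sum_a `|F a|) => x _; rewrite (bigD1 (L x))//= lerDl sumr_ge0.
Qed.

Lemma Ev_fin P (D : set T) (F : A -> R) : measurable D -> P D = 1%E ->
  Ev P D (fun x => F (L x)) = \sum_a F a * pr P [set x | L x == a].
Proof.
move=> mD PD.
rewrite (_ : (fun x => F (L x)) = (fun x => \sum_a F a * (L x == a)%:R)); last first.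
  apply/funext => x; rewrite (bigD1 (L x))//= eqxx mulr1 big1 ?addr0// => a.
  by rewrite eq_sym => /negbTE ->; rewrite mulr0.
rewrite Ev_sum//; last by move=> a; exact/bounded_onZ/bounded_on_bool.
by apply: eq_bigr => a _; rewrite EvZ ?Ev_bool//; exact: bounded_on_bool.
Qed.

Lemma sum_pr_fin P : \sum_a pr P [set x | L x == a] = 1.
Proof.
have := @Ev_fin P setT (fun=> 1) measurableT (probability_setT P).
rewrite Ev_cst//; last exact: probability_setT.
by move=> ->; apply: eq_bigr => a _; rewrite mul1r.
Qed.

(* With [g = dmu/dnu] and [r = mu(L=.)/nu(L=.)], integrate
   [ln r + 1 - r / g <= ln g] against [mu]. *)
Lemma partition_entropy_le mu nu :
  ((\sum_a pr mu [set x | L x == a] *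
     (ln (pr mu [set x | L x == a]) - ln (pr nu [set x | L x == a])))%:E <=
   relative_entropy mu nu)%E.
Proof.
have [dom|ndom] := pselect (mu `<< nu); last first.
  by rewrite /relative_entropy asboolF// leey.
have [g [mg g0 cv muG ->]] := likelihood_ratio_ex dom.
pose p a := pr mu [set x | L x == a]; pose q a := pr nu [set x | L x == a].
pose r a := p a / q a.
have p0 a : 0 <= p a by exact: pr_ge0.
have q0 a : 0 <= q a by exact: pr_ge0.
have r0 a : 0 <= r a by rewrite divr_ge0.
have qp a : q a = 0 -> p a = 0.
  move=> qa; have /null_content_dominatesP/(_ _ (mL a)) := dom.
  have nu0 : nu [set x | L x == a] = 0%E by rewrite prE// -/(q a) qa.
  by move=> /(_ nu0) h; rewrite /p /pr h.
(* On [D], which has full [mu]-measure, [g] and [r] are positive, so neither [ln] nor the division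
   takes a default value. *)
pose D := [set x | 0 < g x] `&` [set x | p (L x) != 0].
have mp : measurable [set x | p (L x) != 0].
  rewrite (_ : [set _ | _] = \bigcup_(a in [set a | p a != 0]) [set x | L x == a]).
    by apply: fin_bigcup_measurable => //; exact: finite_finset.
  apply/seteqP; split => [x /= h|x /= [a h] /eqP ->//].
  by exists (L x) => /=.
have mD : measurable D by apply: measurableI => //; exact: measurable_gt0.
have mup : mu (~` [set x | p (L x) != 0]) = 0%E.
  have -> : ~` [set x | p (L x) != 0] = [set x | (p (L x) == 0)].
    by apply/seteqP; split => x /=; [move/negP; rewrite negbK|move=> ->].
  rewrite prE; last first.
    rewrite (_ : [set _ | _] = ~` [set x | p (L x) != 0]); first exact: measurableC.
    by apply/seteqP; split => x /=; [move=> ->|move/negP; rewrite negbK].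
  rewrite (@pr_sum_fin _ _ _ mu setT measurableT (probability_setT mu) _ L
    (fun a => p a == 0))//.
  by rewrite big1// => a /eqP.
have muDC : mu ([set x | 0 < g x] `\` D) = 0%E.
  apply/eqP; rewrite -measure_le0 -mup le_measure ?inE//.
  - apply: measurableD => //; exact: measurable_gt0.
  - exact: measurableC.
  - by move=> x [gx] /not_andP[].
have muD : mu D = 1%E.
  have H : mu [set x | 0 < g x] = (mu ([set x | (0 < g x)%R] `\` [set x | p (L x) != 0%R]) + mu D)%E.
    exact: (measureDI mu (measurable_gt0 mg) mp).
  rewrite -muG H [X in (X + _)%E](_ : _ = 0%E) ?add0e//.
  rewrite -muDC; congr (mu _); apply/seteqP; split => x [gx h]; split => //.
    by case.
  by move=> px; apply: h.
rewrite (_ : (\int[mu]_(x in [set x | (0 < g x)%R]) (ln (g x))%:E =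
    \int[mu]_(x in D) (ln (g x))%:E)%E); last first.
  rewrite integral_mkcond [RHS]integral_mkcond.
  apply: ae_eq_integral => //.
  - apply/(measurable_restrictT _ (measurable_gt0 mg)).1.
    by apply/measurable_funTS/measurable_EFinP; exact: measurableT_comp.
  - apply/(measurable_restrictT _ mD).1.
    by apply/measurable_funTS/measurable_EFinP; exact: measurableT_comp.
  exists ([set x | 0 < g x] `\` D); split => //.
    by apply: measurableD => //; exact: measurable_gt0.
  move=> x /= h; apply: contra_notP h => h _; rewrite !patchE.
  have [xG|xG] := boolP (x \in [set x | 0 < g x]).
    have -> // : x \in D by apply: contra_notT h => xD; split; [exact: set_mem|rewrite notin_setE in xD].
  by case: ifPn => // /set_mem[xG' _]; rewrite notin_setE in xG.
pose s x := ln (r (L x)) + 1.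
have bs : bounded_on D s by exact: (bounded_on_fin D (fun a => ln (r a) + 1)).
pose t x := r (L x) * expR (- ln (g x)).
have t0 x : 0 <= t x by rewrite mulr_ge0// expR_ge0.
have tE x : 0 < g x -> expR (- ln (g x)) = (g x)^-1.
  by move=> gx; rewrite expRN lnK.
have mt : measurable_fun [set: T] t.
  apply: measurable_funM; first exact: measurable_fin_comp.
  by apply: measurableT_comp => //; apply: measurable_funN; exact: measurableT_comp.
(* The change of variables turns the [mu]-integral of [r / g] into a [nu]-integral of [r], at most
   the sum of the [r a * q a], hence at most the total mass of [p]; if [q a = 0] then [r a = 0] by
   default. *)
have tle : (\int[mu]_(x in D) (t x)%:E <= 1)%E.
  rewrite -cv//; last by apply/measurable_funTS/measurable_EFinP.
  rewrite (eq_integral (fun x => (r (L x))%:E)); last first.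
    move=> x /set_mem[/= gx _]; rewrite -EFinM /t tE// -mulrA mulVf ?mulr1//.
    by rewrite gt_eqF.
  apply: (@le_trans _ _ (\int[nu]_x (r (L x))%:E)%E).
    apply: ge0_subset_integral => //.
    - by apply/measurable_EFinP; exact: measurable_fin_comp.
    - by move=> x _; rewrite lee_fin.
  have br := bounded_on_fin setT r.
  have nuT := probability_setT nu.
  rewrite -[X in (X <= _)%E]fineK; last first.
    by apply: integrable_fin_num => //; exact: (bounded_on_integrable measurableT nuT br).
  rewrite lee_fin -[X in X <= _]/(Ev nu setT (fun x => r (L x))) Ev_fin//.
  rewrite -(sum_pr_fin mu); apply: ler_sum => a _; rewrite -/(p a) -/(q a) /r.
  have [qa|qa] := eqVneq (q a) 0; first by rewrite qa mulr0.
  by rewrite divfK.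
have it : mu.-integrable D (EFin \o t).
  apply/integrableP; split; first exact/measurable_funTS/measurable_EFinP.
  under eq_integral do rewrite /= ger0_norm//.
  by rewrite (le_lt_trans tle)// ltry.
apply: (@le_trans _ _ (\int[mu]_(x in D) ((EFin \o s) x - (EFin \o t) x))%E).
  rewrite integralB//; last exact: (bounded_on_integrable mD muD bs).
  rewrite -[X in (_ <= X - _)%E]fineK; last first.
    by apply: integrable_fin_num => //; exact: (bounded_on_integrable mD muD bs).
  rewrite -[X in (_ <= X%:E - _)%E]/(Ev mu D s) (Ev_fin (fun a => ln (r a) + 1) mD muD).
  have -> : \sum_a (ln (r a) + 1) * pr mu [set x | L x == a] =
      \sum_a p a * (ln (p a) - ln (q a)) + 1.
    rewrite -[X in _ + X](sum_pr_fin mu) -big_split/=; apply: eq_bigr => a _.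
    rewrite -/(p a) mulrDl mul1r mulrC; congr (_ + _).
    have [pa|pa] := eqVneq (p a) 0; first by rewrite pa !mul0r.
    have qa : q a != 0 by apply: contra_neq pa; exact: qp.
    by rewrite /r ln_div ?posrE ?lt0r ?pa ?qa ?p0 ?q0.
  apply: (@le_trans _ _ ((\sum_a p a * (ln (p a) - ln (q a)) + 1)%:E - 1)%E).
    by rewrite -EFinB lee_fin addrK.
  by rewrite leeB.
apply: le_integral_measurable => //.
- by apply/measurable_funTS/measurable_EFinP; exact: measurableT_comp.
- apply: emeasurable_funB; apply/measurable_funTS/measurable_EFinP => //.
  exact: (measurable_fin_comp (fun a => ln (r a) + 1)).
move=> x [/= gx px]; rewrite lee_fin /s /t tE//.
have pp : 0 < p (L x) by rewrite lt0r px p0.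
have qq : 0 < q (L x).
  by rewrite lt0r q0 andbT; apply: contra_neq px; exact: qp.
have rr : 0 < r (L x) by rewrite divr_gt0.
have := @ln_le_subr1 R (r (L x) / g x); rewrite divr_gt0// ln_div ?posrE// => /(_ isT).
by move=> h; lra.
Qed.

End Partition.
End RelativeEntropy.

(** * Grid sets approximate measurable sets in two measures at once *)

Section GridApproximation.
Variables (R : realType) (n : nat).
Local Notation TR := (n.-tuple R).

(** A point is labelled by the set of cuts below it. Cuts may come in any order and with
    repetitions, so two grids are merged by concatenation, as in [on_grid2]. *)
Definition lab K (c : 'I_K -> R) (x : R) : {ffun 'I_K -> bool} := [ffun k => c k < x].

Definition grid_lab K (c : 'I_K -> R) (t : TR) : {ffun 'I_n -> {ffun 'I_K -> bool}} :=
  [ffun i => lab c (tnth t i)].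

Definition on_grid U (phi : TR -> U) := exists K (c : 'I_K -> R)
  (F : {ffun 'I_n -> {ffun 'I_K -> bool}} -> U), forall t, phi t = F (grid_lab c t).

Lemma on_grid_cst U (u : U) : on_grid (fun=> u).
Proof. by exists 0%N, (fun=> 0), (fun=> u). Qed.

Lemma on_grid2 U V W (f : U -> V -> W) (phi : TR -> U) (psi : TR -> V) :
  on_grid phi -> on_grid psi -> on_grid (fun t => f (phi t) (psi t)).
Proof.
move=> [K [c [F hF]]] [K' [c' [F' hF']]].
pose cc (k : 'I_(K + K')) := match fintype.split k with inl k => c k | inr k => c' k end.
exists (K + K')%N, cc, (fun a : {ffun 'I_n -> {ffun 'I_(K + K') -> bool}} =>
  f (F [ffun i => [ffun k => a i (lshift K' k)]])
    (F' [ffun i => [ffun k => a i (rshift K k)]])) => t.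
rewrite hF hF'; congr (f (F _) (F' _)); apply/ffunP => i; rewrite !ffunE;
  apply/ffunP => k; rewrite !ffunE /cc.
  case: splitP => j /= e; first by congr (c _ < _); exact: val_inj.
  by have := ltn_ord k; rewrite e ltnNge leq_addr.
case: splitP => [j /= e|j /= e]; last by congr (c' _ < _); apply/val_inj/(@addnI K).
by have := ltn_ord j; rewrite -e ltnNge leq_addr.
Qed.

Lemma measurable_grid_lab K (c : 'I_K -> R) a : measurable [set t | grid_lab c t == a].
Proof.
rewrite (_ : [set _ | _] = \bigcap_(i in [set: 'I_n]) \bigcap_(k in [set: 'I_K])
    [set t : TR | (c k < tnth t i) = a i k]).
  apply: fin_bigcap_measurable => // i _; apply: fin_bigcap_measurable => // k _.
  have mc : measurable [set t : TR | c k < tnth t i].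
    rewrite (_ : [set _ | _] = (@tnth n R)^~ i @^-1` `]c k, +oo[); last first.
      by apply/seteqP; split => w /=; rewrite in_itv /= andbT.
    by rewrite -[_ @^-1` _]setTI; exact: measurable_tnth.
  case: (a i k) => //.
  rewrite (_ : [set _ | _] = ~` [set t : TR | c k < tnth t i]); first exact: measurableC.
  by apply/seteqP; split => w /=; [move=> ->|move/negP/negbTE].
apply/seteqP; split => t /=.
  by move=> /eqP h i _ k _ /=; rewrite -h !ffunE.
move=> h; apply/eqP/ffunP => i; apply/ffunP => k; rewrite !ffunE.
exact: (h i Logic.I k Logic.I).
Qed.

Lemma measurable_on_grid (b : TR -> bool) : on_grid b -> measurable [set t | b t].
Proof.
move=> [K [c [F hF]]].
rewrite (_ : [set _ | _] = \bigcup_(a in [set a | F a]) [set t | grid_lab c t == a]).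
  apply: fin_bigcup_measurable; first exact: finite_finset.
  by move=> a _; exact: measurable_grid_lab.
apply/seteqP; split => [t /= h|t /= [a h] /eqP e]; last by rewrite hF e.
by exists (grid_lab c t); rewrite //= -hF.
Qed.

Section TwoMeasures.
Variables mu nu : probability TR R.

Definition differ (A : set TR) (b : TR -> bool) := [set t | (t \in A) != b t].

Lemma measurable_differ A b : measurable A -> on_grid b -> measurable (differ A b).
Proof.
move=> mA /measurable_on_grid mb.
rewrite (_ : differ A b = (A `\` [set t | b t]) `|` ([set t | b t] `\` A)).
  by apply: measurableU; exact: measurableD.
apply/seteqP; split => t; rewrite /differ /=.
  have [/set_mem tA|/negP tA] := boolP (t \in A); case: (b t) => //= _; [left|right] => //.
  by split => // tA'; apply: tA; rewrite inE.
move=> [[tA]|[bt tA]].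
  by rewrite mem_set//; case: (b t).
by rewrite memNset// bt.
Qed.

(** One grid set has to serve both measures, because the functional [dv_bound] involves both. *)
Definition approximable (A : set TR) := measurable A /\ forall e : R, 0 < e ->
  exists2 b, on_grid b & pr mu (differ A b) <= e /\ pr nu (differ A b) <= e.

Lemma pr_union_le (P : probability TR R) A B C (e e' : R) :
  measurable A -> measurable B -> measurable C -> A `<=` B `|` C ->
  pr P B <= e -> pr P C <= e' -> pr P A <= e + e'.
Proof.
move=> mA mB mC h hB hC; apply: le_trans (lerD hB hC).
apply: (@le_trans _ _ (pr P (B `|` C))); first by apply: pr_le => //; exact: measurableU.
rewrite -lee_fin EFinD -!prE//; last exact: measurableU.
exact: measureU2.
Qed.

Lemma approximableU A B : approximable A -> approximable B -> approximable (A `|` B).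
Proof.
move=> [mA hA] [mB hB]; split; first exact: measurableU.
move=> e e0; have e20 : 0 < e / 2 by rewrite divr_gt0.
have [b gb [b1 b2]] := hA _ e20; have [b' gb' [b1' b2']] := hB _ e20.
have gbb : on_grid (fun t => b t || b' t) by exact: on_grid2.
exists (fun t => b t || b' t) => //.
have sub : differ (A `|` B) (fun t => b t || b' t) `<=` differ A b `|` differ B b'.
  move=> t; rewrite /differ /= in_setU.
  by case: (t \in A); case: (t \in B); case: (b t); case: (b' t) => //= _; auto.
have m1 := measurable_differ mA gb; have m2 := measurable_differ mB gb'.
have m3 := measurable_differ (measurableU _ _ mA mB) gbb.
by split; rewrite [e]splitr; exact: (pr_union_le m3 m1 m2).
Qed.

Lemma approximable0 : approximable set0.
Proof.
split => // e e0; exists (fun=> false); first exact: on_grid_cst.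
rewrite (_ : differ _ _ = set0); last first.
  by apply/seteqP; split => t //=; rewrite /differ /= in_set0.
by rewrite /pr !measure0/= ltW.
Qed.

Lemma approximableC A : approximable A -> approximable (~` A).
Proof.
move=> [mA hA]; split; first exact: measurableC.
move=> e e0; have [b gb hb] := hA _ e0.
exists (fun t => ~~ b t); first exact: (on_grid2 (fun u _ => ~~ u) gb gb).
rewrite (_ : differ (~` A) (fun t => ~~ b t) = differ A b)//.
by apply/seteqP; split => t; rewrite /differ /= in_setC; case: (t \in A); case: (b t).
Qed.

Lemma pr_tail (P : probability TR R) (A : nat -> set TR) (e : R) :
  (forall k, measurable (A k)) -> 0 < e ->
  \forall k \near \oo, pr P (\bigcup_j A j `\` \bigcup_(j < k) A j) <= e.
Proof.
move=> mA e0; pose F k := \bigcup_j A j `\` \bigcup_(j < k) A j.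
have mU : measurable (\bigcup_j A j) by exact: bigcup_measurable.
have mF k : measurable (F k).
  by apply: measurableD => //; apply: bigcup_measurable => j _.
have : P (F k) @[k --> \oo] --> P (\bigcap_k F k).
  apply: nonincreasing_cvg_mu => //.
  - by rewrite (le_lt_trans (probability_le1 P _))// ltry.
  - exact: bigcap_measurable.
  - move=> k l kl; apply/subsetPset => t [h1 h2]; split => // -[j /= jk Aj].
    by apply: h2; exists j => //=; exact: leq_trans kl.
have -> : \bigcap_k F k = set0.
  apply/seteqP; split => t // h; have [[j _ Aj] _] := h 0%N Logic.I.
  by have [_] := h j.+1 Logic.I; apply; exists j => /=.
rewrite measure0 => /fine_cvgP[_ /cvgrPdist_le/(_ _ e0)].
apply: filterS => k; rewrite /= sub0r normrN; exact/le_trans/ler_norm.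
Qed.

(** A finite part of the union misses at most [e / 2] in each measure, and finite unions of
    approximable sets are approximable. *)
Lemma approximable_bigcup (A : nat -> set TR) :
  (forall k, approximable (A k)) -> approximable (\bigcup_k A k).
Proof.
move=> aA; have mA k : measurable (A k) by case: (aA k).
have mU : measurable (\bigcup_j A j) by exact: bigcup_measurable.
split => // e e0; have e20 : 0 < e / 2 by rewrite divr_gt0.
have [k [k1 k2]] := @filter_ex _ _ _ _ (filterI (pr_tail mu mA e20) (pr_tail nu mA e20)).
have aF : approximable (\bigcup_(j < k) A j).
  rewrite bigcup_mkord; elim: (k) => [|l IH]; first by rewrite big_ord0; exact: approximable0.
  by rewrite big_ord_recr /=; exact: approximableU.
have [mF hF] := aF; have [b gb [b1 b2]] := hF _ e20; exists b => //.
have sub : differ (\bigcup_j A j) b `<=`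
    (\bigcup_j A j `\` \bigcup_(j < k) A j) `|` differ (\bigcup_(j < k) A j) b.
  move=> t; rewrite /differ /= => h.
  have [tF|tF] := boolP (t \in \bigcup_(j < k) A j).
    right; move: h; rewrite mem_set//; move/set_mem: tF => [j _ Aj].
    by exists j.
  have [tU|tU] := boolP (t \in \bigcup_j A j).
    by left; split; [exact: set_mem|rewrite notin_setE in tF].
  by right; move: h; rewrite (negbTE tU).
have m1 := measurable_differ mU gb; have m2 := measurable_differ mF gb.
have m3 : measurable (\bigcup_j A j `\` \bigcup_(j < k) A j) by exact: measurableD.
by split; rewrite [e]splitr; exact: (pr_union_le m1 m3 m2).
Qed.

Lemma approximable_sigma_algebra : sigma_algebra [set: TR] approximable.
Proof.
split; first exact: approximable0.
- by move=> A aA; rewrite setTD; exact: approximableC.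
- by move=> A aA; exact: approximable_bigcup.
Qed.

Lemma approximable_halfspace i (x : R) : approximable [set t : TR | x < tnth t i].
Proof.
have gb : on_grid (fun t : TR => x < tnth t i).
  by exists 1%N, (fun=> x), (fun a : {ffun 'I_n -> {ffun 'I_1 -> bool}} => a i ord0) => t; rewrite !ffunE.
split; first exact: measurable_on_grid.
move=> e e0; exists (fun t => x < tnth t i) => //.
rewrite (_ : differ _ _ = set0); last first.
  by apply/seteqP; split => t //=; rewrite /differ /= mem_setE eqxx.
by rewrite /pr !measure0/= ltW.
Qed.

(** Minimality of a generated sigma-algebra is used twice: for the product, generated by preimages
    under the coordinates, and for the Borel sets of the line, generated by open half-lines, whose
    preimages are themselves grid sets. *)
Lemma measurable_approximable (A : set TR) : measurable A -> approximable A.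
Proof.
move: A; apply: smallest_sub; first exact: approximable_sigma_algebra.
apply: (big_ind (fun S => S `<=` approximable)) => [A []|S S' hS hS' A [/hS|/hS']//|i _ A].
move=> [B mB <-]; rewrite setTI.
have {}mB : (@RGenOInfty.G R).-sigma.-measurable B by rewrite -RGenOInfty.measurableE.
move: B mB; apply: smallest_sub; last first.
  move=> B /= [x ->]; rewrite (_ : _ @^-1` _ = [set t : TR | x < tnth t i]).
    exact: approximable_halfspace.
  by apply/seteqP; split => t /=; rewrite in_itv /= andbT.
split => /=; first by rewrite preimage_set0; exact: approximable0.
- by move=> B aB; rewrite setTD preimage_setC; exact: approximableC.
- by move=> B aB; rewrite preimage_bigcup; exact: approximable_bigcup.
Qed.

End TwoMeasures.
End GridApproximation.

(** * A bound valid on all grids bounds the relative entropy *)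

Section GridEntropy.
Variables (R : realType) (n : nat).
Local Notation TR := (n.-tuple R).
Variables mu nu : probability TR R.
Variable s : R.

Definition grid_pr (P : probability TR R) K (c : 'I_K -> R)
    (a : {ffun 'I_n -> {ffun 'I_K -> bool}}) : R :=
  pr P [set t | grid_lab c t == a].

Hypothesis grid_dom : forall K (c : 'I_K -> R) a, grid_pr nu c a = 0 -> grid_pr mu c a = 0.
Hypothesis grid_le : forall K (c : 'I_K -> R),
  \sum_a grid_pr mu c a * (ln (grid_pr mu c a) - ln (grid_pr nu c a)) <= s.

Let muT : mu [set: TR] = 1%E := probability_setT mu.
Let nuT : nu [set: TR] = 1%E := probability_setT nu.
Let mT := @measurableT _ TR.

Lemma bounded_on_expR (D : set TR) (Y : TR -> R) :
  bounded_on D Y -> bounded_on D (fun t => expR (Y t)).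
Proof.
move=> [mY [C hC]]; split; first exact: measurableT_comp.
exists (expR C) => t /hC h; rewrite ger0_norm ?expR_ge0// ler_expR.
exact: le_trans (ler_norm _) h.
Qed.

(** The Donsker-Varadhan inequality with [- ln (E exp phi)] replaced by its minorant
    [1 - E exp phi]. Both expectations now enter linearly, so approximation errors simply add. *)
Definition dv_bound (phi : TR -> R) : Prop :=
  Ev mu setT phi - Ev nu setT (fun t => expR (phi t)) + 1 <= s.

(** Cell by cell this is [ln x <= x - 1] at [x = q exp F / p]; a cell with [p = 0] contributes a
    nonpositive term, and [grid_dom] excludes [q = 0 < p]. *)
Lemma dv_grid phi : on_grid phi -> dv_bound phi.
Proof.
move=> [K [c [F hF]]]; rewrite /dv_bound.
have -> : phi = (fun t => F (grid_lab c t)) by exact/funext.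
have mL := @measurable_grid_lab R n K c.
rewrite (Ev_fin mL F mT muT) (Ev_fin mL (fun a => expR (F a)) mT nuT).
apply: le_trans (grid_le c); rewrite -(sum_pr_fin mL mu) -sumrB -big_split /=.
apply: ler_sum => a _; rewrite -!/(grid_pr _ c a).
have p0 : 0 <= grid_pr mu c a by exact: pr_ge0.
have q0 : 0 <= grid_pr nu c a by exact: pr_ge0.
have := @grid_dom K c a.
move: p0 q0; set p := grid_pr mu c a; set q := grid_pr nu c a => p0 q0 dom.
have [->|pN0] := eqVneq p 0.
  by rewrite mulr0 mul0r addr0 sub0r oppr_le0 mulr_ge0// expR_ge0.
have pp : 0 < p by rewrite lt0r pN0.
have qq : 0 < q by rewrite lt0r q0 andbT; apply: contra_neq pN0.
have := @ln_le_subr1 R (q * expR (F a) / p); rewrite divr_gt0 ?mulr_gt0 ?expR_gt0//.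
move=> /(_ isT); rewrite ln_div ?posrE ?mulr_gt0 ?expR_gt0//.
rewrite lnM ?posrE ?expR_gt0// expRK => /(ler_wpM2l (ltW pp)).
have -> : p * (q * expR (F a) / p - 1) = q * expR (F a) - p by field.
by move=> h; lra.
Qed.

(** Each layer is replaced by a grid set differing from it by at most [u] in both measures. The two
    expectations move by at most [eta * L * u] and [C * eta * L * u], and [u] is chosen to make the
    sum at most [e]. *)
Lemma dv_layers L (A : 'I_L -> set TR) (M eta : R) : 0 <= eta ->
  (forall j, measurable (A j)) ->
  dv_bound (fun t => - M + eta * \sum_j (t \in A j)%:R).
Proof.
move=> eta0 mA; apply/ler_addgt0Pr => /= e e0.
pose C := expR (eta * L%:R - M).
have C0 : 0 < C by exact: expR_gt0.
pose u : R := e / ((1 + C) * (eta * L%:R + 1)).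
have den0 : 0 < (1 + C) * (eta * L%:R + 1).
  by rewrite mulr_gt0// ltr_wpDl ?mulr_ge0// ltW.
have u0 : 0 < u by rewrite divr_gt0.
have /boolp.choice[b hb] : forall j, exists b, on_grid b /\
    pr mu (differ (A j) b) <= u /\ pr nu (differ (A j) b) <= u.
  move=> j; have [_ /(_ u u0)[b gb h]] := measurable_approximable mu nu (mA j).
  by exists b.
pose phi t : R := - M + eta * \sum_j (t \in A j)%:R.
pose psi t : R := - M + eta * \sum_j (b j t)%:R.
pose df t : R := \sum_j ((t \in A j) != b j t)%:R.
have mdiff j : measurable [set t | (t \in A j) != b j t].
  by apply: measurable_differ => //; case: (hb j).
have bdiff j : bounded_on setT (fun t => ((t \in A j) != b j t)%:R : R).
  exact: bounded_on_bool.
have Edf (P : probability TR R) : P setT = 1%E ->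
    (forall j, pr P (differ (A j) (b j)) <= u) -> Ev P setT df <= L%:R * u.
  move=> PT h; rewrite /df Ev_sum//.
  have -> : L%:R * u = \sum_(j < L) u by rewrite sumr_const card_ord mulr_natl.
  by apply: ler_sum => j _; rewrite Ev_bool//; exact: h.
have bphi : bounded_on setT phi.
  apply: bounded_onD; first exact: bounded_on_cst.
  apply: bounded_onZ; apply: bounded_on_sum => j; apply: bounded_on_bool.
  by rewrite (_ : [set _ | _] = A j)//; apply/seteqP; split => t /=; rewrite inE.
have bpsi : bounded_on setT psi.
  apply: bounded_onD; first exact: bounded_on_cst.
  apply: bounded_onZ; apply: bounded_on_sum => j; apply: bounded_on_bool.
  by apply: measurable_on_grid; case: (hb j).
have bdf : bounded_on setT df by exact: bounded_on_sum.
have psi_grid : on_grid psi.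
  have gb j : on_grid (b j) by case: (hb j).
  have : forall r : seq 'I_L, on_grid (fun t => \sum_(j <- r) (b j t)%:R : R).
    elim=> [|j r IH].
      by under eq_fun do rewrite big_nil; exact: on_grid_cst.
    under eq_fun do rewrite big_cons.
    exact: (on_grid2 (fun (x : bool) y => x%:R + y) (gb j) IH).
  move=> /(_ (index_enum _)) gs.
  exact: (on_grid2 (fun x (_ : R) => - M + eta * x) gs gs).
have dle (x y : bool) : (x%:R : R) <= y%:R + (x != y)%:R.
  by case: x; case: y => /=; lra.
have le1 t : phi t <= psi t + eta * df t.
  rewrite /phi /psi -addrA lerD2l -mulrDr ler_wpM2l// /df -big_split /=.
  by apply: ler_sum => j _; exact: dle.
have le2 t : psi t <= phi t + eta * df t.
  rewrite /phi /psi -addrA lerD2l -mulrDr ler_wpM2l// /df -big_split /=.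
  by apply: ler_sum => j _; rewrite eq_sym; exact: dle.
(* Convexity gives [exp psi - exp phi <= exp psi (psi - phi)], and [C] bounds [exp psi]. *)
have le3 t : expR (psi t) <= expR (phi t) + C * eta * df t.
  have df0 : 0 <= df t by apply: sumr_ge0.
  have : expR (psi t) <= C.
    rewrite ler_expR /psi addrC lerD2r ler_wpM2l//.
    have -> : L%:R = \sum_(j < L) (1 : R) by rewrite sumr_const card_ord.
    by apply: ler_sum => j _; case: (b j t).
  have := expR_ge1Dx (phi t - psi t); rewrite expRD expRN => h hC.
  have e0' := expR_gt0 (psi t).
  have : expR (psi t) * (1 + (phi t - psi t)) <= expR (phi t).
    by rewrite -ler_pdivlMl// mulrC.
  have : expR (psi t) * (psi t - phi t) <= C * (eta * df t).
    apply: (@le_trans _ _ (expR (psi t) * (eta * df t))).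
      by rewrite ler_wpM2l ?(ltW e0')// lerBlDl.
    by rewrite ler_wpM2r// mulr_ge0.
  by move=> ? ?; lra.
have E1 : Ev mu setT phi <= Ev mu setT psi + eta * (L%:R * u).
  apply: (@le_trans _ _ (Ev mu setT (fun t => psi t + eta * df t))).
    by apply: le_Ev => //; apply: bounded_onD => //; exact: bounded_onZ.
  rewrite EvD//; last exact: bounded_onZ.
  rewrite EvZ// lerD2l ler_wpM2l//; apply: Edf => // j.
  by case: (hb j) => _ [].
have E2 : Ev nu setT (fun t => expR (psi t)) <=
    Ev nu setT (fun t => expR (phi t)) + C * eta * (L%:R * u).
  apply: (@le_trans _ _ (Ev nu setT (fun t => expR (phi t) + C * eta * df t))).
    apply: le_Ev => //; first exact: bounded_on_expR.
    by apply: bounded_onD; [exact: bounded_on_expR|exact: bounded_onZ].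
  rewrite EvD//; [|exact: bounded_on_expR|exact: bounded_onZ].
  rewrite EvZ// lerD2l ler_wpM2l// ?mulr_ge0 ?(ltW C0)//; apply: Edf => // j.
  by case: (hb j) => _ [].
have := dv_grid psi_grid; rewrite /dv_bound => h.
have : (1 + C) * (eta * L%:R) * u <= e.
  rewrite /u mulrA ler_pdivrMr// [leRHS]mulrC ler_wpM2r ?(ltW e0)//.
  by rewrite ler_wpM2l ?addr_ge0 ?(ltW C0)// lerDl.
by move=> hu; lra.
Qed.

(** Test with [k] times the indicator of a [nu]-null set [A]: its exponential has [nu]-mean [1], so
    [k mu(A) <= s] for every [k]. *)
Lemma grid_bound_dominates : mu `<< nu.
Proof.
apply/null_content_dominatesP => A mA nuA.
have prnu : pr nu A = 0 by rewrite /pr nuA.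
have bA : bounded_on setT (fun t => (t \in A)%:R : R).
  by apply: bounded_on_bool; rewrite (_ : [set _ | _] = A)//;
     apply/seteqP; split => t /=; rewrite inE.
have EA (P : probability TR R) : P setT = 1%E -> Ev P setT (fun t => (t \in A)%:R) = pr P A.
  move=> PT; rewrite Ev_bool//; last by rewrite (_ : [set _ | _] = A)//;
     apply/seteqP; split => t /=; rewrite inE.
  by congr pr; apply/seteqP; split => t /=; rewrite inE.
have hk (k : nat) : k%:R * pr mu A <= s.
  have := @dv_layers 1 (fun=> A) 0 k%:R (ler0n _ _) (fun=> mA).
  rewrite /dv_bound; under eq_fun do rewrite big_ord1 oppr0 add0r.
  under [in X in _ - X]eq_fun do rewrite big_ord1 oppr0 add0r.
  rewrite (EvZ mT muT _ bA) (EA mu muT).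
  have -> : (fun t => expR (k%:R * (t \in A)%:R : R)) =
      (fun t => 1 + (expR k%:R - 1) * (t \in A)%:R).
    apply/funext => t; case: (t \in A); rewrite ?mulr1 ?mulr0 ?addr0 ?expR0//.
    by rewrite addrC subrK.
  rewrite (EvD mT nuT (bounded_on_cst _ _) (bounded_onZ _ bA)).
  rewrite (EvZ mT nuT _ bA) (EA nu nuT) prnu (Ev_cst mT nuT).
  by lra.
have p0 := pr_ge0 mu A.
have : pr mu A = 0.
  apply/eqP; rewrite eq_le p0 andbT leNgt; apply/negP => pA.
  have := hk (Num.truncn (`|s| / pr mu A)).+1.
  rewrite leNgt => /negP; apply; apply: le_lt_trans (ler_norm s) _.
  by rewrite -ltr_pdivrMr// truncnS_gt.
by rewrite prE// => ->.
Qed.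

(** The sum is the integer part of [y] capped at [L]; it turns a bounded function into a sum of
    layers. *)
Lemma count_levels (y : R) L : 0 <= y ->
  \sum_(j < L) ((j.+1)%:R <= y)%R%:R <= y :> R /\
  Num.min (y - 1) L%:R <= \sum_(j < L) ((j.+1)%:R <= y)%R%:R :> R.
Proof.
move=> y0; have cL L' : \sum_(j < L') ((j.+1)%:R <= y)%R%:R <= L'%:R :> R.
  have -> : L'%:R = \sum_(j < L') (1 : R) by rewrite sumr_const card_ord.
  by apply: ler_sum => j _; case: (_ <= y).
elim: L => [|L [IH1 IH2]]; first by rewrite big_ord0 ge_min lexx orbT.
rewrite big_ord_recr /=; have := cL L; rewrite -natr1; case: (leP (L%:R + 1) y) => /= h hL.
  rewrite min_r in IH2; last by lra.
  by split; [lra|rewrite ge_min; apply/orP; right; lra].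
rewrite addr0; split => //; rewrite min_l in IH2; last by lra.
by rewrite ge_min; apply/orP; left; lra.
Qed.

(** Take [phi] to be [ln g] clamped to [[-kk, kk]] and rounded down to multiples of [1 / kk]. As
    [exp phi <= max (g, exp (- kk))], its [nu]-mean is at most [1 + exp (- kk)], so the functional
    bounds the [mu]-mean of [phi] by [s + exp (- kk)]; then [kk] tends to infinity. *)
Lemma relative_entropy_grid_le : (relative_entropy mu nu <= s%:E)%E.
Proof.
have [g [mg g0 cv muG ->]] := likelihood_ratio_ex grid_bound_dominates.
set G := [set x | (0 < g x)%R].
have mG : measurable G by exact: measurable_gt0.
have mlng : measurable_fun [set: TR] (fun x => ln (g x)) by exact: measurableT_comp.
(* [ln g] may be unbounded below. Adding [h], which is [1 / g] on [G] and has [mu]-integral at most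
   [1], makes it at least [1], so monotone convergence applies; [h] is subtracted at the end. *)
pose h x := expR (- ln (g x)).
have h0 x : 0 <= h x by exact: expR_ge0.
have mh : measurable_fun [set: TR] h.
  by apply: measurableT_comp => //; exact: measurable_funN.
have Eg (f : TR -> R) : measurable_fun [set: TR] f -> measurable_fun G (EFin \o f).
  by move=> mf; apply/measurable_funTS/measurable_EFinP.
have hle : (\int[mu]_(x in G) (h x)%:E <= 1)%E.
  rewrite -cv//; last exact: Eg.
  rewrite (eq_integral (cst 1%E)); last first.
    move=> x /set_mem /= gx; rewrite -EFinM /h expRN lnK// mulVf//.
    by rewrite gt_eqF.
  by rewrite integral_cst// mul1e; exact: probability_le1.
have ih : mu.-integrable G (EFin \o h).
  apply/integrableP; split; first exact: Eg.
  under eq_integral do rewrite /= ger0_norm//.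
  by rewrite (le_lt_trans hle)// ltry.
pose H := fine (\int[mu]_(x in G) (h x)%:E)%E.
have HE : (\int[mu]_(x in G) (h x)%:E)%E = H%:E.
  by rewrite fineK//; exact: integrable_fin_num.
have lnh x : 1 <= ln (g x) + h x.
  by have := expR_ge1Dx (- ln (g x)); rewrite /h; lra.
pose U (k : nat) x := Num.min (ln (g x)) k%:R + h x.
have mU k : measurable_fun [set: TR] (U k).
  apply: measurable_funD => //; exact: measurable_minr.
have U0 k x : 0 <= U k x.
  rewrite /U minElt; case: ifP => _; first by rewrite (le_trans _ (lnh x)).
  by rewrite addr_ge0.
have Ule k : (\int[mu]_(x in G) (U k.+1 x)%:E <= (s + H + 2 / k.+1%:R)%:E)%E.
  pose kk : R := k.+1%:R.
  have kk0 : 0 < kk by rewrite ltr0n.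
  pose l x := ln (Num.max (g x) (expR (- kk))).
  have l_ge x : - kk <= l x.
    rewrite /l -{1}[- kk]expRK ler_ln ?posrE ?expR_gt0 ?le_max ?lexx ?orbT//.
    by rewrite lt_max expR_gt0 orbT.
  (* The number of levels of height [1 / kk] that cover [[-kk, kk]]. *)
  pose L := (2 * k.+1 * k.+1)%N.
  pose A (j : 'I_L) := [set x | (j.+1)%:R <= kk * (l x + kk)].
  have ml : measurable_fun [set: TR] l.
    by apply: measurableT_comp => //; exact: measurable_maxr.
  have mA j : measurable (A j).
    rewrite (_ : A j = (fun x => kk * (l x + kk)) @^-1` `[(j.+1)%:R, +oo[).
      rewrite -[_ @^-1` _]setTI; apply: measurable_funM => //.
      exact: measurable_funD.
    by apply/seteqP; split => x /=; rewrite /A /= in_itv /= andbT.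
  pose phi x := - kk + kk^-1 * \sum_j (x \in A j)%:R.
  have phi_dv : dv_bound phi by apply: dv_layers => //; rewrite invr_ge0 ltW.
  have cnt_x x := @count_levels (kk * (l x + kk)) L.
  have phiE x : phi x = - kk + kk^-1 * \sum_(j < L) ((j.+1)%:R <= kk * (l x + kk))%R%:R.
    by congr (_ + _ * _); apply: eq_bigr => j _; rewrite mem_setE.
  have y0 x : 0 <= kk * (l x + kk).
    by rewrite mulr_ge0 ?(ltW kk0)//; have := l_ge x; lra.
  have phi_le x : phi x <= l x.
    rewrite phiE; have [hz _] := cnt_x x (y0 x); move: hz.
    set z := \sum_(j < L) _ => hz.
    by rewrite addrC lerBlDr ler_pdivrMl.
  have phi_ge x : Num.min (l x) kk - kk^-1 <= phi x.
    rewrite phiE; have [_] := cnt_x x (y0 x).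
    move: (\sum_(j < L) _) => z hz.
    have : kk * (Num.min (l x) kk - kk^-1 + kk) <= z.
      apply: le_trans hz; rewrite le_min; apply/andP; split.
        rewrite mulrDr mulrBr divff ?gt_eqF// mulrDr addrAC lerD2r lerD2r.
        by rewrite ler_pM2l// ge_min lexx.
      rewrite /L !natrM -/kk [leRHS](_ : _ = kk * (kk + kk)); last by ring.
      rewrite ler_pM2l// lerD2r lerBlDr (le_trans (_ : _ <= kk))//.
        by rewrite ge_min lexx orbT.
      by rewrite lerDl invr_ge0 ltW.
    by rewrite -ler_pdivlMl//; move: (kk^-1 * z) (kk^-1) => v w ?; lra.
  have bphi : bounded_on setT phi.
    apply: bounded_onD; first exact: bounded_on_cst.
    apply: bounded_onZ; apply: bounded_on_sum => j; apply: bounded_on_bool.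
    by rewrite (_ : [set _ | _] = A j)//; apply/seteqP; split => t /=; rewrite inE.
  have bphiG : bounded_on G phi.
    by case: bphi => mphi [C hC]; split => //; exists C => x _; exact: hC.
  have Enu : Ev nu setT (fun x => expR (phi x)) <= 1 + expR (- kk).
    rewrite -lee_fin -[X in (X <= _)%E](expectation_Ev mT nuT) ?unlock; last exact: bounded_on_expR.
    apply: (@le_trans _ _ (\int[nu]_x ((g x)%:E + (expR (- kk))%:E))%E).
      apply: ge0_le_integral => //.
      - apply/measurable_EFinP; apply: measurableT_comp => //; by case: bphi.
      - by apply: emeasurable_funD => //; exact/measurable_EFinP.
      move=> x _; rewrite -EFinD lee_fin.
      apply: (@le_trans _ _ (expR (l x))); first by rewrite ler_expR.
      rewrite /l lnK ?posrE ?lt_max ?expR_gt0 ?orbT// ge_max.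
      by rewrite lerDl expR_ge0 lerDr g0.
    have Ecst (P : probability TR R) (r : R) : (\int[P]_x r%:E = r%:E)%E.
      by have := expectation_cst P r; rewrite unlock.
    rewrite ge0_integralD//; last 2 first.
    - by move=> x _; rewrite lee_fin.
    - exact/measurable_EFinP.
    have : (\int[nu]_x (g x)%:E = 1)%E.
      under eq_integral do rewrite -[X in (X%:E)%E]mul1r EFinM.
      by rewrite (cv setT (fun=> 1%E)) ?Ecst// => x; rewrite lee_fin.
    by move=> ->; rewrite Ecst -EFinD.
  have Emu : Ev mu G phi <= s + expR (- kk).
    have -> : Ev mu G phi = Ev mu setT phi.
      by apply: EFin_inj; rewrite -(expectation_Ev mG muG bphiG) -(expectation_Ev mT muT bphi).
    by move: phi_dv; rewrite /dv_bound; lra.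
  (* The rounding and this exponential each cost at most [1 / kk], whence the [2 / k.+1] in the
     claim. *)
  have ekk : expR (- kk) <= kk^-1.
    rewrite expRN lef_pV2 ?posrE ?expR_gt0//.
    by have := expR_ge1Dx kk; lra.
  have bphi1 : bounded_on G (fun x => phi x + kk^-1).
    by apply: bounded_onD => //; exact: bounded_on_cst.
  apply: (@le_trans _ _ (\int[mu]_(x in G) ((EFin \o (fun x => phi x + kk^-1)%R) x + (EFin \o h) x))%E).
    apply: ge0_le_integral => //.
    - by move=> x _; rewrite lee_fin.
    - exact: Eg.
    - by apply: emeasurable_funD; apply: Eg => //; case: bphi1.
    move=> x /= gx; rewrite -EFinD lee_fin /U lerD2r.
    apply: (@le_trans _ _ (Num.min (l x) kk)).
      rewrite le_min !ge_min /l lexx orbT andbT; apply/orP; left.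
      by rewrite ler_ln ?posrE// ?lt_max ?gx// le_max lexx.
    by rewrite -lerBlDr.
  rewrite integralD//; last exact: (bounded_on_integrable mG muG bphi1).
  rewrite [X in (_ + X)%E]HE -[X in (X + _)%E]fineK; last first.
    by apply: integrable_fin_num => //; exact: (bounded_on_integrable mG muG bphi1).
  rewrite -[X in (X%:E + _)%E]/(Ev mu G (fun x => phi x + kk^-1)).
  rewrite EvD//; last exact: bounded_on_cst.
  rewrite Ev_cst// -EFinD lee_fin -/kk.
  have -> : 2 / kk = kk^-1 + kk^-1 by ring.
  move: ekk Emu; move: (kk^-1) (expR (- kk)) => v w ? ?.
  by lra.
have limU : (\int[mu]_(x in G) (ln (g x) + h x)%:E <= (s + H)%:E)%E.
  have cvgU : (\int[mu]_(x in G) (U k x)%:E @[k --> \oo] -->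
      \int[mu]_(x in G) (ln (g x) + h x)%:E)%E.
    rewrite [X in _ --> X](_ : _ = (\int[mu]_(x in G) limn (fun k => (U k x)%:E))%E).
      apply: (@cvg_monotone_convergence _ _ _ mu G mG (fun k x => (U k x)%:E)).
      - by move=> k; exact: (Eg _ (mU k)).
      - by move=> k x _; rewrite lee_fin.
      - move=> x _ k k' kk'; rewrite lee_fin lerD2r le_min ge_min lexx /=.
        by rewrite ge_min ler_nat kk' orbT.
    apply: eq_integral => x _; apply/esym/cvg_lim => //; apply: cvg_near_cst.
    near=> k; rewrite /U min_l//; near: k; exact: nbhs_infty_ger.
  apply/lee_addgt0Pr => e e0.
  apply: (cvge_le _ cvgU); near=> k.
  have kpos : (0 < k)%N by near: k; exact: nbhs_infty_gt.
  rewrite -(prednK kpos); apply: (le_trans (Ule _)).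
  rewrite -EFinD lee_fin lerD2l prednK// ler_pdivrMr ?ltr0n// -ler_pdivrMl//.
  by near: k; exact: nbhs_infty_ger.
have ilh : mu.-integrable G (EFin \o (fun x => ln (g x) + h x)).
  apply/integrableP; split; first by apply: Eg; exact: measurable_funD.
  under eq_integral do rewrite /= ger0_norm ?(le_trans _ (lnh _))//.
  by rewrite (le_lt_trans limU)// ltry.
rewrite (eq_integral (fun x => (EFin \o (fun x => ln (g x) + h x)%R) x - (EFin \o h) x)%E).
  rewrite integralB// [X in (_ - X <= _)%E]HE.
  by rewrite leeBlDr// -EFinD.
by move=> x _; rewrite /= -EFinB addrK.
Unshelve. all: by end_near. Qed.

End GridEntropy.

(** * Upper bound *)

Section LimitBounds.
Variable R : realType.
Implicit Types (u : nat -> \bar R) (v : \bar R).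

Lemma limn_esup_le_near u v : (\forall N \near \oo, (u N <= v)%E) ->
  (limn_esup u <= v)%E.
Proof.
move=> [N _ h]; rewrite /limn_esup /limf_esup.
apply: (@le_trans _ _ (ereal_sup (u @` [set k | (N <= k)%N]))).
  by apply: ereal_inf_lbound; exists [set k | (N <= k)%N] => //; exists N.
by apply: ge_ereal_sup => _ [k kN <-]; exact: h.
Qed.

Lemma limn_einf_ge_near u v : (\forall N \near \oo, (v <= u N)%E) ->
  (v <= limn_einf u)%E.
Proof.
move=> h; rewrite /limn_einf leeNr; apply: limn_esup_le_near.
by apply: filterS h => N; rewrite leeN2.
Qed.

End LimitBounds.

Section MonotoneWords.
Variable N : nat.
Implicit Types (b : 'I_N -> bool).

Lemma sum_ord_geq m : (\sum_(i < N) (m <= i) = N - m)%N.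
Proof.
elim: N => [|k IH]; first by rewrite big_ord0.
by rewrite big_ord_recr /= IH; case: leqP => h; lia.
Qed.

(** The ones of a nondecreasing word form a final segment, so their number determines the word.
    Hence a sorted vector has at most [N + 1] patterns per cut, whatever its entries. *)
Lemma monotone_threshold b : (forall j k : 'I_N, (j <= k)%N -> b j -> b k) ->
  forall j, b j = (N - \sum_k b k <= j)%N.
Proof.
move=> mb j; have jN := ltn_ord j; apply/idP/idP => h.
  have : (N - j <= \sum_k b k)%N.
    rewrite -(sum_ord_geq j); apply: leq_sum => k _; case: (leqP j k) => // jk.
    by rewrite (mb j k).
  by lia.
apply: contraLR h => bj; rewrite -ltnNge.
have : (\sum_k b k <= N - j.+1)%N.
  rewrite -(sum_ord_geq j.+1); apply: leq_sum => k _; case: (leqP j.+1 k) => kj.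
    by case: (b k).
  by case e : (b k) => //; rewrite (mb k j) in bj.
by lia.
Qed.

End MonotoneWords.

Section Labels.
Context d (T : measurableType d) (R : realType) (P : probability T R) (n : nat).
Variables (X : 'I_n -> {RV P >-> R}).

Definition xlab K (c : 'I_K -> R) (y : 'I_n -> R) : {ffun 'I_n -> {ffun 'I_K -> bool}} :=
  [ffun i => lab c (y i)].

Definition cell_pr K (c : 'I_K -> R) a : R := pr P [set w | xlab c (X^~ w) == a].

Lemma grid_lab_joint K (c : 'I_K -> R) w : grid_lab c (joint_rv X w) = xlab c (X^~ w).
Proof. by apply/ffunP => i; rewrite !ffunE tnth_mktuple. Qed.

Lemma measurable_xlab K (c : 'I_K -> R) a : measurable [set w | xlab c (X^~ w) == a].
Proof.
rewrite (_ : [set _ | _] = joint_rv X @^-1` [set t | grid_lab c t == a]).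
  rewrite -[_ @^-1` _]setTI; apply: measurable_joint_rv => //.
  exact: measurable_grid_lab.
by apply/seteqP; split => w /=; rewrite grid_lab_joint.
Qed.

Lemma grid_pr_joint K (c : 'I_K -> R) a : grid_pr (joint_distribution X) c a = cell_pr c a.
Proof.
rewrite /grid_pr /cell_pr /pr; congr fine; rewrite /= /distribution /pushforward /=.
by congr (P _); apply/seteqP; split => w /=; rewrite grid_lab_joint.
Qed.

Lemma cell_pr_ge0 K (c : 'I_K -> R) a : 0 <= cell_pr c a.
Proof. exact: pr_ge0. Qed.

Lemma sum_cell_pr K (c : 'I_K -> R) : \sum_a cell_pr c a = 1.
Proof. exact: (sum_pr_fin (measurable_xlab c)). Qed.

Lemma marginal_cell_pr K (c : 'I_K -> R) i b :
  marginal (cell_pr c) i b = pr P [set w | lab c (X i w) == b].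
Proof.
rewrite /marginal /cell_pr.
rewrite -(@pr_sum_fin _ _ _ P setT measurableT (probability_setT P) _ _
  (fun a : {ffun 'I_n -> {ffun 'I_K -> bool}} => a i == b)); last exact: measurable_xlab.
by congr pr; apply/seteqP; split => w /=; rewrite ffunE.
Qed.

Lemma measurable_lab K (c : 'I_K -> R) i b : measurable [set w | lab c (X i w) == b].
Proof.
rewrite (_ : [set _ | _] = \bigcup_(a in [set a : {ffun 'I_n -> {ffun 'I_K -> bool}} | a i == b])
    [set w | xlab c (X^~ w) == a]).
  apply: fin_bigcup_measurable; first exact: finite_finset.
  by move=> a _; exact: measurable_xlab.
apply/seteqP; split => [w /= h|w [a /= h] /eqP e]; last by rewrite -(eqP h) -e ffunE.
by exists (xlab c (X^~ w)); rewrite //= ffunE.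
Qed.

Lemma grid_pr_product K (c : 'I_K -> R) a :
  grid_pr (product_of_marginals X) c a = \prod_i marginal (cell_pr c) i (a i).
Proof.
have mB i : measurable [set x : R | lab c x == a i].
  rewrite (_ : [set _ | _] = \bigcap_(k in [set: 'I_K]) [set x | (c k < x) = a i k]).
    apply: fin_bigcap_measurable => // k _.
    have mc : measurable [set x | c k < x].
      by rewrite (_ : [set _ | _] = `]c k, +oo[%classic)//;
         apply/seteqP; split => w /=; rewrite in_itv /= andbT.
    case: (a i k) => //.
    rewrite (_ : [set _ | _] = ~` [set x | c k < x]); first exact: measurableC.
    by apply/seteqP; split => w /=; [move=> ->|move/negP/negbTE].
  apply/seteqP; split => x /=; first by move=> /eqP h k _ /=; rewrite -h ffunE.
  by move=> h; apply/eqP/ffunP => k; rewrite ffunE; exact: h.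
rewrite /grid_pr /pr.
rewrite (_ : [set t | grid_lab c t == a] =
    [set t | forall i, [set x | lab c x == a i] (tnth t i)]); last first.
  apply/seteqP; split => t /=; first by move=> /eqP h i; rewrite -h ffunE.
  by move=> h; apply/eqP/ffunP => i; rewrite ffunE; exact/eqP/h.
have E i : distribution P (X i) [set x | lab c x == a i] = (marginal (cell_pr c) i (a i))%:E.
  rewrite marginal_cell_pr -prE; last exact: measurable_lab.
  by rewrite /= /distribution /pushforward.
transitivity (fine (\prod_i distribution P (X i) [set x | lab c x == a i])%E).
  congr fine; exact: (product_probability_rect (fun i => distribution P (X i)) mB).
rewrite (eq_bigr (fun i => (marginal (cell_pr c) i (a i))%:E)); last by move=> i _; exact: E.
by rewrite prodEFin.
Qed.

End Labels.

Section MutualInfo.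
Variables (R : realType) (n : nat) (B : finType) (p : {ffun 'I_n -> B} -> R).
Hypothesis p_ge0 : forall a, 0 <= p a.

Lemma marginal_ge_p (a : {ffun 'I_n -> B}) i : p a <= marginal p i (a i).
Proof. by rewrite /marginal (bigD1 a)//= lerDl sumr_ge0. Qed.

Lemma prod_marginal_eq0 (a : {ffun 'I_n -> B}) : \prod_i marginal p i (a i) = 0 -> p a = 0.
Proof.
move/eqP; rewrite prodf_seq_eq0 => /hasP[i _ /= /eqP h].
by apply/eqP; rewrite eq_le p_ge0 andbT -h marginal_ge_p.
Qed.

(** Where [p a > 0] every marginal factor is at least [p a], so the logarithm of the product splits;
    where [p a = 0] the terms vanish. *)
Lemma mutual_infoE : mutual_info p =
  \sum_a p a * (ln (p a) - ln (\prod_i marginal p i (a i))).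
Proof.
rewrite /mutual_info; under [in RHS]eq_bigr do rewrite mulrBr.
rewrite sumrB; congr (_ - _).
rewrite [RHS](eq_bigr (fun a => \sum_i p a * ln (marginal p i (a i)))); last first.
  move=> a _; have [->|pa] := eqVneq (p a) 0.
    by rewrite mul0r big1// => i _; rewrite mul0r.
  rewrite -mulr_sumr -ln_prod_gt0// => i.
  by rewrite (lt_le_trans _ (marginal_ge_p a i))// lt0r pa p_ge0.
rewrite [RHS]exchange_big /=; apply: eq_bigr => i _.
rewrite [RHS](partition_big (fun a : {ffun 'I_n -> B} => a i) predT)//=.
apply: eq_bigr => b _; rewrite /xlnx {1}/marginal mulr_suml.
by apply: eq_bigr => a /eqP ->.
Qed.

End MutualInfo.

Section UpperBound.
Context d (T : measurableType d) (R : realType) (P : probability T R) (n : nat).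
Variables (X : 'I_n -> {RV P >-> R}).

Lemma mutual_info_le K (c : 'I_K -> R) :
  ((mutual_info (cell_pr X c))%:E <=
   relative_entropy (joint_distribution X) (product_of_marginals X))%E.
Proof.
rewrite mutual_infoE; last exact: cell_pr_ge0.
have := partition_entropy_le (@measurable_grid_lab R n K c)
  (joint_distribution X) (product_of_marginals X).
apply: le_trans; rewrite lee_fin le_eqVlt; apply/orP; left; apply/eqP.
by apply: eq_bigr => a _; rewrite -!/(grid_pr _ c a) grid_pr_joint grid_pr_product.
Qed.

(** If no grid exceeded [s], [relative_entropy_grid_le] would bound the relative entropy by [s]; its
    domination hypothesis holds because a joint cell weighs no more than any of its marginals. An
    infinite relative entropy is included. *)
Lemma mutual_info_sup (s : R) :
  (s%:E < relative_entropy (joint_distribution X) (product_of_marginals X))%E ->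
  exists K (c : 'I_K -> R), s < mutual_info (cell_pr X c).
Proof.
move=> sS; apply: contrapT => h.
have : (relative_entropy (joint_distribution X) (product_of_marginals X) <= s%:E)%E.
  apply: relative_entropy_grid_le => K c.
    move=> a; rewrite grid_pr_joint grid_pr_product.
    exact: prod_marginal_eq0 (@cell_pr_ge0 _ _ _ _ _ X K c) _.
  under eq_bigr do rewrite grid_pr_joint grid_pr_product.
  rewrite -mutual_infoE; last exact: cell_pr_ge0.
  by rewrite leNgt; apply/negP => ?; apply: h; exists K, c.
by rewrite leNgt sS.
Qed.

Definition labels K (c : 'I_K -> R) N (x : 'I_n -> 'I_N -> R) :
    'I_N -> {ffun 'I_n -> {ffun 'I_K -> bool}} :=
  joint_word (fun i j => lab c (x i j)).

Lemma labels_perm K (c : 'I_K -> R) N (x : 'I_n -> 'I_N -> R) (s : {ffun 'I_n -> 'S_N}) :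
  labels c (fun i => perm_vec (s i) (x i)) =
  joint_word (permute_words s (fun i j => lab c (x i j))).
Proof. by []. Qed.

Section Frequencies.
Variable r0 : R.
Hypotheses (r0_gt0 : 0 < r0) (PD : P (good_set X r0) = 1%E).
Hypothesis atomless : forall i c, P [set w | X i w = c] = 0%E.

(** A joint label is a conjunction of half-line conditions, one for each pair of a coordinate and a
    cut. *)
Lemma cell_freq_near K (c : 'I_K -> R) a (e : R) : 0 < e ->
  \forall md \near filter_prod \oo (0 : R)^'+,
  forall N (x : 'I_n -> 'I_N -> R), (0 < N)%N -> Delta X md.1 md.2 x ->
    freq R (labels c x) a <= cell_pr X c a + e.
Proof.
move=> e0.
have [m0 [delta0 d0 h]] := @cell_freq_le _ _ _ _ _ X r0 r0_gt0 PD atomless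
  ('I_n * 'I_K)%type fst (fun l => c l.2) (fun l => a l.1 l.2) e e0.
have cellE (y : 'I_n -> R) :
    in_cell fst (fun l : 'I_n * 'I_K => c l.2) (fun l => a l.1 l.2) y = (xlab c y == a).
  apply/forallP/eqP => [h'|<- -[i k]]; last by rewrite !ffunE.
  apply/ffunP => i; apply/ffunP => k; rewrite !ffunE; exact/eqP/(h' (i, k)).
exists ([set m | (m0 <= m)%N], [set delta | delta <= delta0]).
  split; first by exists m0.
  exact: nbhs_right_le.
move=> [m delta] [/= hm hd] N x N0 hx; have := h N m delta x N0 hm hd hx.
rewrite (_ : kappa _ = freq R (labels c x) a); last first.
  rewrite -kappa_freq; apply: eq_kappa => j; rewrite cellE.
  by congr ((_ == a)%:R); apply/ffunP => i; rewrite !ffunE.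
by rewrite (_ : [set w | _] = [set w | xlab c (X^~ w) == a])//;
  apply/seteqP; split => w /=; rewrite cellE.
Qed.

(** Frequencies and probabilities both sum to one, so an excess of at most [e / M] in every other
    cell bounds the deficit in this one. *)
Lemma freq_near K (c : 'I_K -> R) (e : R) : 0 < e ->
  \forall md \near filter_prod \oo (0 : R)^'+,
  forall N (x : 'I_n -> 'I_N -> R), (0 < N)%N -> Delta X md.1 md.2 x ->
    forall a, `|freq R (labels c x) a - cell_pr X c a| <= e.
Proof.
move=> e0; pose M : R := #|{: {ffun 'I_n -> {ffun 'I_K -> bool}}}|%:R + 1.
have M0 : 0 < M by rewrite ltr_wpDl.
have eM : 0 < e / M by rewrite divr_gt0.
have FF : Filter (filter_prod \oo (0 : R)^'+) by exact: filter_prod_filter.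
have := filter_forall FF (fun a => @cell_freq_near K c a _ eM).
apply: filterS => -[m delta] h N x N0 hx a.
have hb b := h b N x N0 hx.
have sumE : freq R (labels c x) a - cell_pr X c a =
    - \sum_(b | b != a) (freq R (labels c x) b - cell_pr X c b).
  have : \sum_b (freq R (labels c x) b - cell_pr X c b) = 0.
    by rewrite sumrB sum_freq// sum_cell_pr subrr.
  by rewrite (bigD1 a)//= => /eqP; rewrite addr_eq0 => /eqP.
have le1 : e / M <= e by rewrite ler_pdivrMr// ler_peMr ?(ltW e0)// /M lerDr.
rewrite ler_norml; apply/andP; split; last by have := hb a; lra.
rewrite sumE lerN2.
apply: (@le_trans _ _ (\sum_(b : {ffun 'I_n -> {ffun 'I_K -> bool}}) e / M)).
  rewrite [leLHS]big_mkcond; apply: ler_sum => b _; case: ifP => _.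
    by have := hb b; lra.
  exact: ltW.
rewrite sumr_const -[_ *+ _]mulr_natl mulrCA ler_piMr ?(ltW e0)// ler_pdivrMr// mul1r.
by rewrite /M lerDl.
Qed.

End Frequencies.

(** * Union bound over polynomially many label words and types *)

Section Counting.
Variables (K : nat) (c : 'I_K -> R) (N : nat) (E : set {ffun 'I_n -> 'S_N}).
Variables (p : {ffun 'I_n -> {ffun 'I_K -> bool}} -> R) (eta D : R).
Hypothesis N0 : (0 < N)%N.
Hypothesis hE : forall s, E s -> exists2 x : 'I_n -> 'I_N -> R,
  (forall i, nondecreasing_vec (x i)) &
  forall a, `|freq R (labels c (fun i => perm_vec (s i) (x i))) a - p a| <= eta.
Hypothesis hD : forall tau, (forall a, `|tau a - p a| <= eta) -> D <= mutual_info tau.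
Local Notation A := {ffun 'I_n -> {ffun 'I_K -> bool}}.
Local Notation C := (1 + n + #|{: A}| + n * #|{: {ffun 'I_K -> bool}}|)%N.

(** How many entries exceed each cut, for each coordinate, together with the joint type. The sorted
    vectors vary with the permutations, but matter only through these numbers. *)
Definition code := ({ffun 'I_n * 'I_K -> 'I_N.+1} * {ffun A -> 'I_N.+1})%type.

Definition decode (th : {ffun 'I_n * 'I_K -> 'I_N.+1}) (i : 'I_n) (j : 'I_N) :
  {ffun 'I_K -> bool} := [ffun k => (N - th (i, k) <= j)%N].

Lemma code_ex : exists f : {ffun 'I_n -> 'S_N} -> code, forall s, E s ->
  (forall a, cnt (joint_word (permute_words s (decode (f s).1))) a = (f s).2 a) /\
  forall a, `|freq R (joint_word (permute_words s (decode (f s).1))) a - p a| <= eta.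
Proof.
suff /boolp.choice[f hf] : forall s, exists u : code, E s ->
    (forall a, cnt (joint_word (permute_words s (decode u.1))) a = u.2 a) /\
    forall a, `|freq R (joint_word (permute_words s (decode u.1))) a - p a| <= eta.
  by exists f.
move=> s.
have [Es|nEs] := pselect (E s); last first.
  by exists ([ffun=> ord0], [ffun=> ord0]).
have [x mx hx] := hE Es.
have dec : decode [ffun ik : 'I_n * 'I_K => inord (\sum_(j < N) (c ik.2 < x ik.1 j)%R)] =
    (fun i j => lab c (x i j)).
  apply/funext => i; apply/funext => j; apply/ffunP => k; rewrite !ffunE.
  rewrite (@monotone_threshold N (fun j => c k < x i j)); last first.
    by move=> j1 j2 j12 /lt_le_trans; apply; exact: mx.
  rewrite inordK// ltnS -[leqRHS]card_ord -sum1_card; apply: leq_sum => j' _.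
  by case: (_ < _).
exists ([ffun ik : 'I_n * 'I_K => inord (\sum_(j < N) (c ik.2 < x ik.1 j)%R)],
  [ffun a => inord (cnt (labels c (fun i => perm_vec (s i) (x i))) a)]) => _ /=.
rewrite dec; split => // a.
by rewrite ffunE inordK// ltnS cnt_le.
Qed.

Lemma gamma_prod_card : gamma_prod R E = #|[pred s | s \in E]|%:R / N`!%:R ^+ n.
Proof.
rewrite /gamma_prod (eq_bigr (fun=> (N`!%:R : R)^-1 ^+ n)); last first.
  by move=> s _; rewrite prodr_const card_ord card_Sn.
by rewrite sumr_const -[_ *+ _]mulr_natl exprVn.
Qed.

(** Permutations with the same code share the label words and the joint type, so each fibre lies in
    one class estimated by [ln_card_joint_type]; the power of [N + 1] is the number of codes. *)
Lemma gamma_prod_le : gamma_prod R E <=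
  N.+1%:R ^+ (n * K + #|{: A}|) * expR (- (N%:R * D) + C%:R * (ln N.+1%:R + 1)).
Proof.
have [f hf] := code_ex.
have NF : 0 < (N`!%:R : R) ^+ n by rewrite exprn_gt0// ltr0n fact_gt0.
rewrite gamma_prod_card ler_pdivrMr//.
set W := expR _.
have fib (u : code) : #|[pred s | (s \in E) && (f s == u)]|%:R <= W * N`!%:R ^+ n.
  have [[s0 [Es0' fs0]]|h] := pselect (exists s0, E s0 /\ f s0 = u); last first.
    rewrite eq_card0; first by rewrite mulr_ge0 ?expR_ge0// ltW.
    move=> s; apply/negP => /andP[/set_mem Es /eqP fs].
    by apply: h; exists s.
  have [h1 h2] := hf s0 Es0'; rewrite fs0 in h1 h2.
  have := ln_card_joint_type R (decode u.1) s0 N0.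
  set Q := #|same_joint_type _ _|.
  have Q0 : (0 < Q)%N by apply/card_gt0P; exists s0; apply/forallP.
  rewrite ler_norml => /andP[_ hQ].
  apply: (@le_trans _ _ (Q%:R)).
    rewrite ler_nat; apply: subset_leq_card; apply/fintype.subsetP => s /andP[Es /eqP fs].
    apply/forallP => a; rewrite h1.
    by have [h _] := hf s (set_mem Es); rewrite fs in h; rewrite h.
  rewrite -ler_pdivrMr// -[leLHS]lnK ?posrE ?divr_gt0 ?ltr0n// /W ler_expR.
  have := hD h2; rewrite -(ler_pM2l (_ : 0 < N%:R)) ?ltr0n// => hN.
  by lra.
have -> : #|[pred s | s \in E]| = (\sum_(u : code) #|[pred s | (s \in E) && (f s == u)]|)%N.
  rewrite -sum1_card (partition_big f predT)//=; apply: eq_bigr => u _.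
  by rewrite -sum1_card; apply: eq_bigl => s; rewrite !inE.
rewrite natr_sum; apply: (@le_trans _ _ (\sum_(u : code) W * N`!%:R ^+ n)).
  by apply: ler_sum => u _; exact: fib.
rewrite sumr_const card_prod !card_ffun !card_prod !card_ord -expnD.
by rewrite -[_ *+ _]mulr_natl natrX mulrA.
Qed.

End Counting.

(** All that the upper bound uses, shared by [Delta_sym] and [Delta_sym_at]. *)
Definition sorted_microstates (E : forall N, nat -> R -> set {ffun 'I_n -> 'S_N}) :=
  forall N m delta s, E N m delta s -> exists2 x : 'I_n -> 'I_N -> R,
    (forall i, nondecreasing_vec (x i)) &
    Delta X m delta (fun i => perm_vec (s i) (x i)).

Lemma log_rate_upper E (r0 : R) K (c : 'I_K -> R) (s : R) :
  0 < r0 -> P (good_set X r0) = 1%E ->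
  (forall i c, P [set w | X i w = c] = 0%E) ->
  sorted_microstates E -> s < mutual_info (cell_pr X c) ->
  \forall md \near filter_prod \oo (0 : R)^'+,
    (limn_esup (log_rate E md.1 md.2) <= (- s)%:E)%E.
Proof.
move=> r00 PD atl hE sD.
(* Half of the gap pays for replacing the type by the cell probabilities, the other half for the
   polynomial factor. *)
pose e := (mutual_info (cell_pr X c) - s) / 2.
have e0 : 0 < e by rewrite divr_gt0// subr_gt0.
have [eta eta0 heta] := mutual_info_continuous (cell_pr X c) e0.
have := freq_near r00 PD atl c eta0.
apply: filterS => -[m delta] /= hmd.
pose D := mutual_info (cell_pr X c) - e.
have hD tau : (forall a, `|tau a - cell_pr X c a| <= eta) -> D <= mutual_info tau.
  by move=> /heta; rewrite ler_norml => /andP[+ _]; rewrite /D; lra.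
pose A := {ffun 'I_n -> {ffun 'I_K -> bool}}.
pose C : R := (n * K + #|{: A}|)%:R + (1 + n + #|{: A}| + n * #|{: {ffun 'I_K -> bool}}|)%:R.
apply: limn_esup_le_near.
apply: filterS2 (nbhs_infty_gt 0) (near_ln_rate C e0) => N N0 hN.
have hEN sg : E N m delta sg -> exists2 x : 'I_n -> 'I_N -> R,
    (forall i, nondecreasing_vec (x i)) &
    forall a, `|freq R (labels c (fun i => perm_vec (sg i) (x i))) a - cell_pr X c a| <= eta.
  by move=> /hE[x mx hx]; exists x => // a; exact: hmd.
have := gamma_prod_le N0 hEN hD.
have N0R : 0 < (N%:R : R) by rewrite ltr0n.
rewrite /log_rate; have [g0|g0] := ltP 0 (gamma_prod R (E N m delta)); last first.
  by rewrite le0_lneNy ?lee_fin// gt0_muleNy ?leNye// lte_fin invr_gt0.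
rewrite lne_EFin// -EFinM lee_fin => hg.
rewrite ler_pdivrMl//.
have : ln (gamma_prod R (E N m delta)) <= (n * K + #|{: A}|)%:R * ln N.+1%:R +
    (- (N%:R * D) + (1 + n + #|{: A}| + n * #|{: {ffun 'I_K -> bool}}|)%:R * (ln N.+1%:R + 1)).
  rewrite -[X in _ <= _ + X]expRK.
  have -> : (n * K + #|{: A}|)%:R * ln N.+1%:R = ln (N.+1%:R ^+ (n * K + #|{: A}|)) :> R.
    by rewrite lnXn ?ltr0n// mulr_natl.
  rewrite -lnM ?posrE ?exprn_gt0 ?expR_gt0 ?ltr0n//.
  by rewrite ler_ln ?posrE ?mulr_gt0 ?exprn_gt0 ?expR_gt0 ?ltr0n.
have : (n * K + #|{: A}|)%:R * ln N.+1%:R <= (n * K + #|{: A}|)%:R * (ln N.+1%:R + 1) :> R.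
  by rewrite ler_wpM2l// lerDl.
have -> : N%:R * - s = - (N%:R * D) + e * N%:R by rewrite /D /e; field.
move=> h1 h2; apply: (le_trans h2); rewrite addrCA lerD2l.
by apply: le_trans hN; rewrite mulrDl lerD2r.
Qed.

End UpperBound.

(** * Lower bound *)

Section SampleWords.
Context d (T : measurableType d) (R : realType) (P : probability T R) (n : nat).
Variables (X : 'I_n -> {RV P >-> R}) (r0 : R).
Hypothesis PD : P (good_set X r0) = 1%E.
Variables (K : nat) (c : 'I_K -> R).
Local Notation A := {ffun 'I_n -> {ffun 'I_K -> bool}}.
Local Notation p := (cell_pr X c).

Lemma cell_point a : 0 < p a ->
  exists w, good_set X r0 w /\ xlab c (X^~ w) = a.
Proof.
move=> pa; apply: contrapT => h.
have mc := measurable_xlab X c a; have mD := measurable_good_set X r0.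
have H : P [set w | xlab c (X^~ w) == a] =
    (P ([set w | xlab c (X^~ w) == a] `\` good_set X r0) +
     P ([set w | xlab c (X^~ w) == a] `&` good_set X r0))%E.
  exact: (measureDI P mc mD).
move: pa; rewrite /cell_pr /pr H (pr_negl mD PD mc) add0e.
rewrite (_ : _ `&` _ = set0) ?measure0 ?ltxx//.
by apply/seteqP; split => w // [/= /eqP e Dw]; apply: h; exists w.
Qed.

Lemma cell_pr_pos_ex : exists a, 0 < p a.
Proof.
apply: contrapT => h; have := sum_cell_pr X c; rewrite big1 => [/eqP|a _].
  by rewrite eq_sym oner_eq0.
apply/eqP; rewrite eq_le cell_pr_ge0 andbT leNgt; apply/negP => pa.
by apply: h; exists a.
Qed.

(** Round [N p] down and give the remainder to one cell [a0] of positive probability. The other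
    cells err by at most [1], so [a0] errs by at most the number of cells; null cells keep count
    zero, so every cell in use contains a sample point. *)
Lemma type_near (e : R) : 0 < e -> \forall N \near \oo, exists t : A -> nat,
  [/\ (\sum_a t a)%N = N, forall a, (0 < t a)%N -> 0 < p a &
      forall a, `|(t a)%:R / N%:R - p a| <= e].
Proof.
move=> e0; have [a0 pa0] := cell_pr_pos_ex.
pose M : R := #|{: A}|%:R.
near=> N.
have N0 : 0 < (N%:R : R) by rewrite ltr0n; near: N; exact: nbhs_infty_gt.
have NM : M + 1 <= e * N%:R.
  by rewrite -ler_pdivrMl//; near: N; exact: nbhs_infty_ger.
pose f a := Num.truncn (N%:R * p a).
have Np0 a : 0 <= N%:R * p a by rewrite mulr_ge0// ?cell_pr_ge0// ltW.
have f1 a : (f a)%:R <= N%:R * p a by rewrite truncn_le.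
have f2 a : N%:R * p a < (f a)%:R + 1 by rewrite natr1 truncnS_gt.
have sumf : (\sum_(a | a != a0) f a <= N)%N.
  rewrite -(ler_nat R) natr_sum.
  apply: (@le_trans _ _ (\sum_(a | a != a0) N%:R * p a)).
    by apply: ler_sum => a _; exact: f1.
  rewrite -mulr_sumr ler_piMr ?(ltW N0)// -(sum_cell_pr X c).
  by rewrite [leRHS](bigD1 a0)//= lerDr cell_pr_ge0.
pose t a := if a == a0 then (N - \sum_(b | b != a0) f b)%N else f a.
have tN : (\sum_a t a)%N = N.
  rewrite (bigD1 a0)//=; have -> : (\sum_(a | a != a0) t a = \sum_(a | a != a0) f a)%N.
    by apply: eq_bigr => a; rewrite /t => /negbTE ->.
  by rewrite /t eqxx subnK.
have err a : a != a0 -> `|(t a)%:R - N%:R * p a| <= 1.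
  move=> aa0; rewrite /t (negbTE aa0) ler_norml; have := f1 a; have := f2 a; lra.
exists t; split => // [a|a].
  rewrite /t; case: eqP => [->//|_]; rewrite /f truncn_gt0 => h.
  by rewrite -(pmulr_rgt0 _ N0) (lt_le_trans ltr01).
have -> : (t a)%:R / N%:R - p a = ((t a)%:R - N%:R * p a) / N%:R.
  by rewrite mulrBl mulrAC divff ?mul1r// gt_eqF.
rewrite normrM normfV (ger0_norm (ltW N0)) ler_pdivrMr// (le_trans _ NM)//.
have [->|aa0] := eqVneq a a0; last first.
  by rewrite (le_trans (err _ aa0))// lerDr.
have : \sum_b ((t b)%:R - N%:R * p b) = 0.
  by rewrite sumrB -natr_sum tN -mulr_sumr sum_cell_pr mulr1 subrr.
rewrite (bigD1 a0)//= => /eqP; rewrite addr_eq0 => /eqP ->; rewrite normrN.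
apply: (le_trans (ler_norm_sum _ _ _)).
apply: (@le_trans _ _ (\sum_(b : A) 1)); last first.
  by rewrite sumr_const /M lerDl.
by rewrite big_mkcond; apply: ler_sum => b _; case: ifP => // /err.
Unshelve. all: by end_near. Qed.

(** The sampling is deterministic: in a word of the rounded type each letter is replaced by the
    value of [X] at one chosen point of its cell, taken in [good_set] so that [r0] bounds all
    entries. *)
Lemma points_near (e : R) : 0 < e -> \forall N \near \oo,
  exists y : 'I_n -> 'I_N -> R, (forall i j, `|y i j| <= r0) /\
    forall a, `|freq R (labels c y) a - p a| <= e.
Proof.
move=> /type_near; apply: filterS => N [t [tN tp te]].
have [w0 _] : exists w : T, True.
  by have [a /cell_point[w _]] := cell_pr_pos_ex; exists w.
have /boolp.choice[rep hrep] : forall a, exists w, 0 < p a ->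
    good_set X r0 w /\ xlab c (X^~ w) = a.
  move=> a; have [/cell_point[w hw]|h] := boolP (0 < p a); first by exists w.
  by exists w0.
have [u hu] := word_of_type tN.
have pu j : 0 < p (u j).
  apply: tp; rewrite -hu /cnt (bigD1 j)//= eqxx.
  exact: ltn_addr.
exists (fun i j => X i (rep (u j))); split => [i j|a].
  by have [+ _] := hrep _ (pu j); exact.
have -> : freq R (labels c (fun i j => X i (rep (u j)))) a = (t a)%:R / N%:R.
  rewrite /freq -hu; congr (_%:R / _); apply: eq_cnt => j.
  have [_ ej] := hrep _ (pu j); rewrite -[RHS]ej.
  by apply/ffunP => i; rewrite !ffunE.
exact: te.
Qed.

End SampleWords.

(** * Rearranging sorted vectors in the order of a microstate *)

Section Coupling.
Variables (R : realType) (N : nat).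

Lemma sorting_perm (y : 'I_N -> R) : exists s : 'S_N, nondecreasing_vec (y \o s).
Proof.
pose t := [tuple y j | j < N].
have /tuple_permP[s hs] : perm_eq (sort <=%R t) t by rewrite perm_sort.
exists s => j k jk /=.
have sz : size (sort <=%R t) = N by rewrite size_sort size_tuple.
have nthE (i : 'I_N) : nth 0 (sort <=%R t) i = y (s i).
  by rewrite hs -tnth_nth !tnth_mktuple.
rewrite -!nthE; apply: sorted_leq_nth => //.
- exact: le_trans.
- by apply: sort_sorted; exact: le_total.
- by rewrite inE sz.
- by rewrite inE sz.
Qed.

(** Both words are thresholds, so one set of ones contains the other, and their disagreements are
    counted by the difference in size. *)
Lemma monotone_differ (b b' : 'I_N -> bool) :
  (forall j k : 'I_N, (j <= k)%N -> b j -> b k) ->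
  (forall j k : 'I_N, (j <= k)%N -> b' j -> b' k) ->
  \sum_j (b j != b' j)%:R = `|\sum_j (b j)%:R - \sum_j (b' j)%:R| :> R.
Proof.
wlog le : b b' / (\sum_j b j <= \sum_j b' j)%N.
  move=> H mb mb'; have [le|/ltnW le] := leqP (\sum_j b j) (\sum_j b' j).
    exact: H.
  rewrite distrC -H//; apply: eq_bigr => j _; by rewrite eq_sym.
move=> mb mb'.
have bb' j : b j -> b' j.
  rewrite (monotone_threshold mb) (monotone_threshold mb').
  by apply: leq_trans; exact: leq_sub2l.
rewrite distrC ger0_norm; last by rewrite subr_ge0 -!natr_sum ler_nat.
rewrite -sumrB; apply: eq_bigr => j _.
by have := bb' j; case: (b j); case: (b' j) => //= h; rewrite ?subrr ?subr0//; have := h isT.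
Qed.

Variables (n K : nat) (c : 'I_K -> R).

(** Unlike joint frequencies these numbers are invariant under permutations, so they can be compared
    for [xi] and [y] before any order is chosen. *)
Definition halfline_freq (x : 'I_N -> R) k : R := kappa (fun j : 'I_N => (c k < x j)%R%:R).

Lemma halfline_freq_perm x (s : 'S_N) k :
  halfline_freq (perm_vec s x) k = halfline_freq x k.
Proof.
by rewrite /halfline_freq /kappa [in RHS](reindex_inj (@perm_inj _ (s^-1)%g)).
Qed.

Lemma kappa_fin (B : finType) (F : B -> R) (w : 'I_N -> B) :
  kappa (fun j => F (w j)) = \sum_b F b * freq R w b.
Proof.
rewrite (eq_kappa (y := fun j => \sum_b F b * (w j == b)%:R)); last first.
  move=> j; rewrite (bigD1 (w j))//= eqxx mulr1 big1 ?addr0// => a.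
  by rewrite eq_sym => /negbTE ->; rewrite mulr0.
by rewrite kappa_sum; apply: eq_bigr => b _; rewrite kappaZ kappa_freq.
Qed.

Lemma halfline_freq_labels (x : 'I_n -> 'I_N -> R) i k :
  halfline_freq (x i) k =
  \sum_(a : {ffun 'I_n -> {ffun 'I_K -> bool}} | a i k) freq R (labels c x) a.
Proof.
rewrite [RHS]big_mkcond (eq_bigr (fun a : {ffun 'I_n -> {ffun 'I_K -> bool}} =>
    (a i k)%:R * freq R (labels c x) a)); last first.
  by move=> a _; case: (a i k); rewrite ?mul1r ?mul0r.
rewrite -(kappa_fin (fun a : {ffun 'I_n -> {ffun 'I_K -> bool}} => (a i k)%:R)).
by apply: eq_kappa => j; rewrite !ffunE.
Qed.

Lemma freq_differ (B : finType) (w w' : 'I_N -> B) a :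
  `|freq R w a - freq R w' a| <= kappa (fun j => (w j != w' j)%:R).
Proof.
rewrite -!kappa_freq /kappa -mulrBr normrM ger0_norm// ler_wpM2l//.
rewrite -sumrB (le_trans (ler_norm_sum _ _ _))// ler_sum// => j _.
have [->|ne] := eqVneq (w j) (w' j); first by rewrite subrr normr0.
by case: (w j == a); case: (w' j == a); rewrite ?subrr ?subr0 ?sub0r ?normrN ?normr1 ?normr0.
Qed.

(* [s i] puts [xi i] in the order of [y i]. The indicators of a half-line along
   both vectors are then monotone in the same order, so they differ in as few
   places as their numbers of ones allow. *)
Lemma coupling (y xi : 'I_n -> 'I_N -> R) : (forall i, nondecreasing_vec (xi i)) ->
  exists s : {ffun 'I_n -> 'S_N}, forall a,
    `|freq R (labels c (fun i => perm_vec (s i) (xi i))) a - freq R (labels c y) a| <=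
    \sum_i \sum_k `|halfline_freq (xi i) k - halfline_freq (y i) k|.
Proof.
move=> mxi; have /boolp.choice[s hs] : forall i, exists s : 'S_N, nondecreasing_vec (y i \o s).
  by move=> i; exact: sorting_perm.
exists (finfun s) => a; apply: (le_trans (freq_differ _ _ _)).
apply: (@le_trans _ _ (kappa (fun j => \sum_i \sum_k
    ((c k < xi i ((s i)^-1 j)%g)%R != (c k < y i j)%R)%:R))).
  apply: le_kappa => j; case: eqP => /= [_|ne].
    by apply: sumr_ge0 => i _; apply: sumr_ge0.
  have [[i k] hik] : exists ik : 'I_n * 'I_K,
      (c ik.2 < xi ik.1 ((s ik.1)^-1 j)%g)%R != (c ik.2 < y ik.1 j)%R.
    apply: contrapT => h; apply: ne; apply/ffunP => i; apply/ffunP => k.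
    rewrite !ffunE /perm_vec; apply: contrapT => /eqP h'; apply: h; exists (i, k) => //=.
  rewrite (bigD1 i)//= (bigD1 k)//= hik -addrA lerDl addr_ge0//.
    exact: sumr_ge0.
  by apply: sumr_ge0 => i' _; apply: sumr_ge0.
rewrite kappa_sum; apply: ler_sum => i _; rewrite kappa_sum; apply: ler_sum => k _.
rewrite /halfline_freq /kappa -mulrBr normrM ger0_norm// ler_wpM2l//.
rewrite (reindex_inj (@perm_inj _ (s i))) /=.
under eq_bigr do rewrite permK.
rewrite (monotone_differ (b := fun j => c k < xi i j) (b' := fun j => c k < y i (s i j))).
- suff -> : \sum_j (c k < y i j)%R%:R = \sum_j (c k < y i (s i j))%R%:R :> R by [].
  exact: reindex_inj (@perm_inj _ (s i)).
- by move=> j1 j2 j12 /lt_le_trans; apply; exact: mxi.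
- by move=> j1 j2 j12 /lt_le_trans; apply; exact: hs.
Qed.

End Coupling.

(** * Label frequencies and small tails determine the moments *)

Section Quantize.
Variable R : realType.
Implicit Types (B h y z : R).

Lemma sum_ord_lt_real M z : 0 <= z <= M%:R ->
  z <= \sum_(k < M) (k%:R < z)%R%:R <= z + 1.
Proof.
elim: M z => [|M IH] z /andP[z0 zM].
  by rewrite big_ord0 zM; lra.
rewrite big_ord_recr /=; have [zM'|Mz] := leP z M%:R.
  by rewrite addr0 IH// z0.
rewrite (eq_bigr (fun=> 1)) => [|k _]; last first.
  by rewrite (lt_le_trans _ (ltW Mz)) ?ltr_nat//.
rewrite sumr_const card_ord natr1 zM /= -natr1 lerD2r; exact: ltW.
Qed.

(** Equally spaced cuts from [-B] upwards: the number of cuts below [y] rounds [y + B] up to a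
    multiple of the spacing. The bound on [rho] also covers labels that no point has. *)
Lemma quantizer_ex B h : 0 < B -> 0 < h ->
  exists K (c : 'I_K -> R) (rho : {ffun 'I_K -> bool} -> R),
    (forall b, `|rho b| <= B) /\
    forall y, `|y| <= B -> `|y - rho (lab c y)| <= h.
Proof.
move=> B0 h0; pose M := (Num.truncn (2 * B / h)).+1.
have M0 : 0 < (M%:R : R) by rewrite ltr0n.
pose u := 2 * B / M%:R.
have u0 : 0 < u by rewrite divr_gt0// mulr_gt0.
have uh : u <= h.
  by rewrite ler_pdivrMr// [h * _]mulrC -ler_pdivrMr// ltW//; exact: truncnS_gt.
have uM : u * M%:R = 2 * B by rewrite /u divfK// gt_eqF.
exists M, (fun k => k%:R * u - B), (fun b : {ffun 'I_M -> bool} => u * \sum_k (b k)%:R - B).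
split=> [b|y].
  have s0 : 0 <= \sum_k ((b k)%:R : R) by apply: sumr_ge0.
  have sM : \sum_k ((b k)%:R : R) <= M%:R.
    rewrite -[in leRHS](card_ord M) -sum1_card natr_sum; apply: ler_sum => k _.
    by case: (b k).
  rewrite ler_norml; apply/andP; split; first by rewrite lerBrDr addNr mulr_ge0// ltW.
  by rewrite lerBlDr -mulr2n -mulr_natl -uM ler_wpM2l// ltW.
rewrite ler_norml => /andP[y1 y2].
have zM : 0 <= (y + B) / u <= M%:R.
  by rewrite ler_pdivrMr// [M%:R * _]mulrC uM divr_ge0 ?(ltW u0)//=; lra.
have := sum_ord_lt_real zM.
rewrite (eq_bigr (fun k => (lab (fun k : 'I_M => k%:R * u - B) y k)%:R)); last first.
  by move=> k _; rewrite ffunE ltr_pdivlMr// ltrBlDr.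
set s := \sum_k _.
rewrite ler_pdivrMr// -lerBlDr [X in _ && X]ler_pdivlMr// [s * u]mulrC mulrBl mul1r [s * u]mulrC.
move=> /andP[h1 h2]; apply: le_trans uh; rewrite ler_norml; apply/andP; split; lra.
Qed.

Definition tail B m y : R := if B < `|y| then `|y| ^+ m else 0.

Lemma tail_ge0 B m y : 0 <= tail B m y.
Proof. by rewrite /tail; case: ifP => // _; exact: exprn_ge0. Qed.

Lemma prod_approx (I : Type) (s : seq I) (x z : I -> R) B h : 1 <= B -> 0 <= h ->
  (forall i, `|x i| <= B) -> (forall i, `|z i| <= B) -> (forall i, `|x i - z i| <= h) ->
  `|\prod_(i <- s) x i - \prod_(i <- s) z i| <= (size s)%:R * B ^+ size s * h.
Proof.
move=> B1 h0 hx hz hxz; have B0 : 0 <= B by rewrite (le_trans ler01).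
have prodB (f : I -> R) t : (forall i, `|f i| <= B) -> `|\prod_(i <- t) f i| <= B ^+ size t.
  move=> hf; elim: t => [|i t IH]; first by rewrite big_nil normr1.
  by rewrite big_cons normrM exprS ler_pM.
elim: s => [|i s IH]; first by rewrite !big_nil subrr normr0 !mul0r.
rewrite !big_cons.
have -> : x i * \prod_(j <- s) x j - z i * \prod_(j <- s) z j =
    (x i - z i) * \prod_(j <- s) x j +
    z i * (\prod_(j <- s) x j - \prod_(j <- s) z j) by ring.
rewrite (le_trans (ler_normD _ _))// !normrM /=.
have -> : (size s).+1%:R * B ^+ (size s).+1 * h =
    h * B ^+ (size s).+1 + B * ((size s)%:R * B ^+ size s * h).
  by rewrite -natr1 exprS; ring.
apply: lerD; last by rewrite ler_pM.
by rewrite ler_pM// (le_trans (prodB _ _ hx))// exprS ler_peMl// exprn_ge0.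
Qed.

(** If [B] bounds all entries this is [prod_approx]. Otherwise both products are at most the [m]-th
    power of the largest absolute entry, as it exceeds [B >= 1], and that power is a term of the
    tail sum. *)
Lemma word_approx n k m (u : 'I_k -> 'I_n) (x z : 'I_n -> R) B h : 1 <= B -> 0 <= h ->
  (k <= m)%N -> (forall i, `|z i| <= B) ->
  (forall i, `|x i| <= B -> `|x i - z i| <= h) ->
  `|\prod_l x (u l) - \prod_l z (u l)| <= m%:R * B ^+ m * h + 2 * \sum_i tail B m (x i).
Proof.
move=> B1 h0 km hz hxz; have B0 : 0 <= B by rewrite (le_trans ler01).
have [/forallP hx|] := boolP [forall i, `|x i| <= B].
  have := @prod_approx _ (index_enum 'I_k) (x \o u) (z \o u) B h B1 h0 (fun l => hx (u l))
    (fun l => hz (u l)) (fun l => hxz _ (hx (u l))).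
  move=> /le_trans; apply.
  have sz : size (index_enum 'I_k) = k by rewrite /index_enum -enumT size_enum_ord.
  rewrite sz (@le_trans _ _ (m%:R * B ^+ m * h))//; last first.
    by rewrite lerDl mulr_ge0// sumr_ge0// => i _; exact: tail_ge0.
  by rewrite ler_wpM2r// ler_pM ?exprn_ge0// ?ler_nat// ler_weXn2l.
rewrite negb_forall => /existsP[i0 hi0].
have [i _ imax] := @Order.TotalTheory.arg_maxP _ _ _ i0 xpredT (fun i => `|x i|) isT.
have Bi : B < `|x i|.
  by rewrite (lt_le_trans _ (imax i0 isT))// ltNge.
have xi1 : 1 <= `|x i| by rewrite (le_trans B1)// ltW.
have prodM (f : 'I_n -> R) : (forall j, `|f j| <= `|x i|) -> `|\prod_l f (u l)| <= `|x i| ^+ m.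
  move=> hf; rewrite normr_prod (@le_trans _ _ (`|x i| ^+ k))//; last by rewrite ler_weXn2l.
  rewrite -[X in _ <= _ ^+ X]card_ord -prodr_const; apply: ler_prod => l _.
  by rewrite normr_ge0 hf.
have px : `|\prod_l x (u l)| <= `|x i| ^+ m by apply: prodM => j; exact: imax.
have pz : `|\prod_l z (u l)| <= `|x i| ^+ m.
  by apply: prodM => j; rewrite (le_trans (hz j))// ltW.
have tl : `|x i| ^+ m <= \sum_j tail B m (x j).
  rewrite (bigD1 i)//= {1}/tail Bi lerDl sumr_ge0// => j _; exact: tail_ge0.
apply: (le_trans (ler_normB _ _)); rewrite (@le_trans _ _ (2 * \sum_j tail B m (x j)))//.
  lra.
by rewrite lerDr !mulr_ge0// exprn_ge0.
Qed.

End Quantize.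

Section DeltaOfFreq.
Context d (T : measurableType d) (R : realType) (P : probability T R) (n : nat).
Variables (X : 'I_n -> {RV P >-> R}) (r0 : R).
Hypotheses (r0_ge0 : 0 <= r0) (PD : P (good_set X r0) = 1%E).
Local Notation B := (r0 + 1).
Local Notation D := (good_set X r0).
Let mD := measurable_good_set X r0.

(** Three comparisons: moments of [x] with their quantized versions, label frequencies with cell
    probabilities, quantized with true expectations. They cost [delta / 4], [delta / 8] and
    [delta / 8]. The choice of [r0 + 1] makes [B >= 1] and the tails vanish on [good_set]. *)
Lemma Delta_of_freq m (delta : R) : 0 < delta ->
  exists K (c : 'I_K -> R), exists2 eta : R, 0 < eta & exists2 theta : R, 0 < theta &
  forall N (x : 'I_n -> 'I_N -> R), (0 < N)%N ->
    (forall a, `|freq R (labels c x) a - cell_pr X c a| <= eta) ->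
    (forall i, kappa (fun j => tail B m (x i j)) <= theta) ->
    Delta X m delta x.
Proof.
move=> delta0.
have B1 : 1 <= B by rewrite lerDr.
have B0 : 0 < B by rewrite (lt_le_trans ltr01).
have Bm1 : 1 <= B ^+ m by exact: exprn_ege1.
have Bm0 : 0 < B ^+ m by exact: exprn_gt0.
pose h : R := delta / (8 * (m%:R + 1) * B ^+ m).
have h0 : 0 < h by rewrite divr_gt0// !mulr_gt0// ltr_wpDl.
have [K [c [rho [rhoB hrho]]]] := quantizer_ex B0 h0.
pose M : R := #|{: {ffun 'I_n -> {ffun 'I_K -> bool}}}|%:R.
pose eta : R := delta / (8 * (M + 1) * B ^+ m).
pose theta : R := delta / (16 * (n%:R + 1)).
have M0 : 0 <= M by [].
have n0 : 0 <= n%:R :> R by [].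
have eta0 : 0 < eta by rewrite divr_gt0// !mulr_gt0// ltr_wpDl.
have theta0 : 0 < theta by rewrite divr_gt0// !mulr_gt0// ltr_wpDl.
exists K, c, eta => //; exists theta => // N x N0 hfreq htail k u /andP[_ km].
pose F (a : {ffun 'I_n -> {ffun 'I_K -> bool}}) : R := \prod_l rho (a (u l)).
have FB a : `|F a| <= B ^+ m.
  rewrite normr_prod (@le_trans _ _ (B ^+ k))//; last by rewrite ler_weXn2l.
  rewrite -[X in _ <= _ ^+ X]card_ord -prodr_const; apply: ler_prod => l _.
  by rewrite normr_ge0 rhoB.
have hmB : m%:R * B ^+ m * h <= delta / 8.
  have -> : m%:R * B ^+ m * h = delta / 8 * (m%:R / (m%:R + 1)).
    by rewrite /h; field; rewrite !gt_eqF// ltr_wpDl.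
  by rewrite ler_piMr ?divr_ge0 ?(ltW delta0)// ler_pdivrMr ?ltr_wpDl// mul1r lerDl.
have near_F (y : 'I_n -> R) : `|\prod_l y (u l) - F (xlab c y)| <=
    m%:R * B ^+ m * h + 2 * \sum_i tail B m (y i).
  rewrite (_ : F _ = \prod_l rho (lab c (y (u l)))); last first.
    by apply: eq_bigr => l _; rewrite ffunE.
  apply: (@word_approx R n k m u y (fun i => rho (lab c (y i)))) => // [|i].
    exact: ltW.
  exact: hrho.
have b1 : bounded_on D (fun w => \prod_(l < k) X (u l) w).
  by apply: bounded_on_prod => l; exact: bounded_on_X.
have mL := measurable_xlab X c.
have b2 : bounded_on D (fun w => F (xlab c (X^~ w))) by exact: bounded_on_fin.
rewrite (expectation_Ev mD PD b1) -EFinB lte_fin.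
have E1 : `|kappa (fun j => \prod_(l < k) x (u l) j) - \sum_a F a * freq R (labels c x) a| <=
    delta / 8 + delta / 8.
  rewrite -kappa_fin.
  rewrite (_ : kappa _ - kappa _ = kappa (fun j => \prod_(l < k) x (u l) j - F (labels c x j))); last first.
    by rewrite /kappa -mulrBr sumrB.
  apply: (le_trans (kappa_norm_le _)).
  apply: (@le_trans _ _ (kappa (fun j => m%:R * B ^+ m * h + 2 * \sum_i tail B m (x i j)))).
    by apply: le_kappa => j; exact: (near_F (x^~ j)).
  rewrite kappaD kappa_cst// kappaZ kappa_sum; apply: lerD => //.
  apply: (@le_trans _ _ (2 * \sum_(i < n) theta)).
    by rewrite ler_wpM2l//; apply: ler_sum => i _.
  rewrite sumr_const card_ord -[theta *+ _]mulr_natl.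
  have -> : 2 * (n%:R * theta) = delta / 8 * (n%:R / (n%:R + 1)).
    by rewrite /theta; field; rewrite gt_eqF// ltr_wpDl.
  by rewrite ler_piMr ?divr_ge0 ?(ltW delta0)// ler_pdivrMr ?ltr_wpDl// mul1r lerDl.
have E2 : `|\sum_a F a * freq R (labels c x) a - \sum_a F a * cell_pr X c a| <= delta / 8.
  rewrite -sumrB; apply: (le_trans (ler_norm_sum _ _ _)).
  apply: (@le_trans _ _ (\sum_(a : {ffun 'I_n -> {ffun 'I_K -> bool}}) B ^+ m * eta)).
    by apply: ler_sum => a _; rewrite -mulrBr normrM ler_pM.
  rewrite sumr_const -[_ *+ _]mulr_natl -/M.
  have -> : M * (B ^+ m * eta) = delta / 8 * (M / (M + 1)).
    by rewrite /eta; field; rewrite !gt_eqF// ltr_wpDl.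
  by rewrite ler_piMr ?divr_ge0 ?(ltW delta0)// ler_pdivrMr ?ltr_wpDl// mul1r lerDl.
have E3 : `|\sum_a F a * cell_pr X c a - Ev P D (fun w => \prod_(l < k) X (u l) w)| <= delta / 8.
  rewrite -(Ev_fin mL F mD PD).
  have -> : Ev P D (fun w => F (xlab c (X^~ w))) - Ev P D (fun w => \prod_(l < k) X (u l) w) =
      Ev P D (fun w => F (xlab c (X^~ w)) + -1 * \prod_(l < k) X (u l) w).
    by rewrite EvD// ?EvZ ?mulN1r//; exact: bounded_onZ.
  apply: Ev_norm_le => //.
    by apply: bounded_onD => //; exact: bounded_onZ.
  move=> w Dw; rewrite mulN1r distrC; apply: (le_trans (near_F (X^~ w))).
  rewrite big1 ?mulr0 ?addr0// => i _; rewrite /tail ltNge (le_trans (Dw i))//.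
  by rewrite lerDl.
move: E1 E2 E3; rewrite !ler_norml ltr_norml => /andP[? ?] /andP[? ?] /andP[? ?].
by apply/andP; split; lra.
Qed.

End DeltaOfFreq.

Section LowerBound.
Context d (T : measurableType d) (R : realType) (P : probability T R) (n : nat).
Variables (X : 'I_n -> {RV P >-> R}) (r0 : R).
Hypotheses (r0_ge0 : 0 <= r0) (PD : P (good_set X r0) = 1%E).
Local Notation B := (r0 + 1).

Definition halfline_pr K (c : 'I_K -> R) i k : R := pr P [set w | c k < X i w].

Lemma halfline_pr_cells K (c : 'I_K -> R) i k :
  halfline_pr c i k =
  \sum_(a : {ffun 'I_n -> {ffun 'I_K -> bool}} | a i k) cell_pr X c a.
Proof.
rewrite /cell_pr -(@pr_sum_fin _ _ _ P setT measurableT (probability_setT P) _ _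
  (fun a : {ffun 'I_n -> {ffun 'I_K -> bool}} => a i k)); last exact: measurable_xlab.
by congr pr; apply/seteqP; split => w /=; rewrite !ffunE.
Qed.

Lemma halfline_freq_close K (c : 'I_K -> R) N (x : 'I_n -> 'I_N -> R) (e : R) :
  (forall a, `|freq R (labels c x) a - cell_pr X c a| <= e) ->
  forall i k, `|halfline_freq c (x i) k - halfline_pr c i k| <=
    #|{: {ffun 'I_n -> {ffun 'I_K -> bool}}}|%:R * e.
Proof.
move=> h i k; rewrite halfline_freq_labels halfline_pr_cells -sumrB.
apply: (le_trans (ler_norm_sum _ _ _)).
apply: (@le_trans _ _ (\sum_(a : {ffun 'I_n -> {ffun 'I_K -> bool}}) e)).
  rewrite [leLHS]big_mkcond; apply: ler_sum => a _; case: ifP => // _.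
  by rewrite (le_trans _ (h a)).
by rewrite sumr_const mulr_natl.
Qed.

Lemma gamma_prod_ge_type (A : finType) N (b : 'I_n -> 'I_N -> A) s0
    (E : set {ffun 'I_n -> 'S_N}) : (0 < N)%N ->
  (forall s, same_joint_type b s0 s -> E s) ->
  expR (- (N%:R * mutual_info (freq R (joint_word (permute_words s0 b)))) -
    (1 + n + #|{: {ffun 'I_n -> A}}| + n * #|A|)%:R * (ln N.+1%:R + 1)) <= gamma_prod R E.
Proof.
move=> N0 hE; have := ln_card_joint_type R b s0 N0.
set Q := #|same_joint_type _ _|.
have NF : 0 < (N`!%:R : R) ^+ n by rewrite exprn_gt0// ltr0n fact_gt0.
have Q0 : (0 < Q)%N by apply/card_gt0P; exists s0; apply/forallP.
rewrite ler_norml => /andP[hQ _]; rewrite gamma_prod_card.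
apply: (@le_trans _ _ (Q%:R / N`!%:R ^+ n)); last first.
  rewrite ler_pM2r ?invr_gt0// ler_nat; apply: subset_leq_card.
  by apply/fintype.subsetP => s /hE Es; change (s \in E); exact: mem_set.
rewrite -[leRHS]lnK ?posrE ?divr_gt0 ?ltr0n// ler_expR.
by lra.
Qed.

Lemma lower_near m (delta e : R) : 0 < delta -> 0 < e ->
  exists K (c : 'I_K -> R), exists2 eta : R, 0 < eta & exists2 theta : R, 0 < theta &
  \forall N \near \oo, forall (xi : 'I_n -> 'I_N -> R) (E : set {ffun 'I_n -> 'S_N}),
    (forall i, nondecreasing_vec (xi i)) ->
    (forall i k, `|halfline_freq c (xi i) k - halfline_pr c i k| <= eta) ->
    (forall i, kappa (fun j => tail B m (xi i j)) <= theta) ->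
    (forall s : {ffun 'I_n -> 'S_N}, Delta X m delta (fun i => perm_vec (s i) (xi i)) -> E s) ->
    expR (- (N%:R * (mutual_info (cell_pr X c) + e))) <= gamma_prod R E.
Proof.
move=> delta0 e0.
have [K [c [eta1 eta10 [theta theta0 hD]]]] := Delta_of_freq r0_ge0 PD m delta0.
have e20 : 0 < e / 2 by rewrite divr_gt0.
have [eta2 eta20 hMI] := mutual_info_continuous (cell_pr X c) e20.
pose e1 := Num.min eta1 eta2.
have e10 : 0 < e1 by rewrite lt_min eta10.
have e1a : e1 <= eta1 by rewrite ge_min lexx.
have e1b : e1 <= eta2 by rewrite ge_min lexx orbT.
pose M : R := #|{: {ffun 'I_n -> {ffun 'I_K -> bool}}}|%:R.
have M0 : 0 <= M by [].
pose L : R := n%:R * K%:R.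
have L0 : 0 <= L by rewrite mulr_ge0.
have L1 : 0 < L + 1 by rewrite ltr_wpDl.
have M1 : 0 < M + 1 by rewrite ltr_wpDl.
(* The coupling costs at most [n K (2 eta) <= e1 / 2], where [2 eta] adds the distances of [xi] and
   of [y] from the half-line probabilities. Next, [e3] keeps the cell error of [y] below [e1 / 2]
   and, through [M * e3 <= eta], its half-line error below [eta]. *)
pose eta : R := e1 / (4 * (L + 1)).
have eta0 : 0 < eta by rewrite divr_gt0// mulr_gt0.
pose e3 : R := Num.min (e1 / 2) (eta / (M + 1)).
have e30 : 0 < e3 by rewrite /e3 lt_min; apply/andP; split; exact: divr_gt0.
have e31 : e3 <= e1 / 2 by rewrite ge_min lexx.
have e3M : M * e3 <= eta.
  apply: (@le_trans _ _ (M * (eta / (M + 1)))).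
    by rewrite ler_wpM2l// ge_min lexx orbT.
  by rewrite mulrCA ler_piMr ?(ltW eta0)// ler_pdivrMr// mul1r lerDl.
exists K, c, eta => //; exists theta => //.
pose C : R := (1 + n + #|{: {ffun 'I_n -> {ffun 'I_K -> bool}}}| + n * #|{: {ffun 'I_K -> bool}}|)%:R.
apply: filterS3 (nbhs_infty_gt 0) (near_ln_rate C e20) (points_near PD c e30).
move=> N N0 hN [y [_ hy]] xi E mxi hxi htail hE.
have [s hs] := coupling c y mxi.
have hfreq a : `|freq R (labels c (fun i => perm_vec (s i) (xi i))) a - cell_pr X c a| <= e1.
  have h1 : \sum_i \sum_k `|halfline_freq c (xi i) k - halfline_freq c (y i) k| <= e1 / 2.
    apply: (@le_trans _ _ (\sum_(i < n) \sum_(k < K) (2 * eta))).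
      apply: ler_sum => i _; apply: ler_sum => k _.
      have h2 := halfline_freq_close hy i k; rewrite -/M in h2.
      have h3 := le_trans h2 e3M; rewrite distrC in h3.
      rewrite -[_ - _](subrKA (halfline_pr c i k)) (le_trans (ler_normD _ _))//.
      by rewrite mulr_natl mulr2n lerD.
    rewrite !sumr_const !card_ord -!mulrnA -[_ *+ (K * n)]mulr_natl natrM [K%:R * _]mulrC -/L.
    have -> : L * (2 * eta) = e1 / 2 * (L / (L + 1)).
      by rewrite /eta; field; rewrite gt_eqF.
    by rewrite ler_piMr ?divr_ge0 ?(ltW e10)// ler_pdivrMr// mul1r lerDl.
  have := lerD (le_trans (hs a) h1) (le_trans (hy a) e31); rewrite -splitr.
  by apply: le_trans; rewrite -[X in `|X| <= _](subrKA (freq R (labels c y) a)) ler_normD.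
have hfreq1 a := le_trans (hfreq a) e1a.
have hfreq2 a := le_trans (hfreq a) e1b.
(* Label frequencies depend only on the joint type and tail averages are permutation invariant, so
   the whole type class of [s] lies in [E]. *)
have hsame s' : same_joint_type (fun i j => lab c (xi i j)) s s' -> E s'.
  move=> /forallP h; apply: hE; apply: hD => // [a|i].
    rewrite (_ : freq _ _ _ = freq R (labels c (fun i => perm_vec (s i) (xi i))) a)//.
    by rewrite /freq !labels_perm (eqP (h a)).
  rewrite (_ : kappa _ = kappa (fun j => tail B m (xi i j)))//.
  rewrite /kappa; congr (_ * _); apply/esym.
  exact: (reindex_inj (@perm_inj _ ((s' i)^-1)%g)).
have := gamma_prod_ge_type N0 hsame; apply: le_trans.
rewrite ler_expR -labels_perm -/C.
have := hMI _ hfreq2; rewrite ler_norml => /andP[_ h].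
have : N%:R * (mutual_info (freq R (labels c (fun i => perm_vec (s i) (xi i)))) -
    mutual_info (cell_pr X c)) <= N%:R * (e / 2) by rewrite ler_wpM2l.
move: hN; set z := C * _; move: z (mutual_info _) (mutual_info _) (N%:R : R) => z u v w.
by lra.
Qed.

Let S := relative_entropy (joint_distribution X) (product_of_marginals X).

(** The sorted vectors may depend on [N] and on the grid, which admits sampled vectors as well as
    prescribed sequences. Every grid has mutual information at most [S], so the grid supplied by
    [lower_near] costs at most [S + e]. *)
Lemma log_rate_lower (E : forall N, nat -> R -> set {ffun 'I_n -> 'S_N}) m (delta : R) :
  0 < delta ->
  (forall K (c : 'I_K -> R) (eta theta : R), 0 < eta -> 0 < theta ->
    \forall N \near \oo, exists xi : 'I_n -> 'I_N -> R,
    [/\ forall i, nondecreasing_vec (xi i),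
        forall i k, `|halfline_freq c (xi i) k - halfline_pr c i k| <= eta,
        forall i, kappa (fun j => tail B m (xi i j)) <= theta &
        forall s : {ffun 'I_n -> 'S_N},
          Delta X m delta (fun i => perm_vec (s i) (xi i)) -> E N m delta s]) ->
  (- S <= limn_einf (log_rate E m delta))%E.
Proof.
move=> delta0 hE.
suff h (e : R) : 0 < e -> (- S - e%:E <= limn_einf (log_rate E m delta))%E.
  by apply/lee_subgt0Pr => e; exact: h.
move=> e0.
have [K [c [eta eta0 [theta theta0 hN]]]] := lower_near m delta0 e0.
have hS := mutual_info_le X c; rewrite -/S in hS.
apply: (@le_trans _ _ (- (mutual_info (cell_pr X c) + e)%:E)%E).
  by rewrite EFinD oppeD// leeD2r// leeN2.
apply: limn_einf_ge_near.
apply: filterS3 (nbhs_infty_gt 0) hN (hE K c eta theta eta0 theta0).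
move=> N N0 h [xi [h1 h2 h3 h4]].
have N0R : 0 < (N%:R : R) by rewrite ltr0n.
have := h xi _ h1 h2 h3 h4; rewrite /log_rate => hg.
have g0 : 0 < gamma_prod R (E N m delta) by rewrite (lt_le_trans _ hg)// expR_gt0.
rewrite lne_EFin// -EFinM -EFinN lee_fin mulrC ler_pdivlMr//.
by rewrite mulNr mulrC -[leLHS]expRK ler_ln// posrE expR_gt0.
Qed.

End LowerBound.

(** * Sorted vectors for the two kinds of microstate sets *)

Section Realizations.
Context d (T : measurableType d) (R : realType) (P : probability T R) (n : nat).
Variables (X : 'I_n -> {RV P >-> R}) (r0 : R).
Hypotheses (r0_gt0 : 0 < r0) (PD : P (good_set X r0) = 1%E).
Local Notation B := (r0 + 1).
Let S := relative_entropy (joint_distribution X) (product_of_marginals X).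

(** Sort the sampled microstate itself: its entries are bounded by [r0 <= r], so the cutoff holds
    and the tails vanish. *)
Lemma Delta_sym_lower (r : \bar R) m (delta : R) : (r0%:E <= r)%E -> 0 < delta ->
  (- S <= limn_einf (log_rate (Delta_sym X r) m delta))%E.
Proof.
move=> r0r delta0; apply: (log_rate_lower (ltW r0_gt0) PD) => // K c eta theta eta0 theta0.
pose M : R := #|{: {ffun 'I_n -> {ffun 'I_K -> bool}}}|%:R.
have M1 : 0 < M + 1 by rewrite ltr_wpDl.
have e0 : 0 < eta / (M + 1) by rewrite divr_gt0.
apply: filterS2 (nbhs_infty_gt 0) (points_near PD c e0) => N N0 [y [hy hfreq]].
have /boolp.choice[s hs] : forall i, exists s : 'S_N, nondecreasing_vec (y i \o s).
  by move=> i; exact: sorting_perm.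
have yE i : y i \o s i = perm_vec (s i)^-1%g (y i) by apply/funext => j /=; rewrite /perm_vec invgK.
exists (fun i => y i \o s i); split => // [i k|i|s' hs'].
- rewrite yE halfline_freq_perm (le_trans (halfline_freq_close hfreq i k))// -/M.
  by rewrite mulrCA ler_piMr ?(ltW eta0)// ler_pdivrMr// mul1r lerDl.
- rewrite (eq_kappa (y := fun=> 0)) ?kappa_cst ?(ltW theta0)// => j.
  by rewrite /tail ltNge (le_trans (hy _ _))//= lerDl.
exists (fun i => y i \o s i); first exact: hs.
split => // i j; apply: le_trans r0r; rewrite lee_fin; exact: hy.
Qed.

Section At.
Variable xi : 'I_n -> forall N, 'I_N -> R.
Hypothesis hxi : approximates X xi.

Lemma moment_cvg i k : (0 < k)%N ->
  kappa (fun j => @xi i N j ^+ k) @[N --> \oo] --> Ev P (good_set X r0) (fun w => X i w ^+ k).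
Proof.
move=> k0; have [_ /(_ k k0)] := hxi i.
rewrite (expectation_Ev (measurable_good_set X r0) PD); last first.
  by apply: bounded_onX; exact: bounded_on_X.
by move=> /fine_cvgP[_].
Qed.

Lemma Delta_near i m (delta : R) : 0 < delta ->
  \forall N \near \oo, Delta (fun _ : 'I_1 => X i) m delta (fun _ : 'I_1 => @xi i N).
Proof.
move=> delta0.
have : \forall N \near \oo, forall k : 'I_m.+1, (0 < k)%N ->
    `|Ev P (good_set X r0) (fun w => X i w ^+ k) - kappa (fun j => @xi i N j ^+ k)| < delta.
  apply: filter_forall => k; have [->|k0] := posnP k; first by apply: filterE.
  have /cvgrPdist_lt/(_ _ delta0) := @moment_cvg i k k0.
  by apply: filterS.
apply: filterS => N h k u /andP[k0 km].
rewrite (_ : (fun w => _) = (fun w => X i w ^+ k)); last first.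
  by apply/funext => w; rewrite prodr_const card_ord.
rewrite (expectation_Ev (measurable_good_set X r0) PD); last first.
  by apply: bounded_onX; exact: bounded_on_X.
rewrite -EFinB lte_fin distrC.
rewrite (eq_kappa (y := fun j => @xi i N j ^+ k)); last first.
  by move=> j; rewrite prodr_const card_ord.
exact: (h (Ordinal (km : (k < m.+1)%N))).
Qed.

Hypothesis atomless : forall i c, P [set w | X i w = c] = 0%E.

(** Convergence of moments makes [xi i] a microstate of the single variable [X i], by [Delta_near];
    then [freq_near] for one variable converts moments into half-line frequencies. *)
Lemma halfline_near K (c : 'I_K -> R) (eta : R) : 0 < eta -> \forall N \near \oo,
  forall i k, `|halfline_freq c (@xi i N) k - halfline_pr X c i k| <= eta.
Proof.
move=> eta0; apply: filter_forall => i.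
pose X1 := fun _ : 'I_1 => X i.
have PD1 : P (good_set X1 r0) = 1%E.
  have H : (P (good_set X r0) <= P (good_set X1 r0))%E.
    apply: le_measure; rewrite ?inE; try exact: measurable_good_set.
    by move=> w h j; exact: h.
  apply/eqP; rewrite eq_le; apply/andP; split.
    exact: probability_le1 (measurable_good_set X1 r0).
  by move: H; rewrite PD.
pose M : R := #|{: {ffun 'I_1 -> {ffun 'I_K -> bool}}}|%:R.
have M1 : 0 < M + 1 by rewrite ltr_wpDl.
have e0 : 0 < eta / (M + 1) by rewrite divr_gt0.
have FF : ProperFilter (filter_prod \oo (0 : R)^'+) by exact: filter_prod_proper.
have hpos : \forall md \near filter_prod \oo (0 : R)^'+, 0 < md.2.
  exists (setT, [set delta | 0 < delta]); last by move=> [m delta] [].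
  by split; [exact: filterT|exact: nbhs_right_gt].
have := filter_ex (filterI hpos (freq_near r0_gt0 PD1 (fun=> atomless i) c e0)).
move=> [[m delta] [/= delta0 h]].
apply: filterS2 (nbhs_infty_gt 0) (Delta_near i m delta0) => N N0 hN k.
have := halfline_freq_close (h N _ N0 hN) ord0 k; rewrite -/M => /le_trans; apply.
by rewrite mulrCA ler_piMr ?(ltW eta0)// ler_pdivrMr// mul1r lerDl.
Qed.

(** A Markov bound with a large even exponent [k]: beyond [B] one has [|y|^m <= y^k / B^(k - m)],
    and the [k]-th moments are eventually at most [2 r0^k]. The result [2 B^m (r0 / B)^k] is small
    since [r0 < B]. *)
Lemma tail_near m (theta : R) : 0 < theta -> \forall N \near \oo,
  forall i, kappa (fun j => tail B m (@xi i N j)) <= theta.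
Proof.
move=> theta0; apply: filter_forall => i.
have B0 : 0 < B by rewrite ltr_wpDl// ltW.
have Bm0 : 0 < B ^+ m by exact: exprn_gt0.
pose q := (r0 / B) ^+ (2 * m.+1).
have q01 : 0 <= q < 1.
  rewrite exprn_ge0 ?divr_ge0 ?(ltW r0_gt0) ?(ltW B0)//= exprn_ilt1 ?divr_ge0 ?(ltW r0_gt0) ?(ltW B0)//.
  by rewrite ltr_pdivrMr// mul1r ltrDl.
have t0 : 0 < theta / (2 * B ^+ m) by rewrite divr_gt0// mulr_gt0.
have [l hl] := expr_small q01 t0.
(* The factor [2 * m.+1] makes [k] even and larger than [m]. *)
pose k := (2 * m.+1 * l.+1)%N.
have k0 : (0 < k)%N by rewrite /k !muln_gt0.
have mk : (m <= k)%N by rewrite /k; nia.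
have ek : ~~ odd k by rewrite /k !oddM.
have rk0 : 0 < r0 ^+ k by exact: exprn_gt0.
have Evle : Ev P (good_set X r0) (fun w => X i w ^+ k) <= r0 ^+ k.
  rewrite (le_trans (ler_norm _))// (Ev_norm_le (measurable_good_set X r0) PD)//.
    by apply: bounded_onX; exact: bounded_on_X.
  by move=> w Dw; rewrite normrX lerXn2r ?nnegrE ?(ltW r0_gt0)//; exact: Dw.
have /cvgrPdist_le/(_ _ rk0) := @moment_cvg i k k0.
apply: filterS => N /=; rewrite ler_norml => /andP[h _].
have tle y : tail B m y <= (B ^+ (k - m))^-1 * y ^+ k.
  have yk : y ^+ k = `|y| ^+ k by rewrite -normrX ger0_norm// exprn_even_ge0.
  rewrite /tail; case: ltP => By; last by rewrite yk mulr_ge0 ?invr_ge0 ?exprn_ge0// ltW.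
  rewrite mulrC ler_pdivlMr ?exprn_gt0// yk -{2}(subnKC mk) exprD ler_wpM2l ?exprn_ge0//.
  by rewrite lerXn2r ?nnegrE ?(ltW B0)// ltW.
apply: (le_trans (le_kappa (fun j => tle (@xi i N j)))); rewrite kappaZ.
apply: (@le_trans _ _ ((B ^+ (k - m))^-1 * (2 * r0 ^+ k))).
  rewrite ler_wpM2l ?invr_ge0 ?exprn_ge0 ?(ltW B0)//; lra.
have -> : (B ^+ (k - m))^-1 * (2 * r0 ^+ k) = q ^+ l.+1 * (2 * B ^+ m).
  have kE : B ^+ k = B ^+ (k - m) * B ^+ m by rewrite -exprD subnK.
  rewrite /q -exprM -/k expr_div_n kE; field.
  by rewrite !expf_neq0// gt_eqF.
by rewrite -ler_pdivlMr// mulr_gt0.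
Qed.

Lemma Delta_sym_at_lower m (delta : R) : 0 < delta ->
  (- S <= limn_einf (log_rate (Delta_sym_at X xi) m delta))%E.
Proof.
move=> delta0; apply: (log_rate_lower (ltW r0_gt0) PD) => // K c eta theta eta0 theta0.
apply: filterS2 (halfline_near c eta0) (tail_near m theta0) => N h1 h2.
exists (fun i => @xi i N); split => //.
by move=> i; have [+ _] := hxi i; exact.
Qed.

End At.

End Realizations.

(** Testing against real thresholds lets one argument serve finite and infinite limits. *)
Lemma cvge_between (R : realType) (I : Type) (F : set_system I) (FF : Filter F)
    (f : I -> \bar R) (v : \bar R) :
  (forall t : R, (t%:E < v)%E -> \forall x \near F, (t%:E <= f x)%E) ->
  (forall t : R, (v < t%:E)%E -> \forall x \near F, (f x <= t%:E)%E) ->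
  f @ F --> v.
Proof.
case: v => [r||] lo hi.
- have bnd e : 0 < e -> \forall x \near F, (((r - e)%:E <= f x) && (f x <= (r + e)%:E))%E.
    move=> e0; apply: filterS2 (lo (r - e) _) (hi (r + e) _); last 2 first.
    + by rewrite lte_fin ltrBlDr ltrDl.
    + by rewrite lte_fin ltrDl.
    by move=> x -> ->.
  have fin e x : (((r - e)%:E <= f x) && (f x <= (r + e)%:E))%E -> f x \is a fin_num.
    by case: (f x) => [y| |]; rewrite ?leey ?leNye ?leye_eq ?leeNy_eq ?andbF.
  apply/fine_cvgP; split; first by apply: filterS (bnd 1 ltr01) => x; exact: fin.
  apply/cvgrPdist_le => e e0; apply: filterS (bnd e e0) => x h.
  have := h; rewrite -(fineK (fin e x h)) !lee_fin /= ler_norml => /andP[h1 h2].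
  by apply/andP; split; lra.
- by apply/cvgeyPge => t; apply: lo; rewrite ltry.
- by apply/cvgeNyPle => t; apply: hi; rewrite ltNyr.
Qed.

(** * The squeeze, and the choice of bounds for the theorem *)

Section Conclusion.
Context d (T : measurableType d) (R : realType) (P : probability T R).

Lemma entropy_atomless (Y : {RV P >-> R}) (c : R) :
  (-oo < entropy Y)%E -> P [set w | Y w = c] = 0%E.
Proof.
rewrite /entropy; case: asboolP => [[p [mp p0 hp]] _|_]; last by rewrite ltxx.
have := hp [set c] (measurable_set1 c).
by rewrite (integral_Sset1 c).
Qed.

Variables (n : nat) (X : 'I_n -> {RV P >-> R}).

Lemma good_set_full (r0 : R) : (forall i, ('N[P]_+oo[EFin \o X i] <= r0%:E)%E) ->
  P (good_set X r0) = 1%E.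
Proof.
move=> h; have mD := measurable_good_set X r0.
have : {ae P, forall w i, `|X i w| <= r0}.
  apply: filter_forall => i; have := h i.
  have PT : (0 < P [set: T])%E by rewrite probability_setT.
  rewrite unlock PT => /ess_supP.
  by apply: filterS => w /=; rewrite lee_fin.
move=> h0.
have {}h0 : P (~` good_set X r0) = 0%E by apply/negligibleP => //; exact: measurableC.
by rewrite -[good_set _ _]setCK probability_setC ?h0 ?sube0//; exact: measurableC.
Qed.

Let S := relative_entropy (joint_distribution X) (product_of_marginals X).

(** For each real [t > - S], [mutual_info_sup] supplies a grid whose mutual information exceeds
    [- t], so eventually in [(m, delta)] both rates lie between [- S] and [t]. *)
Lemma I_eq_relative_entropy (E : forall N, nat -> R -> set {ffun 'I_n -> 'S_N}) (r0 : R) :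
  0 < r0 -> P (good_set X r0) = 1%E -> (forall i c, P [set w | X i w = c] = 0%E) ->
  sorted_microstates X E ->
  (forall m delta, 0 < delta -> (- S <= limn_einf (log_rate E m delta))%E) ->
  I_limsup E = S /\ I_liminf E = S.
Proof.
move=> r00 PD atl hE lo.
have FF : ProperFilter (filter_prod \oo (0 : R)^'+) by exact: filter_prod_proper.
have near_lo : \forall md \near filter_prod \oo (0 : R)^'+,
    (- S <= limn_einf (log_rate E md.1 md.2))%E.
  exists (setT, [set delta | 0 < delta]); last by move=> [m delta] [_ /= d0]; exact: lo.
  by split; [exact: filterT|exact: nbhs_right_gt].
have near_hi t : (- S < t%:E)%E -> \forall md \near filter_prod \oo (0 : R)^'+,
    (limn_esup (log_rate E md.1 md.2) <= t%:E)%E.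
  move=> St; have : ((- t)%:E < S)%E by rewrite EFinN lteNl.
  move=> /mutual_info_sup[K [c hc]].
  by have := log_rate_upper r00 PD atl hE hc; rewrite opprK.
split; rewrite /I_limsup /I_liminf -[RHS]oppeK; congr (- _)%E; apply: cvg_lim => //.
  apply: cvge_between => // t St; apply: filterS near_lo => md h.
  by rewrite (le_trans (ltW St))// (le_trans h)// limn_einf_sup.
apply: cvge_between => t St.
  by apply: filterS near_lo => md h; rewrite (le_trans (ltW St)).
by apply: filterS (near_hi t St) => md; apply: le_trans; exact: limn_einf_sup.
Qed.

End Conclusion.

Local Open Scope ereal_scope.

Theorem corollary1p7 (R : realType) (d : measure_display)
    (T : measurableType d) (P : probability T R) (n : nat)
    (X : 'I_n -> {RV P >-> R})
    (X_bounded : forall i, 'N[P]_+oo[EFin \o X i] < +oo)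
    (X_entropy : forall i, -oo < entropy (X i)) :
  let S := relative_entropy (joint_distribution X) (product_of_marginals X) in
  (forall r : \bar R, 0 < r -> (forall i, 'N[P]_+oo[EFin \o X i] <= r) ->
     I_sym X r = S /\ I_sym_bar X r = S) /\
  (forall xi : 'I_n -> forall N : nat, 'I_N -> R, approximates X xi ->
     I_sym_at X xi = S /\ I_sym_bar_at X xi = S).
Proof.
move=> S; have atl i c : P [set w | X i w = c] = 0 by exact: entropy_atomless.
(* A common bound for all variables; the added [1] keeps it positive even if they vanish or
   [n = 0]. *)
pose b : R := (\sum_i `|fine 'N[P]_+oo[EFin \o X i]| + 1)%R.
have b0 : (0 < b)%R by rewrite ltr_wpDl// sumr_ge0.
have hb i : 'N[P]_+oo[EFin \o X i] <= b%:E.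
  have Nfin : 'N[P]_+oo[EFin \o X i] \is a fin_num by rewrite ge0_fin_numE ?Lnorm_ge0.
  rewrite -(fineK Nfin) lee_fin /b (bigD1 i)//= -addrA (le_trans (ler_norm _))// lerDl.
  by rewrite addr_ge0// sumr_ge0.
have Pb := good_set_full hb.
split=> [r r0 hr|xi hxi].
  have sorted : sorted_microstates X (Delta_sym X r).
    by move=> N m delta s [x mx [hx _]]; exists x.
  (* A finite cutoff [r] serves as the bound itself, so that sampled entries respect it; for
     [r = +oo] the bound [b] will do. *)
  have [r1 [r10 r1r Pr]] : exists r1 : R, [/\ (0 < r1)%R, r1%:E <= r & P (good_set X r1) = 1].
    case: r r0 hr {sorted} => [r r0 hr|_ _|//].
      by exists r; split => //; exact: good_set_full.
    by exists b; split => //; rewrite leey.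
  apply: (I_eq_relative_entropy r10 Pr atl sorted) => m delta delta0.
  have := Delta_sym_lower r10 Pr m r1r delta0. exact.
apply: (I_eq_relative_entropy b0 Pb atl) => [N m delta s hs|m delta delta0].
  by exists (fun i => xi i N) => // i; have [+ _] := hxi i; exact.
exact: (Delta_sym_at_lower b0 Pb).
Qed.
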